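(* Let $1 \leq q \leq p < \infty$, let $u\colon \mathbb{D} \to \mathbb{C}$ and $\phi\colon \mathbb{D}\to\mathbb{D}$ be analytic, and suppose that $uC_\phi$ is bounded $H^p \to H^q$. If $u$ is not identically zero and $m(E_\phi) > 0$, then $uC_\phi$ fixes an isomorphic copy of $\ell^2$ in $H^p$, i.e., there is a closed subspace $M\subset H^p$ isomorphic to $\ell^2$ on which $uC_\phi$ is bounded below.
   Context: $\mathbb{D}$ is the open unit disc, $\mathbb{T}$ the unit circle with normalized Lebesgue measure $m$, and $H^p$ the classical Hardy space. The weighted composition operator is $(uC_\phi)f = u\cdot(f\circ\phi)$. The boundary contact set is $E_\phi = \{\zeta\in\mathbb{T} : |\phi(\zeta)|=1\}$, where $\phi(\zeta)$ denotes the radial limit (existing a.e.). *)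

(* Defs.v *)
From HB Require Import structures.
From mathcomp Require Import all_boot all_order all_algebra.
From mathcomp Require Import all_classical all_reals all_analysis.
From mathcomp Require Export complex.
Export Order.TTheory GRing.Theory Num.Theory.
Export numFieldNormedType.Exports.

Set Implicit Arguments.
Unset Strict Implicit.
Unset Printing Implicit Defensive.

Local Open Scope classical_set_scope.
Local Open Scope ring_scope.
Local Open Scope complex_scope.

Section HardyDefs.
Variable R : realType.
Local Notation C := R[i].

Definition cabs (z : C) : R := complex.Re `|z|.

Definition expi (t : R) : C := cos t +i* sin t.

Definition disc : set C := [set z | cabs z < 1].

Definition analytic_on_disc (f : C -> C) : Prop :=
  forall z : C, disc z -> derivable (f : C^o -> C^o) z 1.

Definition intmean (p : R) (f : C -> C) (r : R) : \bar R :=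
  ((2 * pi)^-1)%:E *
  (\int[lebesgue_measure]_(t in `[0%R, (2 * pi)%R[%classic)
      ((cabs (f (r%:C * expi t))) `^ p)%:E)%E.

Definition Hp_sup (p : R) (f : C -> C) : \bar R :=
  ereal_sup [set intmean p f r | r in `[0, 1[%classic].

Definition inHp (p : R) (f : C -> C) : Prop :=
  analytic_on_disc f /\ (Hp_sup p f < +oo)%E.

Definition Hnorm (p : R) (f : C -> C) : R := (fine (Hp_sup p f)) `^ p^-1.

Definition wcomp (u phi : C -> C) (f : C -> C) : C -> C :=
  fun z => u z * f (phi z).

Definition wcomp_bounded (p q : R) (u phi : C -> C) : Prop :=
  (forall f, inHp p f -> inHp q (wcomp u phi f)) /\
  exists K : R, forall f, inHp p f -> Hnorm q (wcomp u phi f) <= K * Hnorm p f.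

Definition radial_lim (f : C -> C) (t : R) (l : C) : Prop :=
  (fun r : R => (f (r%:C * expi t) : C^o)) @ at_left 1 --> (l : C^o).

(* boundary contact set E_phi = {zeta in T : |phi(zeta)| = 1}, zeta = e^{it},
   t in [0, 2pi), phi(zeta) being the radial limit (at points where it exists) *)
Definition contact_set (phi : C -> C) : set R :=
  [set t | `[0, 2 * pi[%classic t /\
           exists l : C, radial_lim phi t l /\ cabs l = 1].

(* normalized Lebesgue measure on the circle, transported to [0, 2pi) *)
Definition circ_measure (A : set R) : \bar R :=
  ((2 * pi)^-1)%:E * lebesgue_measure A.

Definition in_l2 (a : nat -> C) : Prop :=
  (\sum_(0 <= n <oo) ((cabs (a n)) ^+ 2)%:E < +oo)%E.

Definition l2norm (a : nat -> C) : R :=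
  Num.sqrt (fine (\sum_(0 <= n <oo) ((cabs (a n)) ^+ 2)%:E)%E).

Definition fixes_copy_of_l2 (p q : R) (u phi : C -> C) : Prop :=
  exists (M : set (C -> C)) (J : (nat -> C) -> (C -> C)),
    (forall a, in_l2 a -> inHp p (J a)) /\
    (forall a b, in_l2 a -> in_l2 b ->
       J (fun n => a n + b n) = (fun z => J a z + J b z)) /\
    (forall (c : C) a, in_l2 a ->
       J (fun n => c * a n) = (fun z => c * J a z)) /\
    M = J @` in_l2 /\
    (exists c1 c2 : R, 0 < c1 /\ 0 < c2 /\
       forall a, in_l2 a ->
         c1 * l2norm a <= Hnorm p (J a) /\ Hnorm p (J a) <= c2 * l2norm a) /\
    (* M is closed in H^p (functions being identified when equal on D) *)
    (forall (fs : nat -> C -> C) (f : C -> C),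
       (forall n, M (fs n)) -> inHp p f ->
       (fun n => Hnorm p (fun z => fs n z - f z)) @ \oo --> (0 : R) ->
       exists2 g, M g & forall z, disc z -> g z = f z) /\
    (exists delta : R, 0 < delta /\
       forall f, M f -> delta * Hnorm p f <= Hnorm q (wcomp u phi f)).

End HardyDefs.

(* Main.v *)
(* For exponents nk growing fast enough put J a = sum_k a_k z^(nk k).  If
   nk (k+1) > M nk k with 2 M >= p, the 2M-th moments of J a on the circles |z| = r
   are bounded by powers of the l2 norm of a, so J maps l2 boundedly into H^p; by
   Littlewood's subordination principle the fourth moments of J a o phi are bounded
   in the same way.  The powers phi^n tend weakly to 0 in L^2 and |phi| is close to 1
   on the contact set E, so for a sparse choice of nk the functions 1_E phi^(nk k)
   are almost orthogonal with norms bounded below, and the integral of |J a o phi|^2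
   over E dominates the square of the l2 norm of a.  Hence |J a o phi| is at least a
   multiple of that norm on a set of measure bounded below, on most of which |u| is
   not small (a truncated Jensen inequality), and u (J a o phi) is bounded below in
   H^q.  Since the operator is bounded, so is J a in H^p, and J embeds l2.  All the
   estimates are made on circles of radius r < 1, hence no boundary values are
   needed apart from the contact set. *)
Require Import Defs.
From HB Require Import structures.
From mathcomp Require Import all_boot all_order all_algebra.
From mathcomp Require Import all_classical all_reals all_analysis.
From mathcomp Require Import complex measurable_realfun ring lra.

Import Order.TTheory GRing.Theory Num.Theory numFieldNormedType.Exports.

Set Implicit Arguments.
Unset Strict Implicit.
Unset Printing Implicit Defensive.

Local Open Scope classical_set_scope.
Local Open Scope ring_scope.
Local Open Scope complex_scope.

(** * The modulus on R[i] *)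

(** Boundary functions are avoided by uniformity in the radius. For analytic f the k-th Fourier
    coefficient on |z| = r is r^k times a number independent of r ([negative_freq]), so what is
    known on |z| = 1/2 passes to every larger radius: the decay of the coefficients of phi^m,
    because |phi| is bounded there by some s < 1, and the lower bound for a coefficient of u that
    feeds Jensen's inequality. This dictates the order of the choices. The exponents come first,
    from thresholds valid for all radii in [1/2, 1); the radius comes last, depending on the number
    of terms, so close to 1 that even the largest power of |phi| in use is nearly 1 in mean on the
    contact set. A radius that varies does no harm, since the Hardy norm is a supremum over radii.
    The fourth moment turns a mean-square bound into a bound on a set of positive measure, which
    survives multiplication by u and passage to any exponent q >= 1. An isomorphic copy allows any
    constants: the triangle inequality of H^p is used up to a factor 4, and the modulus of a complex
    integral is estimated up to a factor 2. *)

Section ComplexModulus.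
Variable R : realType.
Local Notation C := R[i].
Implicit Types (z w : C) (x t : R).

Lemma cReD z w : complex.Re (z + w) = complex.Re z + complex.Re w.
Proof. by case: z w => [? ?] [? ?]. Qed.
Lemma cImD z w : complex.Im (z + w) = complex.Im z + complex.Im w.
Proof. by case: z w => [? ?] [? ?]. Qed.
Lemma cReN z : complex.Re (- z) = - complex.Re z. Proof. by case: z. Qed.
Lemma cImN z : complex.Im (- z) = - complex.Im z. Proof. by case: z. Qed.
Lemma cReM z w : complex.Re (z * w) =
  complex.Re z * complex.Re w - complex.Im z * complex.Im w.
Proof. by case: z w => [? ?] [? ?]. Qed.
Lemma cImM z w : complex.Im (z * w) =
  complex.Re z * complex.Im w + complex.Im z * complex.Re w.
Proof. by case: z w => [? ?] [? ?]. Qed.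
Lemma cReJ z : complex.Re (conjc z) = complex.Re z. Proof. by case: z. Qed.
Lemma cImJ z : complex.Im (conjc z) = - complex.Im z. Proof. by case: z. Qed.
Definition cE := (cReD, cImD, cReN, cImN, cReM, cImM, cReJ, cImJ).

Lemma complexP z w : complex.Re z = complex.Re w -> complex.Im z = complex.Im w ->
  z = w.
Proof. by case: z w => [? ?] [? ?] /= -> ->. Qed.

Lemma Re_sum I (s : seq I) (P : pred I) (F : I -> C) :
  complex.Re (\sum_(i <- s | P i) F i) = \sum_(i <- s | P i) complex.Re (F i).
Proof. by elim/big_rec2: _ => // i y z _ <-; rewrite cReD. Qed.
Lemma cabsE z : cabs z = Num.sqrt (complex.Re z ^+ 2 + complex.Im z ^+ 2).
Proof. by rewrite /cabs normc_def. Qed.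
Lemma normC_cabs z : `|z| = (cabs z)%:C.
Proof. by rewrite cabsE normc_def. Qed.
Lemma cabs_ge0 z : 0 <= cabs z. Proof. by rewrite cabsE sqrtr_ge0. Qed.
Lemma sqr_cabs z : cabs z ^+ 2 = complex.Re z ^+ 2 + complex.Im z ^+ 2.
Proof. by rewrite cabsE sqr_sqrtr// addr_ge0// sqr_ge0. Qed.
Lemma cabsM z w : cabs (z * w) = cabs z * cabs w.
Proof.
by apply: (@complexI R); rewrite -normC_cabs normrM !normC_cabs rmorphM.
Qed.
Lemma cabsD z w : cabs (z + w) <= cabs z + cabs w.
Proof. by rewrite -lecR rmorphD /= -!normC_cabs ler_normD. Qed.
Lemma cabsN z : cabs (- z) = cabs z. Proof. by rewrite /cabs normrN. Qed.
Lemma cabsB z w : cabs (z - w) <= cabs z + cabs w.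
Proof. by rewrite (le_trans (cabsD _ _))// cabsN. Qed.
Lemma cabsC z w : cabs (z - w) = cabs (w - z).
Proof. by rewrite /cabs distrC. Qed.
Lemma cabsJ z : cabs (conjc z) = cabs z.
Proof. by rewrite !cabsE cReJ cImJ sqrrN. Qed.
Lemma cabsR x : cabs x%:C = `|x|.
Proof. by rewrite cabsE /= expr0n addr0 sqrtr_sqr. Qed.
Lemma cabs0 : cabs (0 : C) = 0. Proof. by rewrite /cabs normr0. Qed.
Lemma cabs1 : cabs (1 : C) = 1. Proof. by rewrite /cabs normr1. Qed.
Lemma cabs_eq0 z : (cabs z == 0) = (z == 0).
Proof. by rewrite -[RHS]normr_eq0 normC_cabs fmorph_eq0. Qed.
Lemma cabs_gt0 z : (0 < cabs z) = (z != 0).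
Proof. by rewrite lt_def cabs_eq0 cabs_ge0 andbT. Qed.
Lemma cabsX z n : cabs (z ^+ n) = cabs z ^+ n.
Proof. by elim: n => [|n ih]; rewrite ?expr0 ?cabs1// !exprS cabsM ih. Qed.
Lemma cabsV z : cabs z^-1 = (cabs z)^-1.
Proof. by apply: (@complexI R); rewrite -normC_cabs normfV !normC_cabs fmorphV. Qed.
Lemma cabs_sum I (s : seq I) (P : pred I) (F : I -> C) :
  cabs (\sum_(i <- s | P i) F i) <= \sum_(i <- s | P i) cabs (F i).
Proof.
elim/big_rec2: _ => [|i y z _ h]; first by rewrite cabs0.
by rewrite (le_trans (cabsD _ _))// lerD2l.
Qed.
Lemma Re_le_cabs z : `|complex.Re z| <= cabs z.
Proof. by rewrite -lecR -normC_cabs normc_ge_Re. Qed.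
Lemma Im_le_cabs z : `|complex.Im z| <= cabs z.
Proof.
by rewrite cabsE -sqrtr_sqr ler_sqrt ?addr_ge0 ?sqr_ge0// lerDr sqr_ge0.
Qed.
Lemma cabs_le z : cabs z <= `|complex.Re z| + `|complex.Im z|.
Proof.
rewrite -(@ler_pXn2r _ 2) ?nnegrE ?addr_ge0 ?cabs_ge0// sqr_cabs.
rewrite sqrrD !real_normK ?num_real// lerD2r lerDl.
by rewrite mulrn_wge0// mulr_ge0.
Qed.
Lemma cabs_dist z w : `|cabs z - cabs w| <= cabs (z - w).
Proof.
rewrite ler_norml; apply/andP; split.
  by rewrite lerNl opprB lerBlDr cabsC -{1}(subrK z w) cabsD.
by rewrite lerBlDr -{1}(subrK w z) cabsD.
Qed.
Lemma mulCJ z : z * (conjc z) = ((cabs z) ^+ 2)%:C.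
Proof. by rewrite -sqr_normc normC_cabs rmorphXn. Qed.
Lemma sqr_cabsD z w : cabs (z + w) ^+ 2 =
  cabs z ^+ 2 + cabs w ^+ 2 + 2 * complex.Re ((conjc z) * w).
Proof. rewrite !sqr_cabs !cE; ring. Qed.

Lemma RCM x z : x%:C * z = (x * complex.Re z) +i* (x * complex.Im z).
Proof. by case: z => a b; apply: complexP; rewrite /= !mul0r ?subr0 ?addr0. Qed.

End ComplexModulus.

Section Expi.
Variable R : realType.
Local Notation C := R[i].
Implicit Types (z w : C) (s t : R).

Lemma cabs_expi t : cabs (expi t) = 1.
Proof. by rewrite cabsE /= cos2Dsin2 sqrtr1. Qed.
Lemma expiD s t : expi (s + t) = expi s * expi t.
Proof.
by apply: complexP; rewrite !cE/= ?cosD ?sinD//; ring.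
Qed.
Lemma expi0 : expi (0 : R) = 1.
Proof. by apply: complexP => /=; rewrite ?cos0 ?sin0. Qed.
Lemma expiN t : expi (- t) = conjc (expi t).
Proof. by apply: complexP => /=; rewrite ?cosN ?sinN. Qed.
Lemma expi_neq0 t : expi t != 0.
Proof. by rewrite -cabs_gt0 cabs_expi. Qed.
Lemma expiNV t : expi (- t) = (expi t)^-1.
Proof.
by apply: (mulIf (expi_neq0 t)); rewrite -expiD addNr expi0 mulVf// expi_neq0.
Qed.
Lemma expi_period t : expi (t + 2 * pi) = expi t.
Proof. by rewrite /expi mulr_natl cosD2pi sinD2pi. Qed.
Lemma expi2pi : expi (2 * pi : R) = 1.
Proof. by rewrite -[2 * pi]add0r expi_period expi0. Qed.
Lemma conjV_expi t : conjc (expi t) = (expi t)^-1.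
Proof. by rewrite -expiN expiNV. Qed.

End Expi.

Section ComplexContinuity.
Variable R : realType.
Local Notation C := R[i].

Lemma cvgCP (T : Type) (F : set_system T) (FF : Filter F) (f : T -> C) (l : C) :
  (f : T -> C^o) @ F --> (l : C^o) <->
  (forall e : R, 0 < e -> \forall x \near F, cabs (f x - l) < e).
Proof.
split=> [/cvgrPdist_lt h e e0|h].
  have := h e%:C; rewrite ltcR => /(_ e0); apply: filterS => x /=.
  by rewrite normC_cabs ltcR cabsC.
(* A positive element of [R[i]] has imaginary part 0, so real tolerances suffice. *)
apply/cvgrPdist_lt => -[e ei]; rewrite ltcE /= => /andP[/eqP -> e0].
near=> x; rewrite normC_cabs ltcE /= eqxx/= cabsC.
by near: x; exact: h.
Unshelve. all: by end_near. Qed.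

Lemma cvg_ReP (T : Type) (F : set_system T) (FF : Filter F) (f : T -> C) (l : C) :
  (f : T -> C^o) @ F --> (l : C^o) <->
  ((fun x => complex.Re (f x)) @ F --> complex.Re l /\
   (fun x => complex.Im (f x)) @ F --> complex.Im l).
Proof.
split=> [/cvgCP h|[/cvgrPdist_lt h1 /cvgrPdist_lt h2]].
  split; apply/cvgrPdist_lt => e e0; have := h e e0; apply: filterS => x hx /=.
    by apply: le_lt_trans hx; rewrite distrC -cReN -cReD Re_le_cabs.
  by apply: le_lt_trans hx; rewrite distrC -cImN -cImD Im_le_cabs.
apply/cvgCP => e e0; have e20 : 0 < e / 2 by rewrite divr_gt0.
near=> x; apply: (@lt_le_trans _ _ (e / 2 + e / 2)); last by lra.
rewrite (le_lt_trans (cabs_le _))// !cE.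
by rewrite ltrD// distrC; near: x; [exact: h1|exact: h2].
Unshelve. all: by end_near. Qed.

Lemma cvg_cabs (T : Type) (F : set_system T) (FF : Filter F) (f : T -> C) (l : C) :
  (f : T -> C^o) @ F --> (l : C^o) -> (fun x => cabs (f x)) @ F --> cabs l.
Proof.
move/cvgCP => h; apply/cvgrPdist_lt => e e0; have := h e e0; apply: filterS => x hx.
by apply: le_lt_trans hx; rewrite distrC cabs_dist.
Qed.

Lemma continuous_expi : continuous (@expi R : R -> C^o).
Proof.
by move=> t; apply/cvg_ReP; split; [exact: continuous_cos|exact: continuous_sin].
Qed.

Lemma continuous_circle (r : R) : continuous ((fun t => r%:C * expi t) : R -> C^o).
Proof.
move=> t; apply: (@cvgM C R (nbhs t) _ (fun=> r%:C) (@expi R)).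
  exact: cvg_cst.
exact: continuous_expi.
Qed.

Lemma cabs_circle (r t : R) : 0 <= r -> cabs (r%:C * expi t) = r.
Proof. by move=> r0; rewrite cabsM cabsR cabs_expi mulr1 ger0_norm. Qed.

End ComplexContinuity.

(** * Integrals of bounded measurable functions *)

Section BoundedMeasurable.
Variable R : realType.
Local Notation C := R[i].
Local Notation mu := (@lebesgue_measure R).
Implicit Types (D : set R) (f g : R -> R).

(* Bounded measurable integrands: integrable over every set of finite measure, and
   closed under all the pointwise operations used here. *)
Definition rbm D f := measurable_fun D f /\ exists B, forall x, D x -> `|f x| <= B.

Lemma rbm_cst D k : rbm D (fun=> k).
Proof. by split; [exact: measurable_cst|exists `|k|]. Qed.

Lemma eq_rbm D f g : (forall x, D x -> f x = g x) -> rbm D f -> rbm D g.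
Proof.
move=> fg [mf [B hB]]; split.
  by apply: eq_measurable_fun mf => x; rewrite inE => /fg.
by exists B => x Dx; rewrite -fg// hB.
Qed.

Lemma rbmD D f g : rbm D f -> rbm D g -> rbm D (fun x => f x + g x).
Proof.
move=> [mf [A hA]] [mg [B hB]]; split; first exact: measurable_funD.
by exists (A + B) => x Dx; rewrite (le_trans (ler_normD _ _))// lerD ?hA ?hB.
Qed.

Lemma rbmM D f g : rbm D f -> rbm D g -> rbm D (fun x => f x * g x).
Proof.
move=> [mf [A hA]] [mg [B hB]]; split; first exact: measurable_funM.
by exists (A * B) => x Dx; rewrite normrM ler_pM ?hA ?hB.
Qed.

Lemma rbmN D f : rbm D f -> rbm D (fun x => - f x).
Proof.
move=> [mf [A hA]]; split; first exact: measurableT_comp.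
by exists A => x Dx; rewrite normrN hA.
Qed.

Lemma rbmB D f g : rbm D f -> rbm D g -> rbm D (fun x => f x - g x).
Proof. by move=> hf hg; apply: rbmD => //; exact: rbmN. Qed.

Lemma rbmX D f n : rbm D f -> rbm D (fun x => f x ^+ n).
Proof.
move=> hf; elim: n => [|n ih].
  by under eq_fun do rewrite expr0; exact: rbm_cst.
by under eq_fun do rewrite exprS; exact: rbmM.
Qed.

Lemma rbm_sum D I (s : seq I) (P : pred I) (F : I -> R -> R) :
  (forall i, P i -> rbm D (F i)) -> rbm D (fun x => \sum_(i <- s | P i) F i x).
Proof.
move=> h; elim: s => [|i s ih].
  by apply: eq_rbm (rbm_cst D 0) => x _; rewrite big_nil.
case Pi: (P i); last by apply: eq_rbm ih => x _; rewrite big_cons Pi.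
by apply: eq_rbm (rbmD (h i Pi) ih) => x _; rewrite big_cons Pi.
Qed.

Lemma rbm_continuous D f (g : R -> R) : continuous g -> rbm D f ->
  rbm D (fun x => g (f x)).
Proof.
move=> cg [mf [B hB]]; split.
  by apply: measurableT_comp => //; exact: continuous_measurable_fun.
have [M [_ hM]] : bounded_set (g @` `[- B, B]).
  apply: compact_bounded; apply: continuous_compact.
    exact: continuous_subspaceT.
  exact: segment_compact.
exists (M + 1) => x Dx; apply: (hM (M + 1)); first by rewrite ltrDl.
by exists (f x) => //=; rewrite in_itv/= -ler_norml hB.
Qed.

Lemma rbm_norm D f : rbm D f -> rbm D (fun x => `|f x|).
Proof. by apply: rbm_continuous => x; exact: norm_continuous. Qed.

Lemma rbm_indic D E : measurable D -> measurable E -> rbm D (fun x => \1_E x).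
Proof.
move=> mD mE; split; first by apply: measurable_funTS; exact: measurable_indic.
by exists 1 => x _; rewrite indicE; case: (_ \in _); rewrite ?normr1 ?normr0.
Qed.

Lemma rbmS D D' f : measurable D -> D' `<=` D -> rbm D f -> rbm D' f.
Proof.
move=> mD DD' [mf [B hB]]; split; first exact: measurable_funS mf.
by exists B => x Dx; apply/hB/DD'.
Qed.

Lemma rbm_segment a b f : (forall x, a <= x <= b -> {for x, continuous f}) ->
  rbm `[a, b] f.
Proof.
move=> cf; have cf' : {within `[a, b], continuous f}.
  by apply: continuous_in_subspaceT => x; rewrite inE /= in_itv /= => /cf.
split; first exact: subspace_continuous_measurable_fun.
have [M [_ hM]] : bounded_set (f @` `[a, b]).
  by apply: compact_bounded; apply: continuous_compact => //; exact: segment_compact.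
exists (M + 1) => x Dx; apply: (hM (M + 1)); first by rewrite ltrDl.
by exists x.
Qed.

Section Fixed.
Variable D : set R.
Hypothesis mD : measurable D.
Hypothesis fD : (mu D < +oo)%E.

Lemma rbm_integrable f : rbm D f -> mu.-integrable D (EFin \o f).
Proof.
move=> [mf [B hB]]; apply: measurable_bounded_integrable => //.
by exists B; split; rewrite ?num_real// => M BM x Dx /=; rewrite (le_trans (hB _ _))// ltW.
Qed.

Lemma rintD f g : rbm D f -> rbm D g ->
  \int[mu]_(x in D) (f x + g x) = \int[mu]_(x in D) f x + \int[mu]_(x in D) g x.
Proof. by move=> hf hg; rewrite RintegralD//; exact: rbm_integrable. Qed.

Lemma rintB f g : rbm D f -> rbm D g ->
  \int[mu]_(x in D) (f x - g x) = \int[mu]_(x in D) f x - \int[mu]_(x in D) g x.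
Proof. by move=> hf hg; rewrite RintegralB//; exact: rbm_integrable. Qed.

Lemma rintZ f k : rbm D f ->
  \int[mu]_(x in D) (k * f x) = k * \int[mu]_(x in D) f x.
Proof. by move=> hf; rewrite RintegralZl//; exact: rbm_integrable. Qed.

Lemma rintN f : rbm D f -> \int[mu]_(x in D) (- f x) = - \int[mu]_(x in D) f x.
Proof.
move=> hf; rewrite -mulN1r -rintZ//.
by apply: eq_Rintegral => x _; rewrite mulN1r.
Qed.

Lemma rint_le f g : rbm D f -> rbm D g -> (forall x, D x -> f x <= g x) ->
  \int[mu]_(x in D) f x <= \int[mu]_(x in D) g x.
Proof. by move=> hf hg fg; apply: le_Rintegral => //; exact: rbm_integrable. Qed.

Lemma rint_norm f : rbm D f ->
  `|\int[mu]_(x in D) f x| <= \int[mu]_(x in D) `|f x|.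
Proof. by move=> hf; apply: le_normr_Rintegral => //; exact: rbm_integrable. Qed.

Lemma rint_cst k : \int[mu]_(x in D) k = k * fine (mu D).
Proof. by rewrite Rintegral_cst. Qed.

Lemma rint_sum I (s : seq I) (P : pred I) (F : I -> R -> R) :
  (forall i, P i -> rbm D (F i)) ->
  \int[mu]_(x in D) (\sum_(i <- s | P i) F i x) =
  \sum_(i <- s | P i) \int[mu]_(x in D) F i x.
Proof.
move=> h; elim: s => [|i s ih].
  rewrite big_nil -[RHS](mul0r (fine (mu D))) -rint_cst.
  by apply: eq_Rintegral => x _; rewrite big_nil.
rewrite big_cons -ih; case: ifP => Pi; last first.
  by apply: eq_Rintegral => x _; rewrite big_cons Pi.
rewrite -rintD; [|exact: h|exact: rbm_sum].
by apply: eq_Rintegral => x _; rewrite big_cons Pi.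
Qed.

Lemma rint_bound f B : rbm D f -> (forall x, D x -> `|f x| <= B) ->
  `|\int[mu]_(x in D) f x| <= B * fine (mu D).
Proof.
move=> hf hB; rewrite (le_trans (rint_norm hf))// -rint_cst.
by apply: rint_le => //; [exact: rbm_norm|exact: rbm_cst].
Qed.

Lemma rint_integral f : rbm D f ->
  (\int[mu]_(x in D) (f x)%:E)%E = (\int[mu]_(x in D) f x)%:E.
Proof.
by move=> hf; rewrite /Rintegral fineK// integrable_fin_num//; exact: rbm_integrable.
Qed.

End Fixed.

Definition cbm D (f : R -> C) :=
  rbm D (fun x => complex.Re (f x)) /\ rbm D (fun x => complex.Im (f x)).

Definition cint D (f : R -> C) : C :=
  (\int[mu]_(x in D) complex.Re (f x)) +i* (\int[mu]_(x in D) complex.Im (f x)).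

Implicit Types F G : R -> C.

Lemma cbm_cst D c : cbm D (fun=> c).
Proof. by split; exact: rbm_cst. Qed.

Lemma cbm_real D f : rbm D f -> cbm D (fun x => (f x)%:C).
Proof. by split => //=; exact: rbm_cst. Qed.

Lemma eq_cbm D F G : (forall x, D x -> F x = G x) -> cbm D F -> cbm D G.
Proof. by move=> FG [F1 F2]; split; [apply: eq_rbm F1|apply: eq_rbm F2] => x /FG ->. Qed.

Lemma cbmD D F G : cbm D F -> cbm D G -> cbm D (fun x => F x + G x).
Proof.
move=> [F1 F2] [G1 G2]; split.
  by under eq_fun do rewrite cReD; exact: rbmD.
by under eq_fun do rewrite cImD; exact: rbmD.
Qed.

Lemma cbmN D F : cbm D F -> cbm D (fun x => - F x).
Proof.
move=> [F1 F2]; split.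
  by under eq_fun do rewrite cReN; exact: rbmN.
by under eq_fun do rewrite cImN; exact: rbmN.
Qed.

Lemma cbmB D F G : cbm D F -> cbm D G -> cbm D (fun x => F x - G x).
Proof. by move=> hF hG; apply: cbmD => //; exact: cbmN. Qed.

Lemma cbmM D F G : cbm D F -> cbm D G -> cbm D (fun x => F x * G x).
Proof.
move=> [F1 F2] [G1 G2]; split.
  by under eq_fun do rewrite cReM; apply: rbmB; exact: rbmM.
by under eq_fun do rewrite cImM; apply: rbmD; exact: rbmM.
Qed.

Lemma cbmJ D F : cbm D F -> cbm D (fun x => conjc (F x)).
Proof.
move=> [F1 F2]; split; first by under eq_fun do rewrite cReJ.
by under eq_fun do rewrite cImJ; exact: rbmN.
Qed.

Lemma cbmX D F n : cbm D F -> cbm D (fun x => F x ^+ n).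
Proof.
move=> hf; elim: n => [|n ih].
  by under eq_fun do rewrite expr0; exact: cbm_cst.
by under eq_fun do rewrite exprS; exact: cbmM.
Qed.

Lemma cbm_sum D I (s : seq I) (P : pred I) (F : I -> R -> C) :
  (forall i, P i -> cbm D (F i)) -> cbm D (fun x => \sum_(i <- s | P i) F i x).
Proof.
move=> h; elim: s => [|i s ih].
  by apply: eq_cbm (cbm_cst D 0) => x _; rewrite big_nil.
case Pi: (P i); last by apply: eq_cbm ih => x _; rewrite big_cons Pi.
by apply: eq_cbm (cbmD (h i Pi) ih) => x _; rewrite big_cons Pi.
Qed.

Lemma rbm_cabs D F : cbm D F -> rbm D (fun x => cabs (F x)).
Proof.
move=> [F1 F2]; under eq_fun do rewrite cabsE.
apply: (@rbm_continuous _ _ Num.sqrt); first exact: sqrt_continuous.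
by apply: rbmD; exact: rbmX.
Qed.

Lemma cbmS D D' F : measurable D -> D' `<=` D -> cbm D F -> cbm D' F.
Proof. by move=> mD DD' [F1 F2]; split; exact: (rbmS mD DD'). Qed.

Lemma cbm_segment a b F :
  (forall x, a <= x <= b -> {for x, continuous (F : R -> C^o)}) ->
  cbm `[a, b] F.
Proof.
move=> cF; split; apply: rbm_segment => x xab; have /cvg_ReP[h1 h2] := cF x xab.
  exact: h1.
exact: h2.
Qed.

Section CFixed.
Variable D : set R.
Hypothesis mD : measurable D.
Hypothesis fD : (mu D < +oo)%E.

Lemma Re_cint F : complex.Re (cint D F) = \int[mu]_(x in D) complex.Re (F x).
Proof. by []. Qed.
Lemma eq_cint F G : (forall x, D x -> F x = G x) -> cint D F = cint D G.
Proof.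
by move=> FG; congr (_ +i* _); apply: eq_Rintegral => x; rewrite inE => /FG ->.
Qed.

Lemma cintD F G : cbm D F -> cbm D G ->
  cint D (fun x => F x + G x) = cint D F + cint D G.
Proof.
move=> [F1 F2] [G1 G2]; apply: complexP; rewrite !cE /= -rintD//;
by apply: eq_Rintegral => x _; rewrite !cE.
Qed.

Lemma cintN F : cbm D F -> cint D (fun x => - F x) = - cint D F.
Proof.
move=> [F1 F2]; apply: complexP; rewrite !cE /= -rintN//;
by apply: eq_Rintegral => x _; rewrite !cE.
Qed.

Lemma cintB F G : cbm D F -> cbm D G ->
  cint D (fun x => F x - G x) = cint D F - cint D G.
Proof. by move=> hF hG; rewrite cintD ?cintN//; exact: cbmN. Qed.

Lemma cintZ c F : cbm D F -> cint D (fun x => c * F x) = c * cint D F.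
Proof.
move=> [F1 F2]; apply: complexP; rewrite !cE /=.
  rewrite -!rintZ// -rintB//.
  - by apply: eq_Rintegral => x _; rewrite !cE.
  - by apply: rbmM => //; exact: rbm_cst.
  - by apply: rbmM => //; exact: rbm_cst.
rewrite -!rintZ// -rintD//.
- by apply: eq_Rintegral => x _; rewrite !cE.
- by apply: rbmM => //; exact: rbm_cst.
- by apply: rbmM => //; exact: rbm_cst.
Qed.

Lemma cintJ F : cbm D F -> cint D (fun x => conjc (F x)) = conjc (cint D F).
Proof.
move=> [F1 F2]; apply: complexP; rewrite !cE /= -?rintN//;
by apply: eq_Rintegral => x _; rewrite !cE.
Qed.

Lemma cint_cst c : cint D (fun=> c) = (fine (mu D))%:C * c.
Proof. by rewrite RCM /cint !rint_cst// ![fine _ * _]mulrC. Qed.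

Lemma cint_sum I (s : seq I) (P : pred I) (F : I -> R -> C) :
  (forall i, P i -> cbm D (F i)) ->
  cint D (fun x => \sum_(i <- s | P i) F i x) = \sum_(i <- s | P i) cint D (F i).
Proof.
move=> h; elim: s => [|i s ih].
  rewrite big_nil -[RHS](mulr0 (fine (mu D))%:C) -cint_cst.
  by apply: eq_cint => x _; rewrite big_nil.
rewrite big_cons -ih; case: ifP => Pi; last first.
  by apply: eq_cint => x _; rewrite big_cons Pi.
rewrite -cintD; [|exact: h|exact: cbm_sum].
by apply: eq_cint => x _; rewrite big_cons Pi.
Qed.

(* The factor 2 spares the polarization argument giving the sharp constant 1. *)
Lemma cabs_cint F : cbm D F ->
  cabs (cint D F) <= 2 * \int[mu]_(x in D) cabs (F x).
Proof.
move=> hF; have [F1 F2] := hF.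
rewrite (le_trans (cabs_le _))// mulr_natl mulr2n lerD//=.
  rewrite (le_trans (rint_norm mD fD F1))//.
  by apply: rint_le => //; [exact: rbm_norm|exact: rbm_cabs|move=> x _; exact: Re_le_cabs].
rewrite (le_trans (rint_norm mD fD F2))//.
by apply: rint_le => //; [exact: rbm_norm|exact: rbm_cabs|move=> x _; exact: Im_le_cabs].
Qed.

Lemma cint_bound F B : cbm D F -> (forall x, D x -> cabs (F x) <= B) ->
  cabs (cint D F) <= 2 * (B * fine (mu D)).
Proof.
move=> hF hB; rewrite (le_trans (cabs_cint hF))// ler_pM2l//.
rewrite (le_trans (ler_norm _))// rint_bound//; first exact: rbm_cabs.
by move=> x Dx; rewrite ger0_norm ?cabs_ge0// hB.
Qed.

End CFixed.

End BoundedMeasurable.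

(** * Cauchy's theorem on rectangles *)

Section Derivative.

(** The difference quotient with its denominator cleared. In this form the estimate includes h = 0
    and can be integrated or composed directly. *)
Lemma derivable_approxP (K : numFieldType) (f : K^o -> K^o) (z : K) :
  derivable f z 1 <-> exists l : K, forall e : K, 0 < e ->
    \forall h \near nbhs (0 : K^o), `|f (z + h) - f z - l * h| <= e * `|h|.
Proof.
split=> [/cvg_ex[/= l hl]|[l hl]].
  exists l => e e0; have /cvgrPdist_le/(_ _ e0) := hl.
  move/nbhs_ballP => [d /= d0 hd]; apply/nbhs_ballP; exists d => //= h hh.
  have [->|h0] := eqVneq h 0; first by rewrite addr0 mulr0 !subrr normr0 mulr0.
  have := hd h hh h0; rewrite /= [h *: _]mulr1 [h + z]addrC distrC => hh2.
  rewrite -ler_pdivrMr ?normr_gt0// -normf_div.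
  apply: le_trans hh2; rewrite le_eqVlt; apply/orP; left; apply/eqP; congr `|_|.
  by rewrite mulrBl mulfK// -[_ *: _]/(h^-1 * _) mulrC.
apply/cvg_ex; exists l; apply/cvgrPdist_le => e e0.
have /nbhs_ballP[d /= d0 hd] := hl e e0; apply/nbhs_ballP; exists d => //= h hh h0.
have := hd h hh; rewrite /= [h *: _]mulr1 [h + z]addrC distrC => hh2.
rewrite -ler_pdivrMr ?normr_gt0// -normf_div in hh2.
apply: le_trans hh2; rewrite le_eqVlt; apply/orP; left; apply/eqP; congr `|_|.
by rewrite mulrBl mulfK// -[_ *: _]/(h^-1 * _) mulrC.
Qed.

Variable R : realType.
Local Notation C := R[i].

Lemma nbhsC0P (P : C -> Prop) :
  (\forall h \near nbhs (0 : C^o), P h) <->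
  exists2 d : R, 0 < d & forall h : C, cabs h < d -> P h.
Proof.
split=> [/nbhs_ballP[[d di] /=]|[d d0 hd]].
  rewrite ltcE/= => /andP[/eqP -> d0] hd; exists d => // h hh.
  by apply: hd; rewrite -ball_normE /= sub0r normrN normC_cabs ltcR.
apply/nbhs_ballP; exists d%:C => /=; first by rewrite ltcR.
by move=> h; rewrite -ball_normE /= sub0r normrN normC_cabs ltcR => /hd.
Qed.

Lemma derivableCP (f : C -> C) (z : C) :
  derivable (f : C^o -> C^o) z 1 <-> exists l : C, forall e : R, 0 < e ->
    exists2 d : R, 0 < d & forall h : C, cabs h < d ->
      cabs (f (z + h) - f z - l * h) <= e * cabs h.
Proof.
split=> [/derivable_approxP[l hl]|[l hl]].
  exists l => e e0; have := hl e%:C; rewrite ltcR => /(_ e0)/nbhsC0P[d d0 hd].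
  by exists d => // h /hd; rewrite !normC_cabs -rmorphM lecR.
apply/derivable_approxP; exists l => -[e ei]; rewrite ltcE/= => /andP[/eqP-> e0].
have [d d0 hd] := hl e e0; apply/nbhsC0P; exists d => // h /hd hh.
by rewrite !normC_cabs complexr0 -rmorphM lecR.
Qed.

Lemma derivable_continuousC (f : C -> C) (z : C) :
  derivable (f : C^o -> C^o) z 1 -> {for z, continuous (f : C^o -> C^o)}.
Proof. by move=> /derivable1_diffP; exact: differentiable_continuous. Qed.

Lemma real_approx (f : R -> R) (x l : R) : is_derive x 1 f l ->
  forall e : R, 0 < e -> exists2 d : R, 0 < d &
    forall h : R, `|h| < d -> `|f (x + h) - f x - l * h| <= e * `|h|.
Proof.
move=> [df fl] e e0; have /cvgrPdist_le/(_ e e0) : (fun h : R =>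
    h^-1 *: ((f \o shift x) (h *: (1 : R)) - f x)) @ 0^' --> l.
  by rewrite -fl.
move/nbhs_ballP => [d /= d0 hd]; exists d => // h hh.
have [->|h0] := eqVneq h 0; first by rewrite addr0 mulr0 !subrr normr0 mulr0.
have := hd h; rewrite -ball_normE /= sub0r normrN => /(_ hh h0).
rewrite [h *: _]mulr1 [h + x]addrC distrC => hh2.
rewrite -ler_pdivrMr ?normr_gt0// -normf_div.
apply: le_trans hh2; rewrite le_eqVlt; apply/orP; left; apply/eqP; congr `|_|.
by rewrite mulrBl mulfK// -[_ *: _]/(h^-1 * _) mulrC.
Qed.

(** This is exp(x + iy). It pulls functions on the punctured disc back to rectangles, where circles
    around 0 become vertical segments. *)
Definition cexp (x y : R) : C := (expR x)%:C * expi y.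

Lemma cexpD x y x' y' : cexp (x + x') (y + y') = cexp x y * cexp x' y'.
Proof. by rewrite /cexp expRD expiD rmorphM /= mulrACA. Qed.

Lemma cexp_approx0 (e : R) : 0 < e -> exists2 d : R, 0 < d &
  forall a b : R, `|a| < d -> `|b| < d ->
    cabs (cexp a b - 1 - (a +i* b)) <= e * cabs (a +i* b).
Proof.
(* Below, the error is at most [6 * e' * (A + B)], and [A + B] is at most twice the modulus, whence
   the 12. The radius is also taken at most [e'], so that the product [A * B] counts as [e'] times a
   linear term. *)
move=> e0; have [e' [e'0 e'1 e'e]] : exists e' : R, [/\ 0 < e', e' <= 1 & 12 * e' <= e].
  exists (Num.min (e / 12) 1); split.
  - by rewrite lt_min divr_gt0//= ltr01.
  - by rewrite ge_min lexx orbT.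
  - by rewrite mulrC -ler_pdivlMr// ge_min lexx.
have [d1 d10 h1] := real_approx (is_derive_expR 0) e'0.
have [d2 d20 h2] := real_approx (is_derive_cos 0) e'0.
have [d3 d30 h3] := real_approx (is_derive_sin 0) e'0.
exists (Num.min (Num.min d1 d2) (Num.min d3 e')).
  by rewrite !lt_min d10 d20 d30.
move=> a b; rewrite !lt_min => /andP[/andP[a1 _] /andP[_ ae]].
move=> /andP[/andP[_ b2] /andP[b3 be]].
have {h1 a1} := h1 a a1; rewrite add0r expR0 mul1r => h1.
have {h2 b2} := h2 b b2; rewrite add0r cos0 sin0 oppr0 mul0r subr0 => h2.
have {h3 b3} := h3 b b3; rewrite add0r cos0 sin0 subr0 mul1r => h3.
set A := `|a| in h1 ae; set B := `|b| in h2 h3 be.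
have A0 : 0 <= A := normr_ge0 _. have B0 : 0 <= B := normr_ge0 _.
have AB : A + B <= 2 * cabs (a +i* b).
  have := Re_le_cabs (a +i* b); have := Im_le_cabs (a +i* b) => /=.
  by rewrite -/A -/B; lra.
have ea : `|expR a| <= 3.
  rewrite (_ : expR a = (expR a - 1 - a) + (1 + a)); last by ring.
  rewrite (le_trans (ler_normD _ _))// (le_trans (lerD h1 (ler_normD _ _)))//.
  rewrite normr1 -/A; nra.
have ea1 : `|expR a - 1| <= 2 * A.
  rewrite (_ : expR a - 1 = (expR a - 1 - a) + a); last by ring.
  rewrite (le_trans (ler_normD _ _))// -/A; nra.
rewrite (le_trans (cabs_le _))// /cexp !cE /= !mul0r subr0 addr0 oppr0 addr0.
have hR : `|expR a * cos b - 1 - a| <= e' * A + 2 * (e' * B).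
  rewrite (_ : _ - a = (expR a - 1 - a) * cos b + (1 + a) * (cos b - 1)); last by ring.
  rewrite (le_trans (ler_normD _ _))// lerD// normrM.
    rewrite -[leRHS]mulr1 ler_pM// ler_norml.
    by rewrite cos_geN1 cos_le1.
  rewrite ler_pM//.
  by rewrite (le_trans (ler_normD _ _))// normr1 -/A; lra.
have hI : `|expR a * sin b - b| <= 3 * (e' * B) + 2 * A * B.
  rewrite (_ : _ - b = expR a * (sin b - b) + (expR a - 1) * b); last by ring.
  by rewrite (le_trans (ler_normD _ _))// !normrM lerD// ler_pM.
rewrite (le_trans (lerD hR hI))//.
apply: (@le_trans _ _ (6 * e' * (A + B))); first nra.
apply: (@le_trans _ _ (6 * e' * (2 * cabs (a +i* b)))).
  by rewrite ler_pM2l// mulr_gt0.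
have := cabs_ge0 (a +i* b); nra.
Qed.

End Derivative.

(** * Repeated quartering of a rectangle *)

Section Bisection.
Variable R : realType.

Lemma nested_intervals (x w : nat -> R) :
  (forall n, x n <= x n.+1) -> (forall n, x n.+1 + w n.+1 <= x n + w n) ->
  (forall n, 0 <= w n) -> exists p, forall n, x n <= p <= x n + w n.
Proof.
move=> hx hxw hw.
have x_mono m n : (m <= n)%N -> x m <= x n.
  move=> /subnK <-; elim: (n - m)%N => [|k ih]; first by rewrite add0n.
  by rewrite addSn (le_trans ih).
have xw_mono m n : (m <= n)%N -> x n + w n <= x m + w m.
  move=> /subnK <-; elim: (n - m)%N => [|k ih]; first by rewrite add0n.
  by rewrite addSn (le_trans (hxw _)).
have ub n : ubound (range x) (x n + w n).
  move=> _ [m _ <-]; rewrite (@le_trans _ _ (x (maxn m n)))//.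
    by rewrite x_mono// leq_maxl.
  by rewrite (@le_trans _ _ (x (maxn m n) + w (maxn m n)))// ?lerDl// xw_mono// leq_maxr.
exists (sup (range x)) => n; apply/andP; split.
  by apply: ub_le_sup; [exists (x 0 + w 0); exact: ub|exists n].
by apply: ge_sup; [exists (x 0); exists 0|exact: ub].
Qed.

(** [Q x y w h] belongs to the rectangle with lower left corner (x, y), width w and height h. One of
    the four quarters carries at least a quarter of [Q]; iterating this gives nested rectangles that
    shrink to the point (p, q). *)
Lemma bisection (Q : R -> R -> R -> R -> R) (a b c d : R) :
  a <= b -> c <= d ->
  (forall x y w h, 0 <= w -> 0 <= h ->
    a <= x -> x + (w + w) <= b -> c <= y -> y + (h + h) <= d ->
    Q x y (w + w) (h + h) <=
      Q x y w h + Q (x + w) y w h + Q x (y + h) w h + Q (x + w) (y + h) w h) ->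
  exists p q, [/\ a <= p <= b, c <= q <= d & forall n, exists x y,
    [/\ a <= x, x + (b - a) / 2 ^+ n <= b, c <= y, y + (d - c) / 2 ^+ n <= d &
     [/\ x <= p <= x + (b - a) / 2 ^+ n, y <= q <= y + (d - c) / 2 ^+ n &
      Q a c (b - a) (d - c) <= 4 ^+ n * Q x y ((b - a) / 2 ^+ n) ((d - c) / 2 ^+ n)]]].
Proof.
move=> ab cd Qsub.
pose w n : R := (b - a) / 2 ^+ n; pose h n : R := (d - c) / 2 ^+ n.
have w0 n : 0 <= w n by rewrite /w divr_ge0 ?subr_ge0 ?exprn_ge0.
have h0 n : 0 <= h n by rewrite /h divr_ge0 ?subr_ge0 ?exprn_ge0.
have wS n : w n = w n.+1 + w n.+1.
  by rewrite /w exprS invfM; have := exprn_gt0 n (ltr0n R 2); lra.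
have hS n : h n = h n.+1 + h n.+1.
  by rewrite /h exprS invfM; have := exprn_gt0 n (ltr0n R 2); lra.
pose inv n (s : R * R) := [/\ a <= s.1, s.1 + w n <= b, c <= s.2, s.2 + h n <= d &
  Q a c (b - a) (d - c) <= 4 ^+ n * Q s.1 s.2 (w n) (h n)].
pose stp n (s s' : R * R) := [/\ inv n.+1 s', s.1 <= s'.1,
  s'.1 + w n.+1 <= s.1 + w n, s.2 <= s'.2 & s'.2 + h n.+1 <= s.2 + h n].
(* The invariant is a premise inside the existential, so that choice yields a total step function on
   which the recursion [s] can be based. *)
have next n s : exists s', inv n s -> stp n s s'.
  have [[h1 h2 h3 h4 h5]|ni] := pselect (inv n s); last by exists s.
  have wn := w0 n.+1; have hn := h0 n.+1.
  rewrite wS in h2 h5; rewrite hS in h4 h5.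
  have := Qsub s.1 s.2 _ _ wn hn h1 h2 h3 h4 => Qs.
  have : exists s', [/\ (s'.1 = s.1 \/ s'.1 = s.1 + w n.+1),
      (s'.2 = s.2 \/ s'.2 = s.2 + h n.+1) &
      Q s.1 s.2 (w n.+1 + w n.+1) (h n.+1 + h n.+1) <= 4 * Q s'.1 s'.2 (w n.+1) (h n.+1)].
    set Q0 := Q s.1 s.2 _ _ in Qs *.
    apply: contrapT => /forallNP nq.
    have n1 := nq (s.1, s.2); have n2 := nq (s.1 + w n.+1, s.2).
    have n3 := nq (s.1, s.2 + h n.+1); have n4 := nq (s.1 + w n.+1, s.2 + h n.+1).
    have {}n1 : 4 * Q s.1 s.2 (w n.+1) (h n.+1) < Q0.
      by rewrite ltNge; apply/negP => ?; apply: n1; split=> //=; tauto.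
    have {}n2 : 4 * Q (s.1 + w n.+1) s.2 (w n.+1) (h n.+1) < Q0.
      by rewrite ltNge; apply/negP => ?; apply: n2; split=> //=; tauto.
    have {}n3 : 4 * Q s.1 (s.2 + h n.+1) (w n.+1) (h n.+1) < Q0.
      by rewrite ltNge; apply/negP => ?; apply: n3; split=> //=; tauto.
    have {}n4 : 4 * Q (s.1 + w n.+1) (s.2 + h n.+1) (w n.+1) (h n.+1) < Q0.
      by rewrite ltNge; apply/negP => ?; apply: n4; split=> //=; tauto.
    lra.
  move=> [s' [e1 e2 hQ]]; exists s' => _.
  have h5' : Q a c (b - a) (d - c) <= 4 ^+ n.+1 * Q s'.1 s'.2 (w n.+1) (h n.+1).
    rewrite (le_trans h5)// exprSr -mulrA ler_pM2l// exprn_gt0//.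
  rewrite /stp /inv (wS n) (hS n); case: e1 => e1; case: e2 => e2;
    by rewrite ?e1 ?e2 in h5' *; do ?split => //=; lra.
pose s := fix s n := if n is m.+1 then sval (cid (next m (s m))) else (a, c).
have inv_s n : inv n (s n).
  elim: n => [|n ih].
    by rewrite /inv /w /h /= expr0 !divr1 mul1r; split => //; rewrite addrC subrK.
  by have [] := svalP (cid (next n (s n))) ih.
have stp_s n : stp n (s n) (s n.+1) by exact: svalP (cid (next n (s n))) (inv_s n).
have [p hp] : exists p, forall n, (s n).1 <= p <= (s n).1 + w n.
  by apply: nested_intervals => // n; have [] := stp_s n.
have [q hq] : exists q, forall n, (s n).2 <= q <= (s n).2 + h n.
  by apply: nested_intervals => // n; have [] := stp_s n.
exists p, q; split.
- by have := hp 0; rewrite /= /w expr0 divr1 addrC subrK.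
- by have := hq 0; rewrite /= /h expr0 divr1 addrC subrK.
move=> n; exists (s n).1, (s n).2; have [i1 i2 i3 i4 i5] := inv_s n.
by split=> //; split=> //.
Qed.

End Bisection.

(** * Goursat's theorem *)

Section Goursat.
Variable R : realType.
Local Notation C := R[i].
Local Notation mu := (@lebesgue_measure R).

Lemma measurable_cc (a b : R) : measurable (`[a, b] : set R).
Proof. exact: measurable_itv. Qed.
Lemma mu_cc_fin (a b : R) : (mu `[a, b] < +oo)%E.
Proof. by rewrite lebesgue_measure_itv/=; case: ifP => // _; rewrite -EFinB ltry. Qed.
Lemma fine_mu_cc (a b : R) : a <= b -> fine (mu `[a, b]) = b - a.
Proof.
move=> ab; rewrite lebesgue_measure_itv/= lte_fin; case: ltgtP ab => // -> _.
by rewrite subrr.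
Qed.

Lemma rint_split (f : R -> R) (a c b : R) : a <= c -> c <= b -> rbm `[a, b] f ->
  \int[mu]_(x in `[a, b]) f x =
  \int[mu]_(x in `[a, c]) f x + \int[mu]_(x in `[c, b]) f x.
Proof.
move=> ac cb hf.
have hi := rbm_integrable (measurable_cc a b) (mu_cc_fin a b) hf.
rewrite -(@Rintegral_itv_obnd_cbnd _ c).
  by rewrite -(@Rintegral_itvB _ f (BLeft a) (BRight b) c) ?bnd_simp// addrC subrK.
apply: integrableS hi => // x /=; rewrite !in_itv/= => /andP[cx ->].
by rewrite (le_trans ac)// ltW.
Qed.

Lemma cbm_sub (F : R -> C) (a b a' b' : R) : a <= a' -> b' <= b ->
  cbm `[a, b] F -> cbm `[a', b'] F.
Proof.
move=> h1 h2; apply: cbmS => // x /=; rewrite !in_itv/= => /andP[h3 h4].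
by rewrite (le_trans h1)//= (le_trans h4).
Qed.

Lemma cint_split (F : R -> C) (a c b : R) : a <= c -> c <= b -> cbm `[a, b] F ->
  cint `[a, b] F = cint `[a, c] F + cint `[c, b] F.
Proof.
by move=> ac cb [F1 F2]; apply: complexP; rewrite !cE /= -rint_split.
Qed.

Lemma cint_id (a b : R) : a <= b ->
  cint `[a, b] (fun t => t%:C) = ((b ^+ 2 - a ^+ 2) / 2)%:C.
Proof.
rewrite le_eqVlt => /predU1P[->|ab].
  apply: complexP => /=; rewrite set_itv1 Rintegral_set1// subrr mul0r//.
apply: complexP => /=; last first.
  by rewrite rint_cst// mul0r.
have cidn : continuous (fun t : R => t) by move=> t; exact: cvg_id.
rewrite /Rintegral (@continuous_FTC2 _ (fun t => t) (fun t => t ^+ 2 / 2))//=.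
- by rewrite mulrBl.
- exact: continuous_subspaceT.
- have cF : continuous (fun t : R => t ^+ 2 / 2).
    move=> t; apply: cvgM; last exact: cvg_cst.
    by under eq_fun do rewrite expr2; apply: cvgM; exact: cvg_id.
  split.
  + move=> x _; apply: derivableM; last exact: derivable_cst.
    exact: exprn_derivable.
  + by apply/cvg_at_right_filter/cF.
  + by apply/cvg_at_left_filter/cF.
move=> x _; rewrite derive1E.
rewrite deriveM//; last first.
rewrite derive_cst scaler0 add0r exp_derive.
by rewrite scaler1 scalerA mulVf ?scale1r ?pnatr_eq0// expr1.
Qed.

(** The counterclockwise integral of G dz along the boundary of [x1, x2] x [y1, y2]: dz is i dy on
    the vertical sides and dx on the horizontal ones. *)
Definition rectint (G : R -> R -> C) (x1 x2 y1 y2 : R) : C :=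
  'i%C * (cint `[y1, y2] (fun y => G x2 y) - cint `[y1, y2] (fun y => G x1 y))
  - (cint `[x1, x2] (fun x => G x y2) - cint `[x1, x2] (fun x => G x y1)).

Definition affine (p q : R) (k l : C) (x y : R) : C := k + l * ((x - p) +i* (y - q)).

Lemma cbm_id (a b : R) : cbm `[a, b] (fun t : R => t%:C).
Proof.
by apply: cbm_real; apply: rbm_segment => x _; exact: cvg_id.
Qed.

Lemma cint_affine (k l : C) (a b : R) : a <= b ->
  cint `[a, b] (fun t => k + l * t%:C) =
  (b - a)%:C * k + ((b ^+ 2 - a ^+ 2) / 2)%:C * l.
Proof.
move=> ab; have hm := measurable_cc a b; have hf := mu_cc_fin a b.
rewrite cintD ?cintZ//; [|exact: cbm_id|exact: cbm_cst|].
  by rewrite cint_cst// cint_id// fine_mu_cc// [l * _]mulrC.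
by apply: cbmM; [exact: cbm_cst|exact: cbm_id].
Qed.

Lemma rectint_affine p q k l (x1 x2 y1 y2 : R) : x1 <= x2 -> y1 <= y2 ->
  rectint (affine p q k l) x1 x2 y1 y2 = 0.
Proof.
move=> x12 y12; rewrite /rectint.
have hx x : cint `[y1, y2] (fun y => affine p q k l x y) =
  (y2 - y1)%:C * (k + l * ((x - p) +i* (- q))) +
  ((y2 ^+ 2 - y1 ^+ 2) / 2)%:C * (l * 'i%C).
  rewrite -cint_affine//; apply: eq_cint => y _; rewrite /affine.
  by apply: complexP; rewrite !cE/=; ring.
have hy y : cint `[x1, x2] (fun x => affine p q k l x y) =
  (x2 - x1)%:C * (k + l * ((- p) +i* (y - q))) +
  ((x2 ^+ 2 - x1 ^+ 2) / 2)%:C * l.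
  rewrite -cint_affine//; apply: eq_cint => x _; rewrite /affine.
  by apply: complexP; rewrite !cE/=; ring.
rewrite !hx !hy; case: k l {hx hy} => [k1 k2] [l1 l2].
by apply: complexP; rewrite !cE /=; ring.
Qed.

(** Complex differentiability at p + iq. That the linear part is multiplication by a single complex
    number [l] encodes the Cauchy-Riemann equations. *)
Definition rdiff (G : R -> R -> C) (p q : R) := exists l : C, forall e : R, 0 < e ->
  exists2 d : R, 0 < d & forall h k : R, `|h| < d -> `|k| < d ->
    cabs (G (p + h) (q + k) - G p q - l * (h +i* k)) <= e * cabs (h +i* k).

Variables (G : R -> R -> C) (a b c d : R).
Hypotheses (ab : a <= b) (cd : c <= d).
Hypothesis Gdiff : forall x y, a <= x <= b -> c <= y <= d -> rdiff G x y.

Let G_lip p q : a <= p <= b -> c <= q <= d -> forall e : R, 0 < e ->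
  exists2 dl, 0 < dl & forall h k : R, `|h| < dl -> `|k| < dl ->
    cabs (G (p + h) (q + k) - G p q) < e.
Proof.
move=> hp hq e e0; have [l hl] := Gdiff hp hq.
have [d1 d10 h1] := hl 1 ltr01.
pose K := 1 + cabs l; have K0 : 0 < K by rewrite ltr_pwDl// cabs_ge0.
exists (Num.min d1 (e / (3 * K))).
  by rewrite lt_min d10/= divr_gt0// mulr_gt0.
move=> h k; rewrite !lt_min => /andP[hh1 hh2] /andP[hk1 hk2].
have := h1 h k hh1 hk1; rewrite mul1r => hB.
have hC : cabs (h +i* k) <= `|h| + `|k| by have := cabs_le (h +i* k).
rewrite ltr_pdivlMr ?mulr_gt0// in hh2; rewrite ltr_pdivlMr ?mulr_gt0// in hk2.
rewrite -[X in cabs X](subrK (l * (h +i* k))).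
rewrite (le_lt_trans (cabsD _ _))// cabsM.
apply: (@le_lt_trans _ _ (K * cabs (h +i* k))).
  by rewrite /K mulrDl mul1r lerD2r.
apply: (@le_lt_trans _ _ (K * (`|h| + `|k|))); first by rewrite ler_pM2l.
nra.
Qed.

Let cG1 y : c <= y <= d -> cbm `[a, b] (fun x => G x y).
Proof.
move=> hy; apply: cbm_segment => x hx; apply/cvgCP => e e0.
have [dl dl0 h] := G_lip hx hy e0; apply/nbhs_ballP; exists dl => //= z.
move=> hz; have := h (z - x) 0.
by rewrite addr0 [x + _]addrC subrK distrC normr0; apply.
Qed.

Let cG2 x : a <= x <= b -> cbm `[c, d] (fun y => G x y).
Proof.
move=> hx; apply: cbm_segment => y hy; apply/cvgCP => e e0.
have [dl dl0 h] := G_lip hx hy e0; apply/nbhs_ballP; exists dl => //= z.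
move=> hz; have := h 0 (z - y).
by rewrite addr0 [y + _]addrC subrK distrC normr0; apply.
Qed.

(** Every inner edge is traversed twice, in opposite directions. *)
Let rectint_sub x y w h : 0 <= w -> 0 <= h ->
    a <= x -> x + (w + w) <= b -> c <= y -> y + (h + h) <= d ->
  rectint G x (x + (w + w)) y (y + (h + h)) =
  rectint G x (x + w) y (y + h) + rectint G (x + w) (x + w + w) y (y + h) +
  rectint G x (x + w) (y + h) (y + h + h) +
  rectint G (x + w) (x + w + w) (y + h) (y + h + h).
Proof.
move=> w0 h0 ax xb cy yd; rewrite /rectint.
have hx z : a <= z <= b -> cint `[y, y + (h + h)] (fun y => G z y) =
    cint `[y, y + h] (fun y => G z y) + cint `[y + h, y + h + h] (fun y => G z y).
  move=> hz; rewrite addrA; apply: cint_split; rewrite ?lerDl//.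
  by apply: cbm_sub (cG2 hz); lra.
have hy z : c <= z <= d -> cint `[x, x + (w + w)] (fun x => G x z) =
    cint `[x, x + w] (fun x => G x z) + cint `[x + w, x + w + w] (fun x => G x z).
  move=> hz; rewrite addrA; apply: cint_split; rewrite ?lerDl//.
  by apply: cbm_sub (cG1 hz); lra.
rewrite !hx ?hy; [|lra..]; rewrite !addrA; ring.
Qed.

(** Subtracting [A] is free because its boundary integral vanishes. Each side then contributes at
    most 2 B times its length, the 2 being that of [cint_bound]. *)
Let rectint_bound (A : R -> R -> C) x y w h B : 0 <= w -> 0 <= h ->
    a <= x -> x + w <= b -> c <= y -> y + h <= d ->
  (forall s, cbm `[a, b] (fun x => A x s)) -> (forall s, cbm `[c, d] (fun y => A s y)) ->
  (forall s t, x <= s <= x + w -> y <= t <= y + h -> cabs (G s t - A s t) <= B) ->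
  rectint A x (x + w) y (y + h) = 0 ->
  cabs (rectint G x (x + w) y (y + h)) <= 4 * B * (w + h).
Proof.
move=> w0 h0 ax xb cy yd A1 A2 hB A0.
have -> : rectint G x (x + w) y (y + h) =
    rectint (fun s t => G s t - A s t) x (x + w) y (y + h).
  rewrite -[LHS]subr0 -A0 /rectint.
  have hx z : a <= z <= b -> cint `[y, y + h] (fun t => G z t - A z t) =
      cint `[y, y + h] (fun t => G z t) - cint `[y, y + h] (fun t => A z t).
    move=> hz; apply: cintB; [exact: measurable_cc|exact: mu_cc_fin|..].
      by apply: cbm_sub (cG2 hz).
    by apply: cbm_sub (A2 z).
  have hy z : c <= z <= d -> cint `[x, x + w] (fun t => G t z - A t z) =
      cint `[x, x + w] (fun t => G t z) - cint `[x, x + w] (fun t => A t z).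
    move=> hz; apply: cintB; [exact: measurable_cc|exact: mu_cc_fin|..].
      by apply: cbm_sub (cG1 hz).
    by apply: cbm_sub (A1 z).
  rewrite !hx ?hy; [|lra..]; ring.
have bx z : x <= z <= x + w ->
    cabs (cint `[y, y + h] (fun t => G z t - A z t)) <= 2 * (B * h).
  move=> hz; have muE : fine (mu `[y, y + h]) = h.
    by rewrite fine_mu_cc ?lerDl// addrC addKr.
  rewrite -[X in B * X]muE.
  apply: cint_bound; [exact: measurable_cc|exact: mu_cc_fin|..].
    apply: cbmB; last exact: cbm_sub (A2 z).
    by apply: cbm_sub (cG2 _) => //; lra.
  by move=> t /=; rewrite in_itv/= => ht; exact: hB.
have by_ z : y <= z <= y + h ->
    cabs (cint `[x, x + w] (fun t => G t z - A t z)) <= 2 * (B * w).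
  move=> hz; have muE : fine (mu `[x, x + w]) = w.
    by rewrite fine_mu_cc ?lerDl// addrC addKr.
  rewrite -[X in B * X]muE.
  apply: cint_bound; [exact: measurable_cc|exact: mu_cc_fin|..].
    apply: cbmB; last exact: cbm_sub (A1 z).
    by apply: cbm_sub (cG1 _) => //; lra.
  by move=> t /=; rewrite in_itv/= => ht; exact: hB.
rewrite /rectint (le_trans (cabsB _ _))// cabsM.
have -> : cabs ('i%C : C) = 1 by rewrite cabsE/= expr0n expr1n add0r sqrtr1.
rewrite mul1r (_ : 4 * B * (w + h) =
  (2 * (B * h) + 2 * (B * h)) + (2 * (B * w) + 2 * (B * w))); last by ring.
apply: lerD; apply: (le_trans (cabsB _ _)); apply: lerD.
- by apply: bx; lra.
- by apply: bx; lra.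
- by apply: by_; lra.
- by apply: by_; lra.
Qed.

Theorem goursat : rectint G a b c d = 0.
Proof.
pose Q x y w h : R := cabs (rectint G x (x + w) y (y + h)).
have [//|p [q [hp hq hn]]] := @bisection _ Q a b c d ab cd.
  move=> x y w h w0 h0 ax xb cy yd; rewrite /Q rectint_sub//.
  apply: (le_trans (cabsD _ _)); rewrite lerD2r.
  apply: (le_trans (cabsD _ _)); rewrite lerD2r.
  exact: cabsD.
apply/eqP; rewrite -cabs_eq0 eq_le cabs_ge0 andbT.
have -> : cabs (rectint G a b c d) = Q a c (b - a) (d - c).
  by rewrite /Q ![_ + (_ - _)]addrC !subrK.
pose L := b - a + (d - c); have L0 : 0 <= L by rewrite addr_ge0 ?subr_ge0.
apply/ler_addgt0Pl => e e0; rewrite addr0.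
(* [L] is half the perimeter. On the n-th rectangle the integral is at most [4 * e'] times the
   square of [L / 2 ^+ n], so the factor [4 ^+ n] of the bisection cancels and [4 * e' * L ^+ 2]
   remains. Dividing by [L + 1] covers the degenerate case L = 0. *)
pose e' := e / (4 * (L + 1) ^+ 2).
have L1 : 0 < L + 1 by rewrite ltr_wpDl.
have e'0 : 0 < e' by rewrite divr_gt0// mulr_gt0// exprn_gt0.
have [l hl] := Gdiff hp hq; have [dl dl0 hdl] := hl e' e'0.
have [n hnL] : exists n, L / 2 ^+ n < dl.
  have : (fun n => L / 2 ^+ n) @ \oo --> (0 : R).
    rewrite -(mulr0 L); apply: cvgM; first exact: cvg_cst.
    under eq_fun do rewrite -exprVn.
    by apply: cvg_expr; rewrite ger0_norm ?invr_ge0// invf_lt1 ?ltr1n.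
  move=> /cvgrPdist_lt/(_ _ dl0)[N _ /(_ N (leqnn N))].
  by rewrite sub0r normrN => hN; exists N; rewrite (le_lt_trans (ler_norm _)).
have [x [y [ax xb cy yd [xp yq hQ]]]] := hn n.
set w := (b - a) / 2 ^+ n in xb xp hQ; set h := (d - c) / 2 ^+ n in yd yq hQ.
have n2 : 0 < 2 ^+ n :> R by rewrite exprn_gt0.
have w0 : 0 <= w by rewrite divr_ge0 ?subr_ge0// ltW.
have h0 : 0 <= h by rewrite divr_ge0 ?subr_ge0// ltW.
have wh : w + h = L / 2 ^+ n by rewrite /w /h -mulrDl.
rewrite (le_trans hQ)//.
have hb : Q x y w h <= 4 * (e' * (w + h)) * (w + h).
  apply: (rectint_bound (A := affine p q (G p q) l)) => //.
  - move=> s; apply: cbm_segment => t _; rewrite /affine.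
    apply: cvgD; first exact: cvg_cst.
    apply: (@cvgM C R (nbhs t) _ (fun=> l)); first exact: cvg_cst.
    by apply/cvg_ReP; split => /=; [apply: cvgB; [exact: cvg_id|exact: cvg_cst]|exact: cvg_cst].
  - move=> s; apply: cbm_segment => t _; rewrite /affine.
    apply: cvgD; first exact: cvg_cst.
    apply: (@cvgM C R (nbhs t) _ (fun=> l)); first exact: cvg_cst.
    by apply/cvg_ReP; split => /=; [exact: cvg_cst|apply: cvgB; [exact: cvg_id|exact: cvg_cst]].
  - move=> s t hs ht.
    have sp : `|s - p| <= w by rewrite ler_norml; lra.
    have tq : `|t - q| <= h by rewrite ler_norml; lra.
    have := hdl (s - p) (t - q); rewrite ![_ + (_ - _)]addrC !subrK.
    move=> /(_ _ _)/le_trans; rewrite /affine opprD addrA; apply; [lra|lra|].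
    rewrite ler_pM2l// (le_trans (cabs_le _))//= lerD//.
  - by rewrite rectint_affine ?lerDl.
have {}hQ : 4 ^+ n * Q x y w h <= 4 * e' * L ^+ 2.
  apply: (@le_trans _ _ (4 ^+ n * (4 * (e' * (w + h)) * (w + h)))).
    by rewrite ler_pM2l// exprn_gt0.
  have -> : (4 : R) ^+ n = 2 ^+ n * 2 ^+ n.
    by rewrite -exprMn; congr (_ ^+ _); ring.
  rewrite wh; move: (2 ^+ n) n2 => N N0.
  rewrite le_eqVlt; apply/orP; left; apply/eqP.
  by field; rewrite gt_eqF.
rewrite (le_trans hQ)// /e' (_ : _ * L ^+ 2 = e * (L ^+ 2 / (L + 1) ^+ 2)).
  rewrite ler_piMr ?(ltW e0)// ler_pdivrMr ?exprn_gt0// mul1r.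
  by rewrite ler_pXn2r ?nnegrE// ?lerDl// ltW.
by field; rewrite gt_eqF.
Qed.

End Goursat.

(** * Mean values and Fourier coefficients on circles *)

Section Circle.
Variable R : realType.
Local Notation C := R[i].
Local Notation mu := (@lebesgue_measure R).

Definition circ : set R := `[0, 2 * pi[.

Lemma twopi_gt0 : 0 < 2 * pi :> R.
Proof. by rewrite mulr_gt0// pi_gt0. Qed.
Lemma measurable_circ : measurable circ.
Proof. exact: measurable_itv. Qed.
Lemma mu_circ : mu circ = (2 * pi)%:E.
Proof. by rewrite /circ lebesgue_measure_itv/= lte_fin twopi_gt0 oppr0 addr0. Qed.
Lemma mu_circ_fin : (mu circ < +oo)%E.
Proof. by rewrite mu_circ ltry. Qed.
Lemma fine_mu_circ : fine (mu circ) = 2 * pi.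
Proof. by rewrite mu_circ. Qed.

Lemma circ_sub_cc : circ `<=` `[0, 2 * pi].
Proof. by move=> x; rewrite /circ/= !in_itv/= => /andP[-> /ltW ->]. Qed.

Lemma cbm_circ (F : R -> C) : continuous (F : R -> C^o) -> cbm circ F.
Proof.
move=> cF; apply: (@cbmS _ `[0, 2 * pi]) => //; first exact: circ_sub_cc.
by apply: cbm_segment => x _; exact: cF.
Qed.

Lemma rbm_circ (f : R -> R) : continuous f -> rbm circ f.
Proof.
move=> cF; apply: (@rbmS _ `[0, 2 * pi]) => //; first exact: circ_sub_cc.
by apply: rbm_segment => x _; exact: cF.
Qed.

Lemma cint_circE (F : R -> C) : cbm `[0, 2 * pi] F ->
  cint circ F = cint `[0, 2 * pi] F.
Proof.
move=> [F1 F2].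
have h (f : R -> R) : rbm `[0, 2 * pi] f ->
    \int[mu]_(x in circ) f x = \int[mu]_(x in `[0, 2 * pi]) f x.
  move=> hf; apply: Rintegral_itv_bndo_bndc.
  have hi := rbm_integrable (measurable_cc 0 (2 * pi)) (mu_cc_fin 0 (2 * pi)) hf.
  by apply: integrableS hi => //; exact: circ_sub_cc.
by apply: complexP => /=; exact: h.
Qed.

Lemma rdiff_cexp (F : C -> C) (x y : R) :
  derivable (F : C^o -> C^o) (cexp x y) 1 -> rdiff (fun s t => F (cexp s t)) x y.
Proof.
move=> /derivableCP[l hl]; have [z zdef] : exists z, z = cexp x y by exists (cexp x y).
rewrite -zdef in hl.
have z0 : 0 < cabs z.
  by rewrite zdef /cexp cabsM cabs_expi mulr1 cabsR normr_gt0 gt_eqF// expR_gt0.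
exists (l * z) => e e0.
(* Chain rule: with [E = cexp h k - 1] the increment of exp is [z * E], and |E| <= 2 |w|. The error
   of F contributes the 2, the error of exp the [cabs l]. *)
pose K := cabs z * (2 + cabs l); have K0 : 0 < K.
  by rewrite mulr_gt0// ltr_pwDl// cabs_ge0.
have [e1 [e10 e11 e1K]] : exists e1 : R, [/\ 0 < e1, e1 <= 1 & K * e1 <= e].
  exists (Num.min 1 (e / K)); split.
  - by rewrite lt_min ltr01 divr_gt0.
  - by rewrite ge_min lexx.
  - by rewrite mulrC -ler_pdivlMr// ge_min lexx orbT.
have [d1 d10 h1] := hl e1 e10; have [d2 d20 h2] := cexp_approx0 e10.
pose d := Num.min d2 (d1 / (4 * cabs z)); exists d.
  by rewrite lt_min d20/= divr_gt0// mulr_gt0.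
move=> h k; rewrite !lt_min => /andP[hd1 hd2] /andP[kd1 kd2].
set w := h +i* k.
have hw : cabs w <= `|h| + `|k| by have := cabs_le w.
have {}h2 := h2 h k hd1 kd1; rewrite -/w in h2.
pose E := cexp h k - 1.
have hE : cabs E <= 2 * cabs w.
  rewrite -[E](subrK w) (le_trans (cabsD _ _))// (_ : 2 = 1 + 1 :> R)// mulrDl mul1r.
  by rewrite lerD// (le_trans h2)// ler_piMl// cabs_ge0.
have -> : cexp (x + h) (y + k) = z + z * E by rewrite cexpD -zdef /E; ring.
rewrite -zdef.
have zE : cabs (z * E) < d1.
  rewrite cabsM; rewrite ltr_pdivlMr ?mulr_gt0// in hd2.
  rewrite ltr_pdivlMr ?mulr_gt0// in kd2; have := cabs_ge0 w; nra.
have {}h1 := h1 _ zE.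
have -> : F (z + z * E) - F z - l * z * w =
  (F (z + z * E) - F z - l * (z * E)) + l * z * (E - w) by ring.
rewrite (le_trans (cabsD _ _))//.
apply: (@le_trans _ _ (e1 * (cabs z * (2 * cabs w)) + cabs l * cabs z * (e1 * cabs w))).
  rewrite lerD//; last by rewrite !cabsM ler_wpM2l// mulr_ge0// cabs_ge0.
  by rewrite (le_trans h1)// ler_pM2l// cabsM ler_pM2l.
rewrite (_ : _ + _ = K * e1 * cabs w); last by rewrite /K; ring.
by rewrite ler_wpM2r// cabs_ge0.
Qed.

Lemma cexp_ln (r t : R) : 0 < r -> cexp (ln r) t = r%:C * expi t.
Proof. by move=> r0; rewrite /cexp lnK. Qed.

(* Cauchy's theorem for F o exp on a rectangle [ln r, ln s] x [0, 2 pi]; leaving 0 out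
   of the hypothesis allows F to be an analytic function divided by a power of z. *)
Lemma circle_const (F : C -> C) :
  (forall z : C, 0 < cabs z < 1 -> derivable (F : C^o -> C^o) z 1) ->
  forall r s : R, 0 < r < 1 -> 0 < s < 1 ->
  cint circ (fun t => F (r%:C * expi t)) = cint circ (fun t => F (s%:C * expi t)).
Proof.
move=> dF; suff main (r s : R) : 0 < r -> r <= s -> s < 1 ->
    cint circ (fun t => F (r%:C * expi t)) = cint circ (fun t => F (s%:C * expi t)).
  move=> r s /andP[r0 r1] /andP[s0 s1].
  by have [rs|/ltW sr] := leP r s; [exact: main|symmetry; exact: main].
move=> r0 rs s1; have s0 := lt_le_trans r0 rs; have r1 := le_lt_trans rs s1.
have crc (x : R) : 0 < x < 1 -> continuous ((fun t : R => F (x%:C * expi t)) : R -> C^o).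
  move=> /andP[x0 x1] t; apply: (@continuous_comp R C^o C^o (fun t : R => x%:C * expi t) F t).
    exact: continuous_circle.
  by apply: derivable_continuousC; apply: dF; rewrite cabs_circle ?x0 ?x1// ltW.
have ec (x : R) : 0 < x < 1 -> cint circ (fun t => F (x%:C * expi t)) =
    cint `[0, 2 * pi] (fun t => F (cexp (ln x) t)).
  move=> x01; have /andP[x0 x1] := x01.
  rewrite cint_circE; last by apply: cbm_segment => t _; exact: crc.
  by apply: eq_cint => t _; rewrite cexp_ln.
have hr : 0 < r < 1 by rewrite r0 r1.
have hs : 0 < s < 1 by rewrite s0 s1.
rewrite (ec _ hr) (ec _ hs); apply/eqP; rewrite eq_sym -subr_eq0.
have lnrs : ln r <= ln s by rewrite ler_ln.
have h2pi : 0 <= 2 * pi :> R by rewrite ltW// twopi_gt0.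
have := @goursat R (fun s t => F (cexp s t)) (ln r) (ln s) 0 (2 * pi) lnrs h2pi.
move=> /(_ _)/wrap[].
  move=> x y /andP[_ xs] _; apply: rdiff_cexp; apply: dF.
  rewrite /cexp cabsM cabs_expi mulr1 cabsR ger0_norm ?expR_ge0// expR_gt0/=.
  by rewrite expR_lt1 (le_lt_trans xs)// ln_lt0// s0.
(* The horizontal sides cancel because exp has period 2 pi i; the vertical sides are the two circle
   integrals. *)
rewrite /rectint [X in _ - X](_ : _ = 0) ?subr0.
  by move=> /eqP; rewrite mulf_eq0 => /orP[|//]; rewrite eq_complex/= oner_eq0 andbF.
apply/eqP; rewrite subr_eq0; apply/eqP; apply: eq_cint => x _.
by rewrite /cexp expi2pi expi0.
Qed.

Lemma analytic_cst (c : C) : analytic_on_disc (fun=> c).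
Proof. by move=> z _; exact: derivable_cst. Qed.
Lemma analytic_id : analytic_on_disc (fun z : C => z).
Proof. by move=> z _; exact: derivable_id. Qed.
Lemma analyticD (f g : C -> C) : analytic_on_disc f -> analytic_on_disc g ->
  analytic_on_disc (fun z => f z + g z).
Proof. by move=> hf hg z dz; apply: derivableD; [exact: hf|exact: hg]. Qed.
Lemma analyticN (f : C -> C) : analytic_on_disc f -> analytic_on_disc (fun z => - f z).
Proof. by move=> hf z dz; apply: derivableN; exact: hf. Qed.
Lemma analyticM (f g : C -> C) : analytic_on_disc f -> analytic_on_disc g ->
  analytic_on_disc (fun z => f z * g z).
Proof. by move=> hf hg z dz; apply: derivableM; [exact: hf|exact: hg]. Qed.
Lemma analyticX (f : C -> C) n : analytic_on_disc f ->
  analytic_on_disc (fun z => f z ^+ n).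
Proof.
move=> hf; elim: n => [|n ih].
  by under eq_fun do rewrite expr0; exact: analytic_cst.
by under eq_fun do rewrite exprS; exact: analyticM.
Qed.
Lemma analytic_sum I (s : seq I) (P : pred I) (F : I -> C -> C) :
  (forall i, P i -> analytic_on_disc (F i)) ->
  analytic_on_disc (fun z => \sum_(i <- s | P i) F i z).
Proof.
move=> h; elim: s => [|i s ih].
  rewrite (_ : (fun z => _) = fun=> 0); first exact: analytic_cst.
  by apply/funext => z; rewrite big_nil.
case Pi: (P i); last first.
  by rewrite (_ : (fun z => _) = (fun z => \sum_(j <- s | P j) F j z))//;
    apply/funext => z; rewrite big_cons Pi.
rewrite (_ : (fun z => _) = (fun z => F i z + \sum_(j <- s | P j) F j z)).
  exact: (@analyticD (F i) (fun z => \sum_(j <- s | P j) F j z) (h i Pi) ih).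
by apply/funext => z; rewrite big_cons Pi.
Qed.

Lemma discE (z : C) : disc z = (cabs z < 1) :> Prop.
Proof. by []. Qed.
Lemma disc0 : disc (0 : C). Proof. by rewrite discE cabs0. Qed.

Lemma disc_circle (r t : R) : 0 <= r < 1 -> disc (r%:C * expi t).
Proof. by move=> /andP[r0 r1]; rewrite discE cabs_circle. Qed.

Lemma analytic_circle (f : C -> C) (r : R) : analytic_on_disc f -> 0 <= r < 1 ->
  continuous ((fun t : R => f (r%:C * expi t)) : R -> C^o).
Proof.
move=> hf hr t; apply: (@continuous_comp R C^o C^o (fun t : R => r%:C * expi t) f t).
  exact: continuous_circle.
by apply: derivable_continuousC; apply: hf; exact: disc_circle.
Qed.

Lemma cbm_analytic (f : C -> C) (r : R) : analytic_on_disc f -> 0 <= r < 1 ->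
  cbm circ (fun t : R => f (r%:C * expi t)).
Proof. by move=> hf hr; apply: cbm_circ; exact: analytic_circle. Qed.

(** The integral does not change when the circle shrinks, and by continuity at 0 it tends to 2 pi
    f(0). *)
Lemma mean_value (f : C -> C) (r : R) : analytic_on_disc f -> 0 <= r < 1 ->
  cint circ (fun t => f (r%:C * expi t)) = (2 * pi)%:C * f 0.
Proof.
move=> hf /andP[]; rewrite le_eqVlt => /predU1P[<- _|r0 r1].
  rewrite -fine_mu_circ -cint_cst//; last exact: measurable_circ.
  by apply: eq_cint => t _; rewrite mul0r.
apply/eqP; rewrite -subr_eq0 -cabs_eq0 eq_le cabs_ge0 andbT.
apply/ler_addgt0Pl => e e0; rewrite addr0.
pose e' := e / (2 * (2 * pi)).
have e'0 : 0 < e' by rewrite divr_gt0// mulr_gt0// twopi_gt0.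
have /cvgCP/(_ e' e'0)/nbhs_ballP[] := derivable_continuousC (hf 0 disc0).
move=> [d di]/=; rewrite ltcE/= => /andP[/eqP -> d0] hd.
pose s := Num.min (d / 2) (1 / 2).
have s0 : 0 < s by rewrite lt_min !divr_gt0.
have s1 : s < 1 by rewrite gt_min; apply/orP; right; lra.
have sd : s < d by rewrite gt_min; apply/orP; left; lra.
rewrite (@circle_const f _ r s) ?r0 ?s0//; last first.
  by move=> z /andP[_ z1]; exact: hf.
rewrite -fine_mu_circ -cint_cst//; last exact: measurable_circ.
have mc := measurable_circ; have fc := mu_circ_fin.
have cs : cbm circ (fun t : R => f (s%:C * expi t)).
  by apply: cbm_analytic => //; rewrite s1 (ltW s0).
rewrite -cintB//; last exact: cbm_cst.
have -> : e = 2 * (e' * fine (mu circ)).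
  rewrite fine_mu_circ /e'; move: (2 * pi) twopi_gt0 => P P0.
  by field; rewrite gt_eqF.
apply: cint_bound => //.
  by apply: cbmB => //; exact: cbm_cst.
move=> t _; apply: ltW; apply: hd.
by rewrite -ball_normE/= sub0r normrN normC_cabs complexr0 ltcR cabs_circle// ltW.
Qed.

(** The mean value property for f z^(k+1), which vanishes at 0. *)
Lemma positive_freq (f : C -> C) (r : R) k : analytic_on_disc f -> 0 < r < 1 ->
  cint circ (fun t => f (r%:C * expi t) * expi t ^+ k.+1) = 0.
Proof.
move=> hf /andP[r0 r1]; have mc := measurable_circ; have fc := mu_circ_fin.
have hr : 0 <= r < 1 by rewrite r1 (ltW r0).
have := mean_value (@analyticM f (fun z => z ^+ k.+1) hf
  (@analyticX (fun z => z) k.+1 (@analytic_id))) hr.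
rewrite expr0n !mulr0.
have cf : cbm circ (fun t : R => f (r%:C * expi t) * expi t ^+ k.+1).
  apply: cbmM; first by apply: cbm_analytic; rewrite // r1 (ltW r0).
  by apply: cbmX; apply: cbm_circ; exact: continuous_expi.
have -> : cint circ (fun t : R => f (r%:C * expi t) * (r%:C * expi t) ^+ k.+1) =
   r%:C ^+ k.+1 * cint circ (fun t => f (r%:C * expi t) * expi t ^+ k.+1).
  by rewrite -cintZ//; apply: eq_cint => t _; rewrite exprMn; ring.
move=> /eqP; rewrite mulf_eq0 => /orP[|/eqP //].
by rewrite expf_eq0/= eq_complex/= gt_eqF.
Qed.

Lemma cbm_expiN n : cbm circ (fun t : R => conjc (expi t) ^+ n).
Proof. by apply: cbmX; apply: cbmJ; apply: cbm_circ; exact: continuous_expi. Qed.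

(** [circle_const] for f / z^k: the k-th Fourier coefficient divided by r^k is, up to 2 pi, the k-th
    Taylor coefficient. Multiplying out avoids the inverses and makes this the device for comparing
    different radii. *)
Lemma negative_freq (f : C -> C) (r s : R) k : analytic_on_disc f ->
  0 < r < 1 -> 0 < s < 1 ->
  s%:C ^+ k * cint circ (fun t => f (r%:C * expi t) * conjc (expi t) ^+ k) =
  r%:C ^+ k * cint circ (fun t => f (s%:C * expi t) * conjc (expi t) ^+ k).
Proof.
move=> hf hr hs; have mc := measurable_circ; have fc := mu_circ_fin.
have ex (x : R) : 0 < x < 1 ->
    cint circ (fun t => f (x%:C * expi t) * (x%:C * expi t) ^- k) =
    x%:C ^- k * cint circ (fun t => f (x%:C * expi t) * conjc (expi t) ^+ k).
  move=> /andP[x0 x1]; rewrite -cintZ//; last first.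
    by apply: cbmM; [apply: cbm_analytic; rewrite // x1 (ltW x0)|exact: cbm_expiN].
  apply: eq_cint => t _; rewrite exprMn invfM conjV_expi exprVn; ring.
have := @circle_const (fun z => f z * z ^- k) _ r s hr hs; rewrite !ex//.
move=> /(_ _)/wrap[].
  move=> z /andP[z0 z1]; apply: derivableM; first exact: hf.
  apply: (@derivableV _ _ (fun z : C^o => z ^+ k)).
    by rewrite expf_neq0// -cabs_gt0.
  by apply: (@analyticX (fun z => z) k (@analytic_id) z); rewrite discE.
move=> h.
have nz (x : R) : 0 < x < 1 -> x%:C ^+ k != 0 :> C.
  by move=> /andP[x0 _]; rewrite expf_neq0// eq_complex/= gt_eqF.
have nzr := nz r hr; have nzs := nz s hs.
apply: (mulfI (mulf_neq0 (invr_neq0 nzr) (invr_neq0 nzs))).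
rewrite [LHS](_ : _ = r%:C ^- k * cint circ (fun t => f (r%:C * expi t) * conjc (expi t) ^+ k)).
  by rewrite h; field; rewrite nzr nzs.
by field; rewrite nzr nzs.
Qed.

End Circle.

Arguments analytic_cst {R} c.
Arguments analytic_id {R}.
Arguments analyticD {R f g}.
Arguments analyticN {R f}.
Arguments analyticM {R f g}.
Arguments analyticX {R f} n.
Arguments analytic_sum {R I s P F}.
Arguments circ {R}.
Arguments measurable_circ {R}.
Arguments mu_circ {R}.
Arguments mu_circ_fin {R}.
Arguments fine_mu_circ {R}.
Arguments twopi_gt0 {R}.
Arguments circ_sub_cc {R}.

(** * Trigonometric approximation *)

Section Trigonometric.
Variable R : realType.
Local Notation C := R[i].
Local Notation mu := (@lebesgue_measure R).

Lemma uniform_continuity_segment (f : R -> R) (a b e : R) : continuous f -> 0 < e ->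
  exists2 d : R, 0 < d & forall s t, a <= s <= b -> a <= t <= b -> `|s - t| < d ->
    `|f s - f t| <= e.
Proof.
move=> cf e0; have /compact_near_coveringP := @segment_compact R a b.
move=> /(_ R (0:R)^'+ (fun d x => forall y, `|x - y| < d -> `|f x - f y| <= e) _).
case.
- move=> x _; have e20 : 0 < e / 2 by rewrite divr_gt0.
  have /cvgrPdist_lt/(_ _ e20)/nbhs_ballP[r /= r0 hr] := cf x.
  exists (ball x (r / 2), [set d | d < r / 2]) => /=.
    split; first by apply: nbhsx_ballx; rewrite divr_gt0.
    by apply: nbhs_right_lt; rewrite divr_gt0.
  move=> [x' d] /= [xx' dr] y hy.
  have h1 := hr x'; have h2 := hr y; rewrite /ball/= in h1 h2 xx'.
  have {}h1 : `|f x - f x'| < e / 2 by apply: h1; rewrite (lt_trans xx')//; lra.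
  have {}h2 : `|f x - f y| < e / 2.
    apply: h2; rewrite -(subrK x' x) -addrA (le_lt_trans (ler_normD _ _))//; lra.
  rewrite -(subrK (f x) (f x')) -addrA (le_trans (ler_normD _ _))// distrC; lra.
move=> d /= d0 hd; exists (d / 2); first by rewrite divr_gt0.
move=> s t sab _ st; apply: (hd (d / 2)) => //=.
- by rewrite sub0r normrN gtr0_norm ?divr_gt0//; lra.
- by rewrite divr_gt0.
Qed.

Lemma one_sub_cos (t : R) : cabs (1 - expi t) ^+ 2 = 2 * (1 - cos t).
Proof.
rewrite sqr_cabs !cE /= sub0r sqrrN.
by have := cos2Dsin2 t; lra.
Qed.

(** The estimate behind Korovkin's theorem. Near the diagonal uniform continuity suffices; elsewhere
    [1 - cos (t - s)] is at least [1 - cos d], and a multiple of it dominates the oscillation 2 B. A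
    kernel thus has to be tested on 1 - cos only. *)
Lemma korovkin_modulus (h : R -> R) (e : R) : continuous h -> h 0 = h (2 * pi) ->
  0 < e -> exists2 K : R, 0 <= K & forall s t, 0 <= s <= 2 * pi -> 0 <= t <= 2 * pi ->
    `|h s - h t| <= e + K * (1 - cos (t - s)).
Proof.
move=> ch h02 e0; have e20 : 0 < e / 2 by rewrite divr_gt0.
have [d0 d00 hd0] := uniform_continuity_segment 0 (2 * pi) ch e20.
have pi0 := pi_gt0 R.
have [d [dgt0 dd0 dpi]] : exists d : R, [/\ 0 < d, d <= d0 & d <= pi].
  exists (Num.min d0 pi); split; first by rewrite lt_min d00.
    by rewrite ge_min lexx.
  by rewrite ge_min lexx orbT.
have [B hB] : exists B : R, forall s, 0 <= s <= 2 * pi -> `|h s| <= B.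
  have [_ [B hB]] := rbm_segment (fun x (_ : 0 <= x <= 2 * pi) => ch x).
  by exists B => s hs; apply: hB; rewrite /= in_itv.
have B0 : 0 <= B.
  by apply: (le_trans (normr_ge0 _) (hB 0 _)); rewrite lexx/= mulr_ge0// ltW.
have cd1 : 0 < 1 - cos d.
  by rewrite subr_gt0 -cos0 ltr_cos// in_itv/= ?lexx ?(ltW pi0) ?(ltW dgt0).
exists (2 * B / (1 - cos d)) => [|s t]; first by rewrite divr_ge0// ?mulr_ge0// ltW.
wlog st : s t / s <= t.
  move=> H hs ht; have [st|/ltW ts] := leP s t; first exact: H.
  by have := H t s ts ht hs; rewrite -(opprB t s) cosN distrC.
move=> hs ht; have cpos x : 0 <= 2 * B / (1 - cos d) * (1 - cos x).
  apply: mulr_ge0; last by rewrite subr_ge0 cos_le1.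
  by apply: divr_ge0; [exact: mulr_ge0|exact: ltW].
have [tsd|tsd] := ltP (t - s) d.
  apply: (@le_trans _ _ (e / 2)); last by have := cpos (t - s); lra.
  by apply: hd0; rewrite // distrC ger0_norm ?subr_ge0// (lt_le_trans tsd).
(* Here s is near 0 and t near 2 pi, so the comparison goes through the common value
   [h 0 = h (2 * pi)]. *)
have [tsd2|tsd2] := ltP (2 * pi - d) (t - s).
  apply: (@le_trans _ _ (e / 2 + e / 2)); last by have := cpos (t - s); lra.
  rewrite -(subrK (h 0) (h s)) -addrA {2}h02 (le_trans (ler_normD _ _))//.
  apply: lerD; apply: hd0; rewrite ?lexx ?mulr_ge0 ?(ltW pi0)//.
    by rewrite subr0 ger0_norm; lra.
  by rewrite ger0_norm; lra.
apply: (@le_trans _ _ (2 * B)).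
  by rewrite (le_trans (ler_normB _ _))// mulr_natl mulr2n lerD ?hB.
suff hc : 1 - cos d <= 1 - cos (t - s).
  rewrite ler_wpDl ?(ltW e0)// mulrAC ler_pdivlMr// ler_wpM2l// mulr_ge0//.
rewrite lerD2l lerN2; have [tp|tp] := leP (t - s) pi.
  by rewrite leNgt ltr_cos ?in_itv/= -?leNgt//; lra.
rewrite -[X in X <= _]cosN -[X in X <= _]cosD2pi -mulr_natl.
by rewrite leNgt ltr_cos ?in_itv/= -?leNgt//; lra.
Qed.

Lemma conjcM (z w : C) : conjc (z * w) = conjc z * conjc w.
Proof. exact: (rmorphM (@conjc R)). Qed.
Lemma conjcX (z : C) n : conjc (z ^+ n) = conjc z ^+ n.
Proof. exact: (rmorphXn (@conjc R)). Qed.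
Lemma conjc_sum I (s : seq I) (P : pred I) (F : I -> C) :
  conjc (\sum_(i <- s | P i) F i) = \sum_(i <- s | P i) conjc (F i).
Proof. exact: (rmorph_sum (@conjc R)). Qed.

Lemma cint_expi (k l : nat) :
  cint circ (fun t : R => conjc (expi t) ^+ k * expi t ^+ l) =
  if k == l then (2 * pi)%:C else 0.
Proof.
have hr : 0 < (1 / 2 : R) < 1 by apply/andP; split; lra.
have neg (m n : nat) : (m < n)%N ->
    cint circ (fun t : R => conjc (expi t) ^+ m * expi t ^+ n) = 0.
  move=> mn; rewrite -(@positive_freq R (fun=> 1) (1 / 2) (n - m).-1 (analytic_cst 1) hr)//.
  apply: eq_cint => t _; rewrite mul1r prednK ?subn_gt0// conjV_expi exprVn.
  by rewrite mulrC -expfB.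
have ce : cbm circ (@expi R) by apply: cbm_circ; exact: continuous_expi.
case: ltngtP => [kl|lk|->]; first exact: neg.
  rewrite -[RHS](@conjc0 R) -(neg _ _ lk) -cintJ; last 3 first.
  - exact: measurable_circ.
  - exact: mu_circ_fin.
  - by apply: cbmM; [exact: cbm_expiN|exact: cbmX].
  by apply: eq_cint => t _; rewrite conjcM !conjcX conjcK mulrC.
rewrite -fine_mu_circ -[RHS]mulr1 -cint_cst; last exact: measurable_circ.
apply: eq_cint => t _; rewrite -exprMn mulrC mulCJ cabs_expi expr1n.
by rewrite expr1n.
Qed.

(* The square of the modulus of this kernel is n times the Fejer kernel. *)
Definition dirichlet n (s t : R) : C := \sum_(k < n) (conjc (expi s) * expi t) ^+ k.

(** With z = e^(i(t-s)) the geometric sum gives |1 - z| |D| = |1 - z^n| <= 2, and |1 - z|^2 is 2 (1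
    - cos (t - s)). *)
Lemma dirichlet_bound n (s t : R) : (1 - cos (t - s)) * cabs (dirichlet n s t) ^+ 2 <= 2.
Proof.
have e : conjc (expi s) * expi t = expi (t - s) by rewrite expiD expiN mulrC.
rewrite /dirichlet e -(ler_pM2l (ltr0n R 2)) mulrA -one_sub_cos -exprMn -cabsM.
rewrite -[1 - _]opprB mulNr cabsN -subrX1.
have h : cabs (expi (t - s) ^+ n - 1) <= 2.
  by rewrite (le_trans (cabsB _ _))// cabsX cabs_expi expr1n cabs1; lra.
rewrite -[2 * 2]expr2.
by rewrite ler_pXn2r ?nnegrE ?cabs_ge0.
Qed.

Lemma sqr_dirichlet n (s t : R) : (cabs (dirichlet n s t) ^+ 2)%:C =
  \sum_(k < n) \sum_(l < n)
     (conjc (expi s) ^+ k * expi s ^+ l) * (expi t ^+ k * conjc (expi t) ^+ l).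
Proof.
rewrite -mulCJ /dirichlet conjc_sum mulr_suml; apply: eq_bigr => k _.
rewrite mulr_sumr; apply: eq_bigr => l _.
rewrite conjcX conjcM conjcK !exprMn -!mulrA; congr (_ * _).
by rewrite mulrCA.
Qed.

Lemma cbm_dirichlet n (t : R) : cbm circ (fun s => dirichlet n s t).
Proof.
apply: cbm_sum => k _; apply: cbmX; apply: cbmM; last exact: cbm_cst.
by apply: cbmJ; apply: cbm_circ; exact: continuous_expi.
Qed.

Lemma rbm_sqr_dirichlet n (t : R) : rbm circ (fun s => cabs (dirichlet n s t) ^+ 2).
Proof. by apply: rbmX; apply: rbm_cabs; exact: cbm_dirichlet. Qed.

Lemma int_sqr_dirichlet n (t : R) :
  \int[mu]_(s in circ) (cabs (dirichlet n s t) ^+ 2) = n%:R * (2 * pi).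
Proof.
apply: (@complexI R).
have -> : (\int[mu]_(s in circ) (cabs (dirichlet n s t) ^+ 2))%:C =
    cint circ (fun s => (cabs (dirichlet n s t) ^+ 2)%:C).
  apply: complexP => //=; rewrite rint_cst ?mul0r//; exact: measurable_circ.
have mc := @measurable_circ R; have fc := @mu_circ_fin R.
rewrite (eq_cint (fun s _ => sqr_dirichlet n s t)).
have hb (k l : nat) : cbm circ (fun s : R => conjc (expi s) ^+ k * expi s ^+ l).
  by apply: cbmM; [exact: cbm_expiN|apply: cbmX; apply: cbm_circ; exact: continuous_expi].
have hb' (k l : nat) : cbm circ (fun s : R => (conjc (expi s) ^+ k * expi s ^+ l) *
    (expi t ^+ k * conjc (expi t) ^+ l)).
  by apply: cbmM; [exact: hb|exact: cbm_cst].
rewrite cint_sum//; last by move=> k _; exact: cbm_sum.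
rewrite (eq_bigr (fun=> (2 * pi)%:C)).
  by rewrite sumr_const card_ord [n%:R * _]mulr_natl (raddfMn (real_complex R)).
move=> k _; rewrite cint_sum// (bigD1 k)//= big1 ?addr0.
  rewrite (eq_cint (fun s _ => mulrC _ _)) cintZ// cint_expi eqxx.
  rewrite -exprMn mulCJ cabs_expi expr1n expr1n mul1r//.
move=> l lk; rewrite (eq_cint (fun s _ => mulrC _ _)) cintZ// cint_expi.
by rewrite -val_eqE eq_sym in lk; rewrite (negbTE lk) mulr0.
Qed.

Lemma expi_mulJ (t : R) (k l : nat) : (l <= k)%N ->
  expi t ^+ k * conjc (expi t) ^+ l = expi t ^+ (k - l).
Proof.
move=> lk; rewrite -{1}(subnK lk) exprD -mulrA -exprMn mulCJ cabs_expi.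
by rewrite !expr1n mulr1.
Qed.

(** Conjugation turns a negative frequency into a positive one without changing the real part. Hence
    a real trigonometric polynomial is the real part of an ordinary polynomial on the circle. *)
Lemma conjexpi_horner (t : R) (c : C) (k l : nat) :
  complex.Re (c * (expi t ^+ k * conjc (expi t) ^+ l)) =
  complex.Re ((if (l <= k)%N then c *: 'X^(k - l) else conjc c *: 'X^(l - k)).[expi t]).
Proof.
case: leqP => [lk|/ltnW kl]; rewrite hornerZ hornerXn; first by rewrite expi_mulJ.
rewrite -cReJ !conjcM !conjcX conjcK [X in _ * X]mulrC.
by rewrite expi_mulJ.
Qed.

(** The approximant is the Fejer mean [T] of [h]. The normalization makes [g.[0]] real, hence equal
    to the mean of Re g over the circle; [szego] relies on this. *)
Theorem trig_approx (h : R -> R) (e : R) : continuous h -> h 0 = h (2 * pi) ->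
  0 < e -> exists g : {poly C}, complex.Im g.[0] = 0 /\
    forall t, 0 <= t <= 2 * pi -> `|h t - complex.Re g.[expi t]| <= e.
Proof.
move=> ch h02 e0; have e20 : 0 < e / 2 by rewrite divr_gt0.
have [K K0 hK] := korovkin_modulus ch h02 e20.
have mc := @measurable_circ R; have fc := @mu_circ_fin R; have tp := @twopi_gt0 R.
suff [g hg] : exists g : {poly C},
    forall t, 0 <= t <= 2 * pi -> `|h t - complex.Re g.[expi t]| <= e.
  exists (g - (0 +i* complex.Im g.[0])%:P); split.
    by rewrite hornerD hornerN hornerC !cE /= subrr.
  by move=> t ht; rewrite hornerD hornerN hornerC !cE /= subr0; exact: hg.
(* The error is e / 2 plus K times the mean of (1 - cos) |D|^2 / n; by [dirichlet_bound] the latter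
   is at most [2 * K / n]. *)
pose n := (Num.trunc (4 * K / e)).+1.
have nK : 2 * K / n%:R <= e / 2.
  have hn : 4 * K / e < n%:R.
    by apply: truncnS_gt.
  rewrite ler_pdivrMr ?ltr0n//; rewrite ltr_pdivrMr// in hn; lra.
have n0 : 0 < n%:R :> R by rewrite ltr0n.
pose c (k l : nat) : C := (n%:R * (2 * pi))^-1%:C *
  cint circ (fun s => (h s)%:C * (conjc (expi s) ^+ k * expi s ^+ l)).
have rh : rbm circ h by exact: rbm_circ.
pose T t := (n%:R * (2 * pi))^-1 * \int[mu]_(s in circ) (h s * cabs (dirichlet n s t) ^+ 2).
exists (\sum_(k < n) \sum_(l < n)
  (if (l <= k)%N then c k l *: 'X^(k - l) else conjc (c k l) *: 'X^(l - k))).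
have hb (k l : nat) : cbm circ (fun s : R => (h s)%:C * (conjc (expi s) ^+ k * expi s ^+ l)).
  apply: cbmM; first exact: cbm_real.
  by apply: cbmM; [exact: cbm_expiN|apply: cbmX; apply: cbm_circ; exact: continuous_expi].
move=> t ht; set G := complex.Re _; have -> : G = T t.
  rewrite /G horner_sum Re_sum.
  have -> : T t = complex.Re ((n%:R * (2 * pi))^-1%:C *
      cint circ (fun s => (h s)%:C * (cabs (dirichlet n s t) ^+ 2)%:C)).
    by rewrite RCM /= /T; congr (_ * _); apply: eq_Rintegral => s _; rewrite mul0r subr0.
  have -> : cint circ (fun s => (h s)%:C * (cabs (dirichlet n s t) ^+ 2)%:C) =
    \sum_(k < n) \sum_(l < n) cint circ (fun s => (expi t ^+ k * conjc (expi t) ^+ l) *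
       ((h s)%:C * (conjc (expi s) ^+ k * expi s ^+ l))).
    have hb' (k l : nat) : cbm circ (fun s => (expi t ^+ k * conjc (expi t) ^+ l) *
       ((h s)%:C * (conjc (expi s) ^+ k * expi s ^+ l))).
      by apply: cbmM; [exact: cbm_cst|exact: hb].
    under eq_bigr do rewrite -cint_sum//.
    rewrite -cint_sum//; last by move=> k _; exact: cbm_sum.
    apply: eq_cint => s _; rewrite sqr_dirichlet mulr_sumr; apply: eq_bigr => k _.
    rewrite mulr_sumr; apply: eq_bigr => l _.
    by rewrite mulrA mulrC.
  rewrite mulr_sumr Re_sum; apply: eq_bigr => k _.
  rewrite horner_sum mulr_sumr !Re_sum; apply: eq_bigr => l _.
  by rewrite -conjexpi_horner cintZ// /c [in RHS]mulrCA [in RHS]mulrC.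
have hT : h t = (n%:R * (2 * pi))^-1 *
    \int[mu]_(s in circ) (h t * cabs (dirichlet n s t) ^+ 2).
  have rd := rbm_sqr_dirichlet n t.
  rewrite rintZ// int_sqr_dirichlet mulrCA mulVf ?mulr1//.
  by rewrite mulf_neq0// gt_eqF.
have rd := rbm_sqr_dirichlet n t.
have rch : rbm circ (fun=> h t) by exact: rbm_cst.
have rm1 := rbmM rch rd; have rm2 := rbmM rh rd.
rewrite [X in X - _]hT /T -mulrBr -rintB// normrM gtr0_norm ?invr_gt0 ?mulr_gt0 ?pi_gt0//.
rewrite [X in X <= _]mulrC ler_pdivrMr ?mulr_gt0 ?pi_gt0//.
apply: (le_trans (rint_norm mc fc (rbmB rm1 rm2))).
have rcd : rbm circ (fun s => e / 2 * cabs (dirichlet n s t) ^+ 2 + K * 2).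
  by apply: rbmD; [apply: rbmM => //; exact: rbm_cst|exact: rbm_cst].
apply: (@le_trans _ _ (\int[mu]_(s in circ) (e / 2 * cabs (dirichlet n s t) ^+ 2 + K * 2))).
  apply: rint_le => //; first by apply: rbm_norm; exact: rbmB.
  move=> s /circ_sub_cc /=; rewrite in_itv/= => hs.
  rewrite -mulrBl normrM [X in _ * X]ger0_norm ?exprn_ge0 ?cabs_ge0//.
  have := hK _ _ hs ht; rewrite distrC => hst.
  apply: (@le_trans _ _ ((e / 2 + K * (1 - cos (t - s))) * cabs (dirichlet n s t) ^+ 2)).
    by rewrite ler_wpM2r// exprn_ge0// cabs_ge0.
  by rewrite mulrDl lerD2l -mulrA ler_wpM2l// dirichlet_bound.
rewrite rintD//; [|by apply: rbmM => //; exact: rbm_cst|exact: rbm_cst].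
rewrite rintZ// rint_cst// int_sqr_dirichlet fine_mu_circ.
rewrite ler_pdivrMr// in nK; nra.
Qed.

End Trigonometric.

(** * Small values of an analytic function *)

Section Uniqueness.
Variable R : realType.
Local Notation C := R[i].
Local Notation mu := (@lebesgue_measure R).

Lemma cabs_powM (a b : R) i (X Y : C) : 0 <= a -> 0 <= b ->
  a%:C ^+ i * X = b%:C ^+ i * Y -> a ^+ i * cabs X = b ^+ i * cabs Y.
Proof.
move=> a0 b0 /(congr1 (@cabs R)).
by rewrite !cabsM !cabsX !cabsR (ger0_norm a0) (ger0_norm b0).
Qed.

Lemma circ_cc (t : R) : circ t -> 0 <= t <= 2 * pi.
Proof. by rewrite /circ/= in_itv/= => /andP[-> /ltW ->]. Qed.

Lemma polar (z : C) : exists2 t : R, circ t & z = (cabs z)%:C * expi t.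
Proof.
have [->|z0] := eqVneq z 0.
  by exists 0; rewrite ?cabs0 ?mul0r// /circ/= in_itv/= lexx twopi_gt0.
have cz : 0 < cabs z by rewrite cabs_gt0.
pose a := complex.Re z / cabs z; pose b := complex.Im z / cabs z.
have ab : a ^+ 2 + b ^+ 2 = 1.
  by rewrite !expr_div_n -mulrDl -sqr_cabs divff// expf_neq0// gt_eqF.
have a1 : -1 <= a <= 1.
  by rewrite -ler_norml -(@ler_pXn2r _ 2) ?nnegrE// expr1n real_normK ?num_real//; have := sqr_ge0 b; lra.
have zE t : cos t = a -> sin t = b -> z = (cabs z)%:C * expi t.
  move=> ca sb; apply: complexP; rewrite !cE /= ?ca ?sb ?mul0r ?subr0 ?addr0 /a /b.
    by rewrite mulrC divfK// gt_eqF.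
  by rewrite mulrC divfK// gt_eqF.
have pi0 := pi_gt0 R.
have sa : sin (acos a) = `|b|.
  rewrite sin_acos//; have -> : 1 - a ^+ 2 = b ^+ 2 by lra.
  by rewrite sqrtr_sqr.
have [b0|b0] := leP 0 b.
  exists (acos a); last by apply: zE; rewrite ?acosK// sa ger0_norm.
  rewrite /circ/= in_itv/= acos_ge0//= (le_lt_trans (acos_lepi _))//; lra.
exists (2 * pi - acos a).
  rewrite /circ/= in_itv/= subr_ge0 ltrBlDr ltrDl.
  rewrite (le_trans (acos_lepi _))//=; last lra.
  rewrite lt_neqAle acos_ge0// andbT; apply/eqP => a0.
  by move: sa; rewrite -a0 sin0 => /esym/eqP; rewrite normr_eq0 lt_eqF.
apply: zE.
  by rewrite addrC mulr_natl cosD2pi cosN acosK.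
rewrite addrC mulr_natl sinD2pi sinN sa ltr0_norm ?opprK//.
Qed.

Lemma expi_Jmul (t : R) (k l : nat) : (k <= l)%N ->
  conjc (expi t) ^+ k * expi t ^+ l = expi t ^+ (l - k).
Proof. by move=> kl; rewrite mulrC expi_mulJ. Qed.

Lemma expi_JmulJ (t : R) (k l : nat) : (l <= k)%N ->
  conjc (expi t) ^+ k * expi t ^+ l = conjc (expi t) ^+ (k - l).
Proof.
move=> lk; apply: (can_inj (@conjcK R)).
by rewrite conjcM !conjcX conjcK expi_mulJ.
Qed.

Lemma rint_indic (D E : set R) : measurable D -> measurable E ->
  \int[mu]_(x in D) \1_E x = fine (mu (E `&` D)).
Proof. by move=> mD mE; rewrite /Rintegral integral_indic. Qed.

Lemma continuous_eq0 (f : R -> R) : continuous f -> (forall t, circ t -> 0 <= f t) ->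
  \int[mu]_(t in circ) f t = 0 -> forall t, circ t -> f t = 0.
Proof.
move=> cf f0 If t0 ht0; apply/eqP; rewrite eq_le f0// andbT leNgt; apply/negP => ft0.
have e20 : 0 < f t0 / 2 by rewrite divr_gt0.
have /cvgrPdist_lt/(_ _ e20)/nbhs_ballP[d /= d0 hd] := cf t0.
have /andP[t00 t02] : 0 <= t0 < 2 * pi by move: ht0; rewrite /circ/= in_itv.
(* A one-sided interval, because t0 may be the endpoint 0; it is cut at 2 pi to stay inside
   [circ]. *)
pose b := Num.min (t0 + d) (2 * pi).
have tb : t0 < b by rewrite lt_min t02 ltrDl d0.
have sub : `[t0, b[ `<=` circ.
  move=> x; rewrite /circ/= !in_itv/= lt_min => /andP[h1 /andP[_ ->]].
  by rewrite (le_trans t00).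
have mc := @measurable_circ R; have fc := @mu_circ_fin R.
have mI : measurable (`[t0, b[ : set R) by exact: measurable_itv.
have r1 : rbm circ (\1_(`[t0, b[%classic) : R -> R) by exact: rbm_indic.
have : f t0 / 2 * (b - t0) <= 0.
  rewrite -If (_ : b - t0 = \int[mu]_(x in circ) \1_(`[t0, b[%classic) x); last first.
    rewrite rint_indic//; have -> : `[t0, b[%classic `&` circ = `[t0, b[%classic by apply/setIidPl.
    by rewrite lebesgue_measure_itv/= lte_fin tb.
  rewrite -rintZ//; apply: rint_le => //; [by apply: rbmM => //; exact: rbm_cst|exact: rbm_circ|].
  move=> x cx; rewrite indicE; case: (boolP (x \in _)) => [/set_mem/=|_]; last first.
    by rewrite mulr0 f0.
  rewrite in_itv/= lt_min => /andP[h1 /andP[h2 _]]; rewrite mulr1.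
  have /(hd x) : `|t0 - x| < d by rewrite ltr_norml; lra.
  by rewrite /= ltr_norml; lra.
by rewrite leNgt mulr_gt0// subr_gt0.
Qed.

Lemma continuous_Re (f : R -> C) : continuous (f : R -> C^o) ->
  continuous (fun t => complex.Re (f t)).
Proof. by move=> cf t; have /cvg_ReP[] := cf t. Qed.
Lemma continuous_Im (f : R -> C) : continuous (f : R -> C^o) ->
  continuous (fun t => complex.Im (f t)).
Proof. by move=> cf t; have /cvg_ReP[] := cf t. Qed.
Lemma continuous_cabs (f : R -> C) : continuous (f : R -> C^o) ->
  continuous (fun t => cabs (f t)).
Proof. by move=> cf t; have /cvg_cabs := cf t. Qed.

Lemma cbm_horner (g : {poly C}) (f : R -> C) : cbm circ f -> cbm circ (fun t => g.[f t]).
Proof.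
move=> hf; under eq_fun do rewrite horner_coef.
by apply: cbm_sum => i _; apply: cbmM; [exact: cbm_cst|exact: cbmX].
Qed.

Lemma cbm_expi : cbm circ (@expi R).
Proof. by apply: cbm_circ; exact: continuous_expi. Qed.

Variables (u : C -> C).
Hypothesis hu : analytic_on_disc u.

(** Multiplying by e^(ijt) with j > 0 shifts the index k to k - j. The new coefficient vanishes by
    hypothesis if j <= k and by [positive_freq] if j > k, so only the constant term of q
    survives. *)
Lemma cint_mul_horner r k (q : {poly C}) : 0 < r < 1 ->
  (forall j, (j < k)%N -> cint circ (fun t => u (r%:C * expi t) * conjc (expi t) ^+ j) = 0) ->
  cint circ (fun t => u (r%:C * expi t) * conjc (expi t) ^+ k * q.[expi t]) =
  q.[0] * cint circ (fun t => u (r%:C * expi t) * conjc (expi t) ^+ k).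
Proof.
move=> hr h0; have mc := @measurable_circ R; have fc := @mu_circ_fin R.
have hr' : 0 <= r < 1 by case/andP: hr => r0 ->; rewrite ltW.
have cu := cbm_analytic hu hr'.
have ck : cbm circ (fun t => u (r%:C * expi t) * conjc (expi t) ^+ k).
  by apply: cbmM => //; exact: cbm_expiN.
have cj (j : nat) : cbm circ (fun t => u (r%:C * expi t) * conjc (expi t) ^+ k * expi t ^+ j).
  by apply: cbmM => //; apply: cbmX; exact: cbm_expi.
have term (j : nat) : cint circ (fun t => u (r%:C * expi t) * conjc (expi t) ^+ k * expi t ^+ j.+1) = 0.
  have [jk|kj] := leqP j.+1 k.
    rewrite -(h0 (k - j.+1)%N); last by rewrite ltn_subrL (leq_trans _ jk).
    by apply: eq_cint => t _; rewrite -mulrA expi_JmulJ.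
  rewrite -(positive_freq (j - k)%N hu hr); apply: eq_cint => t _.
  by rewrite -mulrA expi_Jmul ?(ltnW kj)// subSn.
rewrite (eq_cint (G := fun t => \sum_(i < size q)
   q`_i * (u (r%:C * expi t) * conjc (expi t) ^+ k * expi t ^+ i))).
  rewrite cint_sum//; last by move=> i _; apply: cbmM; [exact: cbm_cst|exact: cj].
  rewrite horner_coef0; case: (size q) (nth_default 0 (s := q) (n := 0)) => [|n] q0.
    by rewrite big_ord0 q0// mul0r.
  rewrite big_ord_recl big1 ?addr0.
    by rewrite cintZ//; congr (_ * _); apply: eq_cint => t _; rewrite expr0 mulr1.
  by move=> i _; rewrite cintZ// lift0 term mulr0.
move=> t _; rewrite horner_coef mulr_sumr; apply: eq_bigr => i _.
by rewrite mulrCA.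
Qed.

Lemma cint_horner (g : {poly C}) :
  cint circ (fun t : R => g.[expi t]) = (2 * pi)%:C * g.[0].
Proof.
rewrite (eq_cint (G := fun t : R => \sum_(i < size g)
   g`_i * (conjc (expi t) ^+ 0 * expi t ^+ i))); last first.
  by move=> t _; rewrite horner_coef; apply: eq_bigr => i _; rewrite expr0 mul1r.
have mc := @measurable_circ R; have fc := @mu_circ_fin R.
have ci (i : nat) : cbm circ (fun t : R => conjc (expi t) ^+ 0 * expi t ^+ i).
  by apply: cbmM; [exact: cbm_expiN|apply: cbmX; exact: cbm_expi].
rewrite cint_sum//; last by move=> i _; apply: cbmM; [exact: cbm_cst|exact: ci].
rewrite horner_coef0; case: (size g) (nth_default 0 (s := g) (n := 0)) => [|n] g0.
  by rewrite big_ord0 g0// mulr0.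
rewrite big_ord_recl big1 ?addr0; first by rewrite cintZ// cint_expi eqxx mulrC.
by move=> i _; rewrite cintZ// cint_expi lift0 mulr0.
Qed.

(** If all these coefficients vanish, [negative_freq] makes them vanish on the circle through z as
    well. Trigonometric approximation then makes u orthogonal there to every continuous periodic
    real function, in particular to Re u and Im u, so the integral of |u|^2 is 0 and u(z) = 0. *)
Lemma fourier_nonzero : (exists z, disc z /\ u z != 0) ->
  exists k, cint circ (fun t => u ((1 / 2)%:C * expi t) * conjc (expi t) ^+ k) != 0.
Proof.
move=> [z [dz uz]]; apply: contrapT => /forallNP nk.
have h2 : 0 < (1 / 2 : R) < 1 by apply/andP; split; lra.
have mc := @measurable_circ R; have fc := @mu_circ_fin R.
have [t ct zE] := polar z.
(* The comparison of radii requires a positive radius; at the origin the coefficient of index 0 is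
   already 2 pi u(0). *)
have [z0|z0] := eqVneq z 0.
  apply: (nk 0%N); rewrite z0 in uz.
  rewrite (eq_cint (G := fun t => u ((1 / 2)%:C * expi t))).
    rewrite mean_value ?(ltW h2.1)//; last by case/andP: h2 => /ltW ->.
    by rewrite mulf_neq0// eq_complex/= gt_eqF// twopi_gt0.
  by move=> s _; rewrite expr0 mulr1.
pose r := cabs z; have hr : 0 < r < 1 by rewrite /r cabs_gt0 z0.
have hr' : 0 <= r < 1 by case/andP: hr => r0 ->; rewrite ltW.
have {}nk k : cint circ (fun t => u (r%:C * expi t) * conjc (expi t) ^+ k) = 0.
  have := negative_freq k hu hr h2.
  have -> : cint circ (fun t => u ((1 / 2)%:C * expi t) * conjc (expi t) ^+ k) = 0.
    by apply/eqP; apply: contrapT => /negP h; exact: (nk k).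
  rewrite mulr0 => /eqP; rewrite mulf_eq0 expf_eq0 eq_complex/= => /orP[|/eqP//].
  by rewrite gt_eqF ?andbF//; case/andP: h2.
pose U (t : R) := u (r%:C * expi t); have cU : continuous (U : R -> C^o).
  exact: analytic_circle.
have cbU : cbm circ U by exact: cbm_circ.
have [B hB] : exists B, forall s, circ s -> cabs (U s) <= B.
  have [_ [B hB]] := rbm_cabs cbU; exists B => s cs.
  by have := hB s cs; rewrite ger0_norm ?cabs_ge0.
have key (h : R -> R) : continuous h -> h 0 = h (2 * pi) ->
    cint circ (fun t => U t * (h t)%:C) = 0.
  move=> ch h02; apply/eqP; rewrite -cabs_eq0 eq_le cabs_ge0 andbT.
  apply/ler_addgt0Pl => e e0; rewrite addr0.
  have B0 : 0 <= B by apply: le_trans (cabs_ge0 _) (hB t ct).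
  pose e' := e / (2 * ((B + 1) * (2 * pi))).
  have B1 : 0 < B + 1 by rewrite ltr_wpDl.
  have e'0 : 0 < e' by rewrite divr_gt0// mulr_gt0// mulr_gt0// twopi_gt0.
  have [g [g0 hg]] := trig_approx ch h02 e'0.
  have crg : rbm circ (fun t => complex.Re g.[expi t]).
    by have [] := cbm_horner g cbm_expi.
  have rh : rbm circ h by exact: rbm_circ.
  have g_0 : cint circ (fun t => U t * g.[expi t]) = 0.
    have := @cint_mul_horner r 0 g hr; rewrite nk mulr0 => /(_ _) <-//.
    by apply: eq_cint => s _; rewrite expr0 mulr1.
  have gJ : cint circ (fun t => U t * conjc g.[expi t]) = 0.
    rewrite (eq_cint (G := fun t => \sum_(i < size g)
      conjc g`_i * (U t * conjc (expi t) ^+ i))).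
      rewrite cint_sum// ?big1//.
        move=> i _; rewrite cintZ ?nk ?mulr0//.
        by apply: cbmM => //; exact: cbm_expiN.
      by move=> i _; apply: cbmM; [exact: cbm_cst|apply: cbmM => //; exact: cbm_expiN].
    move=> s _; rewrite horner_coef conjc_sum mulr_sumr; apply: eq_bigr => i _.
    by rewrite conjcM conjcX mulrCA.
  have Re0 : cint circ (fun t => U t * (complex.Re g.[expi t])%:C) = 0.
    rewrite (eq_cint (G := fun t => 2^-1 * (U t * g.[expi t] + U t * conjc g.[expi t]))).
      have c1 : cbm circ (fun t => U t * g.[expi t]).
        by apply: cbmM => //; apply: cbm_horner; exact: cbm_expi.
      have c2 : cbm circ (fun t => U t * conjc g.[expi t]).
        by apply: cbmM => //; apply: cbmJ; apply: cbm_horner; exact: cbm_expi.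
      by rewrite cintZ ?cintD// ?g_0 ?gJ ?addr0 ?mulr0//; exact: cbmD.
    by move=> s _; rewrite -mulrDr ReJ_add mulrA mulrC.
  rewrite -[cint _ _]subr0 -Re0 -cintB//; last 2 first.
  - by apply: cbmM => //; exact: cbm_real.
  - by apply: cbmM => //; exact: cbm_real.
  have -> : e = 2 * ((B + 1) * e' * fine (mu circ)).
    rewrite fine_mu_circ /e'; move: (2 * pi) (@twopi_gt0 R) => P P0.
    by field; rewrite !gt_eqF.
  apply: cint_bound => //.
    by apply: cbmB; (apply: cbmM => //; exact: cbm_real).
  move=> s cs; rewrite -mulrBr cabsM -rmorphB /= cabsR ler_pM ?cabs_ge0//.
    by rewrite (le_trans (hB _ cs))// lerDl.
  by apply: hg; exact: circ_cc.
have U02 : U 0 = U (2 * pi) by rewrite /U expi0 expi2pi.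
have I0 : \int[mu]_(t in circ) (cabs (U t) ^+ 2) = 0.
  have [r1 r2] := cbU.
  have -> : \int[mu]_(t in circ) (cabs (U t) ^+ 2) =
      \int[mu]_(t in circ) (complex.Re (U t) ^+ 2 + complex.Im (U t) ^+ 2).
    by apply: eq_Rintegral => s _; rewrite sqr_cabs.
  rewrite rintD//; [|exact: rbmX|exact: rbmX].
  have /(congr1 (@complex.Re R)) := key _ (continuous_Re cU) (congr1 _ U02).
  have /(congr1 (@complex.Im R)) := key _ (continuous_Im cU) (congr1 _ U02).
  rewrite /cint /= => h1 h2'.
  rewrite -[RHS]addr0 -{1}h2' -h1; congr (_ + _); apply: eq_Rintegral => s _.
    by rewrite cReM /= mulr0 subr0 expr2.
  by rewrite cImM /= mulr0 add0r expr2.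
have := continuous_eq0 _ _ I0 ct; move=> /(_ _ _)/eqP; rewrite expf_eq0/= cabs_eq0.
move: uz; rewrite zE -/r -/(U t) => /negbTE -> h; apply: notF; apply: h.
  move=> s; under eq_fun do rewrite expr2.
  by apply: cvgM; exact: continuous_cabs.
by move=> s _; rewrite exprn_ge0// cabs_ge0.
Qed.

(** The least k is the order of the zero of u at 0. Vanishing of the lower coefficients on all
    circles is what [szego] assumes. *)
Lemma fourier_first : (exists z, disc z /\ u z != 0) -> exists k,
  cint circ (fun t => u ((1 / 2)%:C * expi t) * conjc (expi t) ^+ k) != 0 /\
  forall j r, (j < k)%N -> 0 < r < 1 ->
    cint circ (fun t => u (r%:C * expi t) * conjc (expi t) ^+ j) = 0.
Proof.
move=> /fourier_nonzero h.
have [k hk hmin] := ex_minnP h; exists k; split=> // j r jk hr.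
have h2 : 0 < (1 / 2 : R) < 1 by apply/andP; split; lra.
have := negative_freq j hu hr h2.
have -> : cint circ (fun t => u ((1 / 2)%:C * expi t) * conjc (expi t) ^+ j) = 0.
  by apply/eqP; apply: contraTT jk => /hmin; rewrite -leqNgt.
rewrite mulr0 => /eqP; rewrite mulf_eq0 expf_eq0 eq_complex/= => /orP[|/eqP//].
by rewrite gt_eqF ?andbF//; case/andP: h2.
Qed.

End Uniqueness.

(** * A truncated Jensen inequality *)

Section Jensen.
Variable R : realType.
Local Notation C := R[i].
Local Notation mu := (@lebesgue_measure R).

(** Taking inverses, 1 / (1 + x/n) = 1 - x/(n+x) <= exp(-x/(n+x)), and n x/(n+x) >= x - 1 as soon as
    n >= x^2 - x. *)
Lemma expR_lower (x : R) : exists N : nat, forall n, (N <= n)%N -> (0 < n)%N ->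
  expR (x - 1) <= `|1 + x / n%:R| ^+ n.
Proof.
pose N := (Num.trunc (2 * `|x| + 2 * x ^+ 2)).+1; exists N => n Nn n0.
have hn : 2 * `|x| + 2 * x ^+ 2 < n%:R.
  by rewrite (lt_le_trans (truncnS_gt _))// ler_nat.
have x2 := sqr_ge0 x; have ax := normr_ge0 x.
have n1 : 0 < n%:R :> R by rewrite ltr0n.
have xn : `|x| <= n%:R / 2 by lra.
have nx : 0 < n%:R + x by move: xn; rewrite ler_norml; lra.
have e1 : 1 + x / n%:R = (n%:R + x) / n%:R by field; rewrite gt_eqF.
have p1 : 0 < 1 + x / n%:R by rewrite e1 divr_gt0.
rewrite gtr0_norm// -[leLHS]invrK -expRN -[leRHS]invrK.
rewrite lef_pV2 ?posrE ?invr_gt0 ?exprn_gt0 ?expR_gt0//.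
rewrite -exprVn.
have -> : (1 + x / n%:R)^-1 = 1 + (- x / (n%:R + x)).
  by rewrite e1; field; rewrite !gt_eqF.
apply: (@le_trans _ _ (expR (- x / (n%:R + x)) ^+ n)).
  rewrite ler_pXn2r ?nnegrE ?expR_ge0 ?expR_ge1Dx//.
  rewrite (_ : 1 + _ = n%:R / (n%:R + x)) ?divr_ge0 ?(ltW nx) ?(ltW n1)//.
  by field; rewrite gt_eqF.
rewrite -expRM_natl ler_expR mulrA ler_pdivrMr//.
have : x <= `|x| by exact: ler_norm.
have := ler_norm (- x); rewrite normrN => h3 h4; rewrite expr2 in x2 hn; nra.
Qed.

Variables (u : C -> C).
Hypothesis hu : analytic_on_disc u.

(** The square of the modulus of 1 + w/n equals 1 + y with n y = 2 Re w + |w|^2 / n, and 1 + y <=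
    e^y. *)
Lemma exp_poly_bound (w : C) (n : nat) : (0 < n)%N ->
  cabs ((1 + w / n%:R) ^+ n) <= expR (complex.Re w + cabs w ^+ 2 / (2 * n%:R)).
Proof.
move=> n0; have n1 : 0 < n%:R :> R by rewrite ltr0n.
rewrite -(@ler_pXn2r _ 2) ?nnegrE ?cabs_ge0 ?expR_ge0//.
rewrite cabsX exprAC -!expRM_natl.
have wn : w / n%:R = (n%:R^-1)%:C * w.
  by rewrite mulrC fmorphV rmorph_nat.
have -> : cabs (1 + w / n%:R) ^+ 2 = 1 + (2 * complex.Re w + cabs w ^+ 2 / n%:R) / n%:R.
  rewrite wn sqr_cabsD cabs1 cabsM cabsR ger0_norm ?invr_ge0//.
  rewrite conjc1 mul1r RCM /=; field; rewrite gt_eqF//.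
have -> : 2 * (complex.Re w + cabs w ^+ 2 / (2 * n%:R)) =
   n%:R * ((2 * complex.Re w + cabs w ^+ 2 / n%:R) / n%:R).
  by field; rewrite gt_eqF.
rewrite expRM_natl; set y := (_ / n%:R).
have [y1|y1] := leP 0 (1 + y).
  by rewrite ler_pXn2r ?nnegrE ?expR_ge0 ?expR_ge1Dx.
have : 0 <= 1 + y.
  have -> : 1 + y = cabs (1 + w / n%:R) ^+ 2.
    rewrite wn sqr_cabsD cabs1 cabsM cabsR ger0_norm ?invr_ge0//.
    rewrite conjc1 mul1r RCM /= /y; field; rewrite gt_eqF//.
  by rewrite exprn_ge0// cabs_ge0.
by rewrite leNgt y1.
Qed.

(* Szego-type inequality: testing against the polynomials (1 + g/n)^n, which
   approximate exp g, bounds the geometric mean of e^h by a Fourier coefficient. *)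
Lemma szego k r (h : R -> R) : 0 < r < 1 ->
  (forall j, (j < k)%N -> cint circ (fun t => u (r%:C * expi t) * conjc (expi t) ^+ j) = 0) ->
  continuous h -> h 0 = h (2 * pi) ->
  cabs (cint circ (fun t => u (r%:C * expi t) * conjc (expi t) ^+ k)) *
    expR ((\int[mu]_(t in circ) h t) / (2 * pi)) <=
  2 * expR 4 * \int[mu]_(t in circ) (cabs (u (r%:C * expi t)) * expR (h t)).
Proof.
move=> hr h0 ch h02; have mc := @measurable_circ R; have fc := @mu_circ_fin R.
have hr' : 0 <= r < 1 by case/andP: hr => r0 ->; rewrite ltW.
have cu := cbm_analytic hu hr'; have rh := rbm_circ ch.
have [g [g0 hg]] := trig_approx ch h02 (ltr01 : 0 < 1 :> R).
have cg : cbm circ (fun t : R => g.[expi t]) by apply: cbm_horner; exact: cbm_expi.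
have [B hB] : exists B, forall s : R, circ s -> cabs g.[expi s] ^+ 2 <= B.
  have [_ [B hB]] := rbmX 2 (rbm_cabs cg); exists B => s cs.
  by have := hB s cs; rewrite ger0_norm ?exprn_ge0 ?cabs_ge0.
pose x := complex.Re g.[0]; have gx : g.[0] = x%:C by apply: complexP.
have [N hN] := expR_lower x.
(* [N] gives |q(0)| >= e^(x-1), and n >= B keeps the second-order term |g|^2 / (2 n) below 1, so |q|
   <= e^(h+2) on the circle. As the mean of h is at most x + 1, the total loss is e^2 e^2, the
   [expR 4] of the statement. *)
pose n := (maxn N (Num.trunc B).+1).
have n0 : (0 < n)%N by rewrite leq_max orbT.
have n1 : 0 < n%:R :> R by rewrite ltr0n.
have nB : B <= n%:R.
  by rewrite (le_trans (ltW (truncnS_gt _)))// ler_nat leq_maxr.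
have {}hN : expR (x - 1) <= `|1 + x / n%:R| ^+ n by apply: hN; rewrite // leq_maxl.
pose q := (1 + (n%:R^-1)%:P * g) ^+ n.
have qE z : q.[z] = (1 + g.[z] / n%:R) ^+ n.
  by rewrite /q horner_exp hornerD hornerM !hornerC mulrC.
have q0 : expR (x - 1) <= cabs q.[0].
  rewrite qE gx cabsX (_ : 1 + _ = (1 + x / n%:R)%:C) ?cabsR//.
  by rewrite rmorphD rmorphM /= fmorphV rmorph_nat.
have qb t : circ t -> cabs q.[expi t] <= expR 2 * expR (h t).
  move=> ct; rewrite qE (le_trans (exp_poly_bound _ n0))// -expRD ler_expR.
  have := hg t (circ_cc ct).
  rewrite ler_norml => /andP[h1 h2].
  have : cabs g.[expi t] ^+ 2 / (2 * n%:R) <= 1.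
    by rewrite ler_pdivrMr ?mulr_gt0// mul1r; have := hB _ ct; lra.
  lra.
have meanh : (\int[mu]_(t in circ) h t) / (2 * pi) <= x + 1.
  rewrite ler_pdivrMr ?twopi_gt0// -fine_mu_circ -rint_cst//.
  have -> : \int[mu]_(t0 in circ) (x + 1) = \int[mu]_(t in circ) (complex.Re g.[expi t] + 1).
    have [rg _] := cg.
    rewrite rintD//; [|exact: rbm_cst|exact: rbm_cst].
    rewrite rintD//; [|exact: rbm_cst].
    congr (_ + _).
    have /(congr1 (@complex.Re R)) := cint_horner g.
    rewrite RCM Re_cint /= -/x => ->.
    by rewrite rint_cst// fine_mu_circ mulrC.
  apply: rint_le => //; first by apply: rbmD; [by have [] := cg|exact: rbm_cst].
  move=> t ct; have := hg t (circ_cc ct).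
  by rewrite ler_norml => /andP[h1 h2]; lra.
set U := fun t => u (r%:C * expi t) * conjc (expi t) ^+ k.
have cU : cbm circ U by apply: cbmM => //; exact: cbm_expiN.
have cq : cbm circ (fun t : R => q.[expi t]) by apply: cbm_horner; exact: cbm_expi.
have rE : rbm circ (fun t => expR (h t)).
  by apply: rbm_circ => t; apply: continuous_comp; [exact: ch|exact: continuous_expR].
apply: (@le_trans _ _ (cabs (cint circ U) * expR (x + 1))).
  by rewrite ler_wpM2l ?cabs_ge0// ler_expR.
apply: (@le_trans _ _ (expR 2 * cabs (cint circ (fun t => U t * q.[expi t])))).
  rewrite (cint_mul_horner hu _ hr h0) cabsM mulrA [X in _ <= X]mulrC.
  rewrite ler_wpM2l ?cabs_ge0// (_ : x + 1 = 2 + (x - 1)); last by ring.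
  by rewrite expRD ler_wpM2l ?expR_ge0.
rewrite (_ : 4 = 2 + 2)%R; last by ring.
set J := \int[mu]_(t in circ) _.
rewrite (expRD 2 2) (_ : 2 * (expR 2 * expR 2) * J = expR 2 * (2 * (expR 2 * J))); last by ring.
rewrite ler_wpM2l ?expR_ge0//.
rewrite (le_trans (cabs_cint mc fc (cbmM cU cq)))// ler_wpM2l//.
have ru : rbm circ (fun t => cabs (u (r%:C * expi t)) * expR (h t)).
  by apply: rbmM => //; exact: rbm_cabs.
rewrite /J -rintZ//; apply: rint_le => //.
- by apply: rbm_cabs; exact: cbmM.
- by apply: rbmM => //; exact: rbm_cst.
move=> t ct; rewrite !cabsM cabsX cabsJ cabs_expi expr1n mulr1.
by rewrite mulrCA ler_wpM2l ?cabs_ge0// qb.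
Qed.

Lemma measurable_small (f : R -> R) (c : R) : continuous f ->
  measurable [set t | f t < c].
Proof.
move=> cf; rewrite (_ : [set _ | _] = setT `&` f @^-1` `]-oo, c[).
  by apply: (continuous_measurable_fun cf) => //; exact: measurable_itv.
by rewrite setTI; apply/seteqP; split=> t /=; rewrite in_itv.
Qed.

(** Take h = - ln (|u|^2 + c^2) / 2 with c = e^(-s). By [szego] its integral is at most a constant
    [K1] independent of c and r. On the set |u| < c one has h >= s - 1, elsewhere h >= -(|u| + 1),
    so s times the measure of the set is at most K1 + S + 2 pi, and s is taken large. *)
Theorem small_set (S : R) : (exists z, disc z /\ u z != 0) ->
  (forall r, 0 <= r < 1 -> \int[mu]_(t in circ) cabs (u (r%:C * expi t)) <= S) ->
  forall e : R, 0 < e -> exists2 c : R, 0 < c & forall r, 1 / 2 <= r < 1 ->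
    \int[mu]_(t in circ) \1_[set t | cabs (u (r%:C * expi t)) < c] t <= e.
Proof.
move=> /(fourier_first hu)[k [ck hk]] hS e e0.
have mc := @measurable_circ R; have fc := @mu_circ_fin R.
have h2 : 0 < (1 / 2 : R) < 1 by apply/andP; split; lra.
set m0 := cabs (cint circ (fun t => u ((1 / 2)%:C * expi t) * conjc (expi t) ^+ k)).
have m00 : 0 < m0 by rewrite cabs_gt0.
have tp := @twopi_gt0 R.
pose K1 := 2 * pi * (2 * expR 4 * (2 * pi) / m0).
pose K := K1 + S + 2 * pi.
pose s := Num.max 1 (K / e); have s1 : 1 <= s by rewrite le_max lexx.
have s0 : 0 < s by rewrite (lt_le_trans _ s1).
have sK : K <= s * e by rewrite -ler_pdivrMr// le_max lexx orbT.
exists (expR (- s)); first exact: expR_gt0.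
move=> r hr; have hr0 : 0 < r < 1 by case/andP: hr => r2 ->; rewrite andbT (lt_le_trans _ r2).
have hr' : 0 <= r < 1 by case/andP: hr0 => /ltW -> ->.
set c := expR (- s); have c0 : 0 < c := expR_gt0 _.
have c1 : c <= 1 by rewrite -expR0 ler_expR oppr_le0 ltW.
pose U t := cabs (u (r%:C * expi t)).
have U0 t : 0 <= U t := cabs_ge0 _.
have cU : continuous U by apply: continuous_cabs; exact: analytic_circle.
have rU : rbm circ U by exact: rbm_circ.
(* The term c^2 keeps the logarithm continuous at zeros of u. Still |u| e^h <= 1, which bounds the
   right-hand side of [szego]. *)
pose w t := U t ^+ 2 + c ^+ 2.
have w0 t : 0 < w t by rewrite ltr_wpDl ?exprn_ge0 ?exprn_gt0.
pose h t := - (ln (w t) / 2).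
have hE t : expR (h t) ^+ 2 = (w t)^-1.
  rewrite -expRM_natl /h mulrN mulrC divfK ?pnatr_eq0// expRN lnK//.
  by rewrite posrE.
have cw : continuous w.
  move=> t; apply: cvgD; last exact: cvg_cst.
  by under eq_fun do rewrite expr2; apply: cvgM; exact: cU.
have ch : continuous h.
  move=> t; apply: cvgN; apply: cvgM; last exact: cvg_cst.
  by apply: (@continuous_comp _ _ _ w (@ln R)); [exact: cw|exact: continuous_ln].
have h02 : h 0 = h (2 * pi) by rewrite /h /w /U expi0 expi2pi.
have := szego hr0 (fun j jk => hk j r jk hr0) ch h02.
set I := \int[mu]_(t in circ) h t.
set J := (X in _ <= _ * X) => hsz.
have J2 : J <= 2 * pi.
  rewrite -fine_mu_circ -[fine _]mul1r -rint_cst//; apply: rint_le => //.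
  - apply: rbmM => //; apply: rbm_circ => t.
    by apply: continuous_comp; [exact: ch|exact: continuous_expR].
  - exact: rbm_cst.
  move=> t _; rewrite -(@ler_pXn2r _ 2) ?nnegrE ?mulr_ge0 ?expR_ge0 ?cabs_ge0//.
  rewrite exprMn hE expr1n ler_pdivrMr// mul1r /w lerDl exprn_ge0// ltW//.
(* The modulus of the coefficient is proportional to r^k, hence at least its value at 1/2 for r >=
   1/2. *)
have mr : m0 <= cabs (cint circ (fun t => u (r%:C * expi t) * conjc (expi t) ^+ k)).
  have r2 : 0 < r by case/andP: hr0.
  have h20 : 0 < (1 / 2 : R) by lra.
  have := cabs_powM (ltW h20) (ltW r2) (negative_freq k hu hr0 h2).
  rewrite -/m0; set a := cabs _ => ha.
  have h2k : 0 < (1 / 2 : R) ^+ k by rewrite exprn_gt0//; lra.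
  rewrite -(ler_pM2l h2k) ha ler_wpM2r ?(ltW m00)//.
  by rewrite lerXn2r// ?nnegrE; case/andP: hr => //; lra.
have I1 : I <= K1.
  have : m0 * expR (I / (2 * pi)) <= 2 * expR 4 * (2 * pi).
    apply: (@le_trans _ _ (2 * expR 4 * J)).
      by apply: le_trans hsz; rewrite ler_wpM2r// expR_ge0.
    by rewrite ler_wpM2l// mulr_ge0// expR_ge0.
  rewrite mulrC -ler_pdivlMr// => hI.
  have : I / (2 * pi) <= 2 * expR 4 * (2 * pi) / m0.
    by apply: le_trans hI; apply: le_trans (expR_ge1Dx _); rewrite lerDr.
  by rewrite ler_pdivrMr// mulrC.
set A := [set t | U t < c].
have mA : measurable A by exact: measurable_small.
have rA : rbm circ (\1_A : R -> R) by exact: rbm_indic.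
have rh : rbm circ h by exact: rbm_circ.
have : s * \int[mu]_(t in circ) \1_A t <= I + S + 2 * pi.
  rewrite -rintZ//.
  apply: (@le_trans _ _ (\int[mu]_(t in circ) (h t + U t + 1))).
    apply: rint_le => //.
    - by apply: rbmM => //; exact: rbm_cst.
    - by apply: rbmD; [exact: rbmD|exact: rbm_cst].
    move=> t _; rewrite indicE; case: (boolP (t \in A)) => [/set_mem/= tA|_].
      rewrite mulr1; have hw : w t <= expR (2 * (1 - s)).
        rewrite (_ : 2 * (1 - s) = 1 + (1 + (- s + - s))); last by ring.
        rewrite 3!expRD -/c -expr2.
        have := U0 t; have e2 : 2 <= expR 1 :> R by have := expR_ge1Dx (1 : R); lra.
        have : 0 <= c ^+ 2 by rewrite exprn_ge0// ltW.
        have : U t ^+ 2 <= c ^+ 2 by rewrite ler_pXn2r ?nnegrE ?(ltW tA)// ltW.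
        rewrite /w; move: (c ^+ 2) (expR 1) e2 => q E e2 h7 q0 _.
        have q1 : 2 * q <= E * q by rewrite ler_wpM2r.
        have : 1 * (E * q) <= E * (E * q).
          by rewrite ler_wpM2r ?mulr_ge0//; lra.
        by lra.
      have : ln (w t) <= 2 * (1 - s) by rewrite -ler_expR lnK ?posrE.
      by have := U0 t; rewrite /h; lra.
    rewrite mulr0; have : ln (w t) <= 2 * (U t + 1).
      rewrite -ler_expR lnK ?posrE// expRM_natl.
      have e1 := expR_ge1Dx (U t + 1).
      have : (1 + (U t + 1)) ^+ 2 <= expR (U t + 1) ^+ 2.
        by rewrite ler_pXn2r ?nnegrE ?expR_ge0//; have := U0 t; lra.
      by have := U0 t; rewrite /w; nra.
    by rewrite /h; lra.
  rewrite rintD//; [|exact: rbmD|exact: rbm_cst].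
  rewrite rintD// rint_cst// mul1r fine_mu_circ lerD2r lerD2l.
  exact: hS.
by move=> hI; rewrite -(ler_pM2l s0); apply: (le_trans hI); rewrite (le_trans _ sK)// /K !lerD2r.
Qed.

End Jensen.

(** * Lacunary polynomials and subordination *)

Section CoefNorm.
Variable R : realType.
Local Notation C := R[i].
Local Notation mu := (@lebesgue_measure R).
Implicit Types (p f g : {poly C}).

(** The squared H^2 norm read off the coefficients; polynomials with disjoint sets of exponents then
    add exactly. *)
Definition coefsq p : R := \sum_(i < size p) cabs p`_i ^+ 2.

Lemma coefsqE n p : (size p <= n)%N -> coefsq p = \sum_(i < n) cabs p`_i ^+ 2.
Proof.
move=> pn; rewrite /coefsq (big_ord_widen n (fun i => cabs p`_i ^+ 2))//.
rewrite [RHS](bigID (fun i : 'I_n => (i < size p)%N))/=.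
rewrite [X in _ = _ + X]big1 ?addr0// => i; rewrite -leqNgt => hi.
by rewrite nth_default// cabs0 expr0n.
Qed.

Lemma coefsq0 : coefsq 0 = 0.
Proof. by rewrite /coefsq size_poly0 big_ord0. Qed.

Lemma coefsqZ c p : coefsq (c *: p) = cabs c ^+ 2 * coefsq p.
Proof.
rewrite (@coefsqE (size p) (c *: p)) ?size_scale_leq// /coefsq mulr_sumr.
by apply: eq_bigr => i _; rewrite coefZ cabsM exprMn.
Qed.

Lemma coefsq_cat n p g : (size p <= n)%N ->
  coefsq (p + g * 'X^n) = coefsq p + coefsq g.
Proof.
move=> pn; rewrite (@coefsqE (n + size g)); last first.
  rewrite (leq_trans (size_polyD _ _))// geq_max (leq_trans pn) ?leq_addr//=.
  by rewrite (leq_trans (size_polyMleq _ _))// size_polyXn addnS/= addnC.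
rewrite big_split_ord/=; congr (_ + _).
  rewrite (coefsqE pn); apply: eq_bigr => i _.
  by rewrite coefD coefMXn ltn_ord addr0.
apply: eq_bigr => i _; rewrite coefD coefMXn ltnNge leq_addr/= addnC addnK.
by rewrite nth_default ?add0r// (leq_trans pn)// leq_addl.
Qed.

Lemma coefsq_sum n m (P : nat -> {poly C}) : (forall j, (j <= m)%N -> (size (P j) <= n)%N) ->
  coefsq (\sum_(j < m.+1) P j * 'X^(n * j)) = \sum_(j < m.+1) coefsq (P j).
Proof.
elim: m P => [|m ih] P hP.
  by rewrite !big_ord1 muln0 expr0 mulr1.
rewrite !(big_ord_recl m.+1) muln0 expr0 mulr1.
rewrite (_ : \sum_(i < m.+1) _ = (\sum_(i < m.+1) P i.+1 * 'X^(n * i)) * 'X^n).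
  rewrite coefsq_cat; last exact: hP.
  rewrite (ih (fun j => P j.+1))//; by move=> j jm; apply: hP.
rewrite mulr_suml; apply: eq_bigr => i _.
by rewrite lift0 mulnS addnC exprD mulrA.
Qed.

(* By the gap condition the terms of the binomial expansion of (g + a X^(nk N))^m
   have disjoint sets of exponents, so the coefficient sums of squares add up. *)
Lemma coefsq_dissociate (M N : nat) (nk : nat -> nat) (a : nat -> C) :
  (0 < nk 0)%N -> (forall k, (M * nk k < nk k.+1)%N) ->
  forall m, (m <= M)%N ->
  coefsq ((\sum_(k < N) a k *: 'X^(nk k)) ^+ m) <=
    m`!%:R * (\sum_(k < N) cabs (a k) ^+ 2) ^+ m.
Proof.
move=> nk0 hn; case: (posnP M) => [->|M0].
  move=> m; rewrite leqn0 => /eqP ->; rewrite !expr0 mulr1.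
  rewrite (coefsqE (n := 1)) ?size_poly1// big_ord1 coef1 eqxx cabs1 expr1n.
  by rewrite fact0.
have mono k l : (k <= l)%N -> (nk k <= nk l)%N.
  move=> /subnK <-; elim: (l - k)%N => [|d ih]; rewrite ?add0n// addSn.
  rewrite (leq_trans ih)// (leq_trans (leq_pmull _ M0))//.
  exact/ltnW/hn.
elim: N => [|N ih] m mM.
  rewrite !big_ord0; case: m mM => [|m] _.
    rewrite !expr0 mulr1 (coefsqE (n := 1)) ?size_poly1// big_ord1 coef1 eqxx.
    by rewrite cabs1 expr1n fact0.
  by rewrite !expr0n /= coefsq0 mulr0.
rewrite !big_ord_recr/=; set g := \sum_(k < N) _; set s := \sum_(k < N) _.
have s0 : 0 <= s by apply: sumr_ge0 => i _; rewrite exprn_ge0// cabs_ge0.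
(* All powers of g up to M have degree below [nk N], so the factors X^(nk N * i) move them into
   separate blocks. *)
have sg : (M * (size g).-1 < nk N)%N.
  case: N {ih} @g @s s0 => [|N] g s s0.
    by rewrite /g big_ord0 size_poly0 muln0.
  apply: leq_ltn_trans (hn N); rewrite leq_mul2l; apply/orP; right.
  suff : (size g <= (nk N).+1)%N by case: (size g).
  apply: (leq_trans (size_sum _ _ _)); apply/bigmax_leqP => i _.
  rewrite (leq_trans (size_scale_leq _ _))// size_polyXn ltnS mono//.
  by rewrite -ltnS.
have sz j : (j <= m)%N -> (size (g ^+ j) <= nk N)%N.
  move=> jm; rewrite (leq_trans (size_poly_exp_leq _ _))//.
  apply: leq_ltn_trans sg; rewrite mulnC leq_mul2r; apply/orP; right.
  exact: leq_trans mM.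
rewrite exprDn.
rewrite (_ : \sum_(i < m.+1) _ =
    \sum_(i < m.+1) (('C(m, i)%:R * a N ^+ i) *: g ^+ (m - i)) * 'X^(nk N * i)).
  rewrite (coefsq_sum (P := fun i => ('C(m, i)%:R * a N ^+ i) *: g ^+ (m - i))).
    rewrite exprDn mulr_sumr; apply: ler_sum => i _.
    have im : (i <= m)%N by rewrite -ltnS.
    rewrite coefsqZ cabsM cabsX exprMn -exprM mulnC exprM.
    rewrite (_ : cabs _ = 'C(m, i)%:R); last first.
      by rewrite -(rmorph_nat (real_complex R)) /= cabsR ger0_norm.
    have := ih (m - i)%N (leq_trans (leq_subr _ _) mM); rewrite -/g -/s => hi.
    set b := (cabs (a N) ^+ 2) ^+ i.
    have b0 : 0 <= b by rewrite /b exprn_ge0// exprn_ge0// cabs_ge0.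
    (* One binomial coefficient is kept for the expansion on the right; the other, times (m - i)!,
       is at most m!. This is the origin of the factorial. *)
    apply: (@le_trans _ _ ('C(m, i)%:R ^+ 2 * b * ((m - i)`!%:R * s ^+ (m - i)))).
      by rewrite ler_wpM2l// mulr_ge0// exprn_ge0.
    rewrite -[X in _ <= _ * X]mulr_natr expr2.
    rewrite (_ : _ * _ = ('C(m, i) * (m - i)`!)%:R * (s ^+ (m - i) * b * 'C(m, i)%:R)); last first.
      by rewrite natrM; ring.
    apply: ler_wpM2r.
      by apply: mulr_ge0 => //; apply: mulr_ge0 => //; exact: exprn_ge0.
    by rewrite ler_nat -(bin_fact im) leq_mul2l leq_pmull ?fact_gt0 ?orbT.
  by move=> j jm; rewrite (leq_trans (size_scale_leq _ _))// sz// leq_subr.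
apply: eq_bigr => i _.
by rewrite exprZn -exprM -scalerAr -scaler_nat scalerA scalerAl.
Qed.

Lemma horner_lacunary (N : nat) (nk : nat -> nat) (a : nat -> C) (z : C) :
  (\sum_(k < N) a k *: 'X^(nk k)).[z] = \sum_(k < N) a k * z ^+ nk k.
Proof. by rewrite horner_sum; apply: eq_bigr => k _; rewrite hornerZ hornerXn. Qed.

Lemma analytic_horner (g : {poly C}) (f : C -> C) : analytic_on_disc f ->
  analytic_on_disc (fun z => g.[f z]).
Proof.
move=> hf; rewrite (_ : (fun z => _) = fun z => \sum_(i < size g) g`_i * f z ^+ i).
  apply: (@analytic_sum R 'I_(size g) _ _ (fun i z => g`_i * f z ^+ i)) => i _.
  exact: (analyticM (analytic_cst g`_i) (analyticX i hf)).
by apply/funext => z; rewrite horner_coef.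
Qed.

End CoefNorm.

Arguments analytic_horner {R} g {f}.

(** * Littlewood's subordination principle *)

Section Subordination.
Variable R : realType.
Local Notation C := R[i].
Local Notation mu := (@lebesgue_measure R).
Variable phi : C -> C.
Hypothesis aphi : analytic_on_disc phi.
Hypothesis dphi : forall z, disc z -> disc (phi z).

(** In the inductive step |c|^2 occurs twice, once in the integral and once in the extra summand:
    this is the 2. The fraction pays for the cross terms. *)
Definition subord_cst : R := 2 + 4 * cabs (phi 0) ^+ 2 / (1 - cabs (phi 0) ^+ 2).

Let a := cabs (phi 0).
Let a0 : 0 <= a := cabs_ge0 _.
Let a1 : a < 1. Proof. by have := dphi (@disc0 R). Qed.

(* Littlewood's subordination principle for polynomials: peeling off the constant
   term of f, the extra summand |f(phi 0)|^2 absorbs the cross term. *)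
Lemma subordination (r : R) (f : {poly C}) : 0 <= r < 1 ->
  \int[mu]_(t in circ) (cabs f.[phi (r%:C * expi t)] ^+ 2) <=
  2 * pi * (subord_cst * coefsq f).
Proof.
move=> hr; have mc := @measurable_circ R; have fc := @mu_circ_fin R.
have tp := @twopi_gt0 R.
have cphi := cbm_analytic aphi hr.
have ch (g : {poly C}) : cbm circ (fun t => g.[phi (r%:C * expi t)]).
  exact: cbm_horner.
suff : \int[mu]_(t in circ) (cabs f.[phi (r%:C * expi t)] ^+ 2) +
    2 * pi * cabs f.[phi 0] ^+ 2 <= 2 * pi * (subord_cst * coefsq f).
  by apply: le_trans; rewrite lerDl mulr_ge0 ?(ltW tp)// exprn_ge0// cabs_ge0.
elim/poly_ind: f => [|p c ih].
  rewrite coefsq0 !mulr0 horner0 cabs0 expr0n mulr0 addr0.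
  rewrite (_ : \int[mu]_(t in circ) _ = \int[mu]_(t in circ) 0).
    by rewrite rint_cst// mul0r.
  by apply: eq_Rintegral => t _; rewrite horner0 cabs0 expr0n.
pose P t := p.[phi (r%:C * expi t)]; pose ph t := phi (r%:C * expi t).
have ph1 t : cabs (ph t) <= 1.
  by apply: ltW; apply: (dphi (disc_circle t hr)).
have rP : rbm circ (fun t => cabs (P t) ^+ 2) by apply: rbmX; apply: rbm_cabs; exact: ch.
have cM : cbm circ (fun t => conjc c * (P t * ph t)).
  by apply: cbmM; [exact: cbm_cst|apply: cbmM; [exact: ch|exact: cphi]].
have rM : rbm circ (fun t => complex.Re (conjc c * (P t * ph t))) by have [] := cM.
have e1 : \int[mu]_(t in circ) (cabs (p * 'X + c%:P).[ph t] ^+ 2) <=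
    2 * pi * cabs c ^+ 2 + 2 * (2 * pi * complex.Re (conjc c * (p.[phi 0] * phi 0))) +
    \int[mu]_(t in circ) (cabs (P t) ^+ 2).
  apply: (@le_trans _ _ (\int[mu]_(t in circ) (cabs c ^+ 2 +
      2 * complex.Re (conjc c * (P t * ph t)) + cabs (P t) ^+ 2))).
    apply: rint_le => //.
    - by apply: rbmX; apply: rbm_cabs; exact: ch.
    - apply: rbmD => //; apply: rbmD; [exact: rbm_cst|apply: rbmM => //; exact: rbm_cst].
    move=> t _; rewrite hornerMXaddC addrC sqr_cabsD -/(P t).
    rewrite -addrA [_ ^+ 2 + 2 * _]addrC addrA lerD2l cabsM exprMn.
    by rewrite ler_piMr ?exprn_ge0 ?cabs_ge0// exprn_ile1// cabs_ge0.
  rewrite rintD//; last first.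
    by apply: rbmD; [exact: rbm_cst|apply: rbmM => //; exact: rbm_cst].
  rewrite lerD2r rintD//; [|exact: rbm_cst|apply: rbmM => //; exact: rbm_cst].
  rewrite rint_cst// fine_mu_circ rintZ// -Re_cint cintZ//; last by apply: cbmM; [exact: ch|exact: cphi].
  rewrite (mean_value (f := fun z => p.[phi z] * phi z) _ hr); last first.
    exact: (analyticM (analytic_horner p aphi) aphi).
  by rewrite (mulrCA (conjc c)) RCM [cabs c ^+ 2 * _]mulrC.
rewrite (_ : coefsq (p * 'X + c%:P) = cabs c ^+ 2 + coefsq p); last first.
  rewrite addrC -{1}['X]expr1 coefsq_cat ?size_polyC ?leq_b1//; congr (_ + _).
  by rewrite (coefsqE (n := 1)) ?size_polyC ?leq_b1// big_ord1 coefC.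
rewrite hornerMXaddC.
have e2 : complex.Re (conjc c * (p.[phi 0] * phi 0)) <= cabs c * (cabs p.[phi 0] * a).
  by rewrite (le_trans (ler_norm _))// (le_trans (Re_le_cabs _))// !cabsM cabsJ.
have e3 : cabs (p.[phi 0] * phi 0 + c) <= cabs p.[phi 0] * a + cabs c.
  by rewrite (le_trans (cabsD _ _))// cabsM.
have {}e3 : cabs (p.[phi 0] * phi 0 + c) ^+ 2 <= (cabs p.[phi 0] * a + cabs c) ^+ 2.
  by rewrite ler_pXn2r ?nnegrE ?cabs_ge0 ?addr_ge0 ?mulr_ge0 ?cabs_ge0.
move: e2 e3 ih e1; rewrite -/(P _).
set Re1 := complex.Re _; set S := cabs (_ + c) ^+ 2; set I1 := \int[mu]_(t in circ) _.
set I2 := \int[mu]_(t in circ) _.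
have := cabs_ge0 c; have := cabs_ge0 p.[phi 0].
move: (cabs c) (cabs p.[phi 0]) => x y y0 x0 e2 e3 ih e1.
(* The cross terms, 2xya from the integral and 2xya from the extra summand, are balanced against (1
   - a^2) y^2. That is what remains of the extra summand y^2 of the induction hypothesis after a^2
   y^2 has been spent. *)
have hb : 4 * x * y * a <= 4 * a ^+ 2 / (1 - a ^+ 2) * x ^+ 2 + (1 - a ^+ 2) * y ^+ 2.
  have d0 : 0 < 1 - a ^+ 2 by rewrite subr_gt0 expr_lt1.
  rewrite -subr_ge0.
  have -> : 4 * a ^+ 2 / (1 - a ^+ 2) * x ^+ 2 + (1 - a ^+ 2) * y ^+ 2 - 4 * x * y * a =
     (2 * a * x - (1 - a ^+ 2) * y) ^+ 2 / (1 - a ^+ 2).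
    by field; rewrite gt_eqF.
  by rewrite divr_ge0 ?sqr_ge0// ltW.
have -> : subord_cst * (x ^+ 2 + coefsq p) =
  2 * x ^+ 2 + 4 * a ^+ 2 / (1 - a ^+ 2) * x ^+ 2 + subord_cst * coefsq p.
  by rewrite /subord_cst -/a; ring.
move: (4 * a ^+ 2 / _ * _) hb => b hb.
move: (subord_cst * coefsq p) ih => c2 ih.
apply: (@le_trans _ _ (2 * pi * x ^+ 2 + 2 * (2 * pi * (x * (y * a))) + I1 +
   2 * pi * (y * a + x) ^+ 2)).
  rewrite lerD//; last by rewrite ler_pM2l.
  by rewrite (le_trans e1)// lerD2r lerD2l ler_pM2l// ler_pM2l.
move: (2 * pi) tp ih => T T0 ih.
have : T * (x ^+ 2 + 2 * (x * (y * a)) + (y * a + x) ^+ 2 - y ^+ 2) <= T * (2 * x ^+ 2 + b).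
  rewrite ler_pM2l//; nra.
lra.
Qed.

End Subordination.

(** * Weak convergence of the powers and the contact set *)

Section L1Approximation.
Variable R : realType.
Local Notation C := R[i].
Local Notation mu := (@lebesgue_measure R).

Lemma indic_continuous_approx (E : set R) (e : R) : measurable E -> 0 < e ->
  exists f : R -> R, continuous f /\ \int[mu]_(t in circ) `|\1_E t - f t| <= e.
Proof.
move=> mE e0; have mc := @measurable_circ R; have fc := @mu_circ_fin R.
have rE := rbm_indic mc mE.
have [g [cg _ cvg0]] := approximation_continuous_integrable mc fc (rbm_integrable mc fc rE).
have /fine_cvgP[_ /cvgrPdist_le/(_ e e0)[n _ /(_ n (leqnn n))]] := cvg0.
rewrite /= sub0r normrN => hn; exists (g n); split; first exact: cg.
exact: le_trans (ler_norm _) hn.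
Qed.

(** A continuous L^1 approximant f may differ at 0 and 2 pi. Adding the jump times a ramp [psi] on
    the last stretch of length d makes it periodic at an L^1 cost of at most [j * d]; f, the ramp
    and [trig_approx] each cost e / 3. *)
Lemma indic_trig_approx (E : set R) (e : R) : measurable E -> 0 < e ->
  exists g : {poly C}, \int[mu]_(t in circ) `|\1_E t - complex.Re g.[expi t]| <= e.
Proof.
move=> mE e0; have mc := @measurable_circ R; have fc := @mu_circ_fin R.
have rE := rbm_indic mc mE; have tp := @twopi_gt0 R.
have e30 : 0 < e / 3 by rewrite divr_gt0.
have [f [cf hf]] := indic_continuous_approx mE e30.
pose j := `|f 0 - f (2 * pi)| + 1.
have j0 : 0 < j by rewrite ltr_wpDl.
pose d := Num.min (2 * pi) (e / 3 / j).
have d0 : 0 < d by rewrite lt_min tp divr_gt0.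
have d2 : d <= 2 * pi by rewrite ge_min lexx.
have dj : j * d <= e / 3 by rewrite mulrC -ler_pdivlMr// ge_min lexx orbT.
pose psi t := Num.max 0 ((t - (2 * pi - d)) / d).
have cpsi : continuous psi.
  move=> t; apply: (@continuous_max R R (fun=> 0) (fun t => (t - (2 * pi - d)) / d) t).
    exact: cvg_cst.
  apply: cvgM; last exact: cvg_cst.
  by apply: cvgB; [exact: cvg_id|exact: cvg_cst].
pose h t := f t + (f 0 - f (2 * pi)) * psi t.
have ch : continuous h.
  move=> t; apply: cvgD; first exact: cf.
  by apply: cvgM; [exact: cvg_cst|exact: cpsi].
have psi0 : psi 0 = 0.
  by apply/max_idPl; rewrite mulr_le0_ge0 ?invr_ge0 ?(ltW d0)// sub0r oppr_le0 subr_ge0.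
have psi2 : psi (2 * pi) = 1.
  by rewrite /psi opprB addrCA subrr addr0 divff ?gt_eqF//; apply/max_idPr.
have h02 : h 0 = h (2 * pi).
  by rewrite /h psi0 psi2 mulr0 addr0 mulr1 addrCA subrr addr0.
have e60 : 0 < e / (3 * (2 * pi)) by rewrite divr_gt0// mulr_gt0.
have [g [_ hg]] := trig_approx ch h02 e60.
exists g.
have mI : measurable (`[2 * pi - d, 2 * pi[%classic : set R) by exact: measurable_itv.
have rI := rbm_indic mc mI.
have rg : rbm circ (fun t => complex.Re g.[expi t]).
  by have [] := cbm_horner g (@cbm_expi R).
have rf : rbm circ f by exact: rbm_circ.
have r1 : rbm circ (fun t => `|\1_E t - f t|) by apply: rbm_norm; exact: rbmB.
have r2 : rbm circ (fun t => j * \1_(`[2 * pi - d, 2 * pi[%classic) t).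
  by apply: rbmM => //; exact: rbm_cst.
apply: (@le_trans _ _ (\int[mu]_(t in circ) (`|\1_E t - f t| +
    j * \1_(`[2 * pi - d, 2 * pi[%classic) t + e / (3 * (2 * pi))))).
  apply: rint_le => //.
  - by apply: rbm_norm; exact: rbmB.
  - by apply: rbmD; [exact: rbmD|exact: rbm_cst].
  move=> t ct; have ht := hg t (circ_cc ct).
  rewrite (_ : \1_E t - _ = (\1_E t - f t) + (f t - h t) + (h t - complex.Re g.[expi t]));
    last by ring.
  rewrite (le_trans (ler_normD _ _))// lerD// (le_trans (ler_normD _ _))// lerD2l.
  rewrite /h opprD addrA subrr sub0r normrN normrM.
  have psi_ge0 : 0 <= psi t by rewrite le_max lexx.
  rewrite (ger0_norm psi_ge0) ler_pM//; first by rewrite lerDl.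
  rewrite indicE; case: (boolP (t \in _)) => [_|] /=.
    rewrite ge_max ler01/= ler_pdivrMr// mul1r.
    by have /andP[_ ?] := circ_cc ct; lra.
  move/negP => nt; rewrite ge_max lexx/=.
  rewrite mulr_le0_ge0 ?invr_ge0 ?(ltW d0)// subr_le0 leNgt; apply/negP => h1.
  apply: nt; rewrite inE /= in_itv/= (ltW h1)/=.
  by move: ct; rewrite /circ/= in_itv/= => /andP[].
rewrite rintD//; [|exact: rbmD|exact: rbm_cst].
rewrite (@rint_cst _ circ)// rintD// rintZ// fine_mu_circ rint_indic//.
have -> : `[2 * pi - d, 2 * pi[%classic `&` circ = `[2 * pi - d, 2 * pi[%classic :> set R.
  apply/setIidPl => t /=; rewrite /circ/= !in_itv/= => /andP[h1 ->].
  by rewrite andbT (le_trans _ h1)// subr_ge0.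
rewrite lebesgue_measure_itv/= lte_fin ltrBlDr ltrDl d0/=.
have -> : 2 * pi - (2 * pi - d) = d by ring.
have -> : e / (3 * (2 * pi)) * (2 * pi) = e / 3.
  by move: (2 * pi) tp => P P0; field; rewrite gt_eqF.
lra.
Qed.

End L1Approximation.

Lemma pow_le (R : realType) (x y : R) m : 0 <= x -> x <= y -> x ^+ m <= y ^+ m.
Proof. by move=> x0 xy; apply: lerXn2r; rewrite ?nnegrE// (le_trans x0 xy). Qed.

Lemma half_powM_bound (R : realType) (a b r B : R) i : 0 <= b -> b <= B ->
  0 <= r <= 1 -> (1 / 2) ^+ i * a = r ^+ i * b -> a <= 2 ^+ i * B.
Proof.
move=> b0 bB /andP[r0 r1] ab; have p2 : 0 < (1 / 2 : R) ^+ i.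
  by rewrite exprn_gt0// divr_gt0.
rewrite -(ler_pM2l p2) ab mulrA -exprMn (_ : 1 / 2 * 2 = 1); last first.
  by rewrite divfK ?pnatr_eq0.
rewrite expr1n mul1r; apply: le_trans bB.
by rewrite ler_piMl// exprn_ile1.
Qed.

(** * The powers of phi tested against indicator functions *)

Section WeakNull.
Variable R : realType.
Local Notation C := R[i].
Local Notation mu := (@lebesgue_measure R).
Variable phi : C -> C.
Hypothesis aphi : analytic_on_disc phi.
Hypothesis dphi : forall z, disc z -> disc (phi z).

Let mc := @measurable_circ R.
Let fc := @mu_circ_fin R.

Lemma half_circle_sup : exists s : R, [/\ 0 <= s, s < 1 &
  forall t, circ t -> cabs (phi ((1 / 2)%:C * expi t)) <= s].
Proof.
have h2 : 0 <= (1 / 2 : R) < 1 by apply/andP; split; lra.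
pose f t := cabs (phi ((1 / 2)%:C * expi t)).
have cf : continuous f by apply: continuous_cabs; exact: analytic_circle.
have p0 : 0 <= 2 * pi :> R by rewrite ltW// twopi_gt0.
have [c _ hc] := EVT_max p0 (continuous_subspaceT cf).
exists (f c); split; first exact: cabs_ge0.
  by apply: (dphi (disc_circle c h2)).
by move=> t /circ_cc ct; apply: hc; rewrite in_itv.
Qed.

(** The indicator is replaced by a trigonometric polynomial. The Fourier coefficients of phi^m on
    |z| = r are carried to |z| = 1/2, where |phi| <= s < 1, so they decay like s^m. The threshold
    [m0] serves all radii at once, which allows r to be chosen after the exponents. *)
Lemma weak_null (E : set R) (e : R) : measurable E -> 0 < e ->
  exists m0 : nat, forall m r, (m0 <= m)%N -> 1 / 2 <= r < 1 ->
    cabs (cint circ (fun t => (\1_E t)%:C * phi (r%:C * expi t) ^+ m)) <= e.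
Proof.
move=> mE e0; have tp := @twopi_gt0 R.
have e40 : 0 < e / 4 by rewrite divr_gt0.
have [g hg] := indic_trig_approx mE e40.
have [s [s0 s1 hs]] := half_circle_sup.
have h2 : 0 < (1 / 2 : R) < 1 by apply/andP; split; lra.
have h2' : 0 <= (1 / 2 : R) < 1 by apply/andP; split; lra.
have freq i m r : 1 / 2 <= r < 1 ->
    cabs (cint circ (fun t => phi (r%:C * expi t) ^+ m * conjc (expi t) ^+ i)) <=
    2 ^+ i * (2 * (2 * pi)) * s ^+ m.
  move=> hr; have hr0 : 0 < r < 1 by case/andP: hr => r2 ->; rewrite andbT; lra.
  have r0 : 0 < r by case/andP: hr0.
  have h20 : 0 < (1 / 2 : R) by lra.
  have hab := cabs_powM (ltW h20) (ltW r0) (negative_freq i (analyticX m aphi) hr0 h2).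
  have cb : cbm circ (fun t => phi ((1 / 2)%:C * expi t) ^+ m * conjc (expi t) ^+ i).
    apply: cbmM; last exact: cbm_expiN.
    by apply: cbmX; exact: (cbm_analytic aphi h2').
  have hb t : circ t -> cabs (phi ((1 / 2)%:C * expi t) ^+ m * conjc (expi t) ^+ i) <= s ^+ m.
    move=> ct; rewrite cabsM !cabsX cabsJ cabs_expi expr1n mulr1.
    by apply: pow_le; [exact: cabs_ge0|exact: hs].
  have bb := cint_bound mc fc cb hb.
  have r01 : 0 <= r <= 1 by rewrite (ltW r0)/=; case/andP: hr => _ /ltW.
  rewrite -mulrA (_ : 2 * (2 * pi) * s ^+ m = 2 * (s ^+ m * fine (mu circ))).
    exact: half_powM_bound (cabs_ge0 _) bb r01 hab.
  by rewrite fine_mu_circ; ring.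
(* Re g is half of g plus its conjugate. Against phi^m the part g contributes only its constant
   term, the conjugate one coefficient for each degree. *)
pose K := (cabs g.[0] * (2 * (2 * pi)) +
   \sum_(i < size g) cabs g`_i * (2 ^+ i * (2 * (2 * pi)))).
have K0 : 0 <= K.
  apply: addr_ge0; first by rewrite mulr_ge0 ?cabs_ge0// mulr_ge0// ltW.
  apply: sumr_ge0 => i _; rewrite mulr_ge0 ?cabs_ge0// mulr_ge0 ?exprn_ge0//.
  by rewrite mulr_ge0// ltW.
have : (fun m => K * s ^+ m) @ \oo --> (0 : R).
  rewrite -(mulr0 K); apply: cvgM; first exact: cvg_cst.
  by apply: cvg_expr; rewrite ger0_norm.
move=> /cvgrPdist_le/(_ (e / 2)); rewrite divr_gt0// => /(_ isT)[m0 _ hm0].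
exists m0 => m r mm hr.
have hr0 : 0 < r < 1 by case/andP: hr => r2 ->; rewrite andbT; lra.
have hr' : 0 <= r < 1 by case/andP: hr0 => /ltW -> ->.
have cph : cbm circ (fun t => phi (r%:C * expi t) ^+ m).
  by apply: cbmX; exact: cbm_analytic.
have ph1 t : cabs (phi (r%:C * expi t) ^+ m) <= 1.
  rewrite cabsX exprn_ile1// ?cabs_ge0//; apply: ltW.
  exact: (dphi (disc_circle t hr')).
have cg : cbm circ (fun t : R => g.[expi t]) by apply: cbm_horner; exact: cbm_expi.
have [rg _] := cg; have rE := rbm_indic mc mE.
pose h t := complex.Re g.[expi t].
have c1 : cbm circ (fun t => (\1_E t - h t)%:C * phi (r%:C * expi t) ^+ m).
  by apply: cbmM => //; apply: cbm_real; exact: rbmB.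
have c2 : cbm circ (fun t => (h t)%:C * phi (r%:C * expi t) ^+ m).
  by apply: cbmM => //; exact: cbm_real.
rewrite (eq_cint (G := fun t => (\1_E t - h t)%:C * phi (r%:C * expi t) ^+ m +
   (h t)%:C * phi (r%:C * expi t) ^+ m)); last first.
  by move=> t _; rewrite -mulrDl -rmorphD /= subrK.
rewrite cintD// (le_trans (cabsD _ _))// (_ : e = e / 2 + e / 2); last by lra.
apply: lerD.
  rewrite (le_trans (cabs_cint mc fc c1))// (_ : e / 2 = 2 * (e / 4)); last by lra.
  rewrite ler_wpM2l// (le_trans _ hg)//; apply: rint_le => //.
  - exact: rbm_cabs.
  - by apply: rbm_norm; exact: rbmB.
  by move=> t _; rewrite cabsM cabsR ler_piMr.
have := hm0 m mm; rewrite /= sub0r normrN ger0_norm ?mulr_ge0 ?exprn_ge0//.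
apply: le_trans.
have c3 : cbm circ (fun t => phi (r%:C * expi t) ^+ m * g.[expi t]) by exact: cbmM.
have c4 : cbm circ (fun t => phi (r%:C * expi t) ^+ m * conjc g.[expi t]).
  by apply: cbmM => //; exact: cbmJ.
rewrite (eq_cint (G := fun t => 2^-1 * (phi (r%:C * expi t) ^+ m * g.[expi t] +
   phi (r%:C * expi t) ^+ m * conjc g.[expi t]))); last first.
  by move=> t _; rewrite -mulrDr ReJ_add mulrC mulrA mulrC.
rewrite cintZ ?cintD//; last exact: cbmD.
rewrite cabsM; apply: (@le_trans _ _ (1 * (K * s ^+ m))); last by rewrite mul1r.
apply: ler_pM; rewrite ?cabs_ge0//.
  rewrite cabsV -(rmorph_nat (real_complex R)) /= cabsR ger0_norm// invf_le1//; lra.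
rewrite (le_trans (cabsD _ _))// /K mulrDl lerD//.
  have := @cint_mul_horner R (fun z => phi z ^+ m) (analyticX m aphi) r 0 g hr0.
  rewrite (eq_cint (G := fun t => phi (r%:C * expi t) ^+ m * g.[expi t])); last first.
    by move=> t _; rewrite expr0 mulr1.
  move=> -> //; rewrite cabsM -mulrA ler_wpM2l ?cabs_ge0//.
  by rewrite (le_trans (freq 0 m r hr))// expr0 mul1r.
rewrite (eq_cint (G := fun t => \sum_(i < size g)
    conjc g`_i * (phi (r%:C * expi t) ^+ m * conjc (expi t) ^+ i))); last first.
  move=> t _; rewrite horner_coef conjc_sum mulr_sumr; apply: eq_bigr => i _.
  by rewrite conjcM conjcX mulrCA.
have c5 (i : nat) : cbm circ (fun t => phi (r%:C * expi t) ^+ m * conjc (expi t) ^+ i).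
  by apply: cbmM => //; exact: cbm_expiN.
rewrite cint_sum//; last by move=> i _; apply: cbmM; [exact: cbm_cst|exact: c5].
rewrite (le_trans (cabs_sum _ _ _))// mulr_suml; apply: ler_sum => i _.
by rewrite cintZ// cabsM cabsJ -mulrA ler_wpM2l ?cabs_ge0// freq.
Qed.

End WeakNull.

Section Gaps.

Lemma lacunary_gaps (M : nat) (thr : nat -> nat) : (0 < M)%N ->
  exists nk : nat -> nat, [/\ (0 < nk 0)%N, forall k, (M * nk k < nk k.+1)%N &
    forall k l, (l < k)%N -> (thr k <= nk k - nk l)%N].
Proof.
(* The first summand forces the ratio M; the other two put [nk k.+1] at distance at least [thr k.+1]
   from every earlier exponent. *)
move=> M0; pose nk := fix nk k :=
  if k is k'.+1 then ((M * nk k').+1 + nk k' + thr k)%N else 1%N.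
have nkS k : nk k.+1 = ((M * nk k).+1 + nk k + thr k.+1)%N by [].
have mono i j : (i <= j)%N -> (nk i <= nk j)%N.
  move=> /subnK <-; elim: (j - i)%N => [|d ih]; rewrite ?add0n// addSn.
  by apply: (leq_trans ih); rewrite nkS addnAC leq_addl.
exists nk; split=> [//|k|[//|k] l]; first by rewrite nkS -addnA leq_addr.
rewrite ltnS => /mono lk; have lS : (nk l + thr k.+1 <= nk k.+1)%N.
  by rewrite nkS leq_add2r (leq_trans lk)// leq_addl.
by rewrite leq_subRL// (leq_trans _ lS)// leq_addr.
Qed.

End Gaps.

(** * The contact set and the Gram matrix of the powers of phi *)

Section ContactSet.
Variable R : realType.
Local Notation C := R[i].
Local Notation mu := (@lebesgue_measure R).

Let mc := @measurable_circ R.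
Let fc := @mu_circ_fin R.

Lemma rint_dct0 (f : nat -> R -> R) (B : R) : (forall n, rbm circ (f n)) ->
  (forall n t, circ t -> `|f n t| <= B) ->
  (forall t, circ t -> f ^~ t @ \oo --> (0 : R)) ->
  (fun n => \int[mu]_(t in circ) f n t) @ \oo --> (0 : R).
Proof.
move=> hf hB f0.
have h1 : {ae mu, forall t, circ t -> (fun n => (f n t)%:E) @ \oo --> 0%:E}.
  by apply: aeW => t ct; apply/fine_cvgP; split; [exact: nearW|exact: f0].
have h2 : {ae mu, forall t n, circ t -> (`|(f n t)%:E| <= B%:E)%E}.
  by apply: aeW => t n ct; exact: hB.
have [_ _] := @dominated_convergence _ _ R mu circ mc (fun n t => (f n t)%:E)
  (fun=> 0%E) (fun=> B%:E)
  (fun n => (measurable_EFinP _ _).2 (hf n).1) (measurable_cst _) h1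
  (rbm_integrable mc fc (rbm_cst circ B)) h2.
by rewrite integral0 => /fine_cvg.
Qed.

(** The shift to n + 2 starts the sequence at 1/2, the lower end of the range on which [weak_null]
    and [small_set] are uniform. *)
Definition radius (n : nat) : R := 1 - n.+2%:R^-1.

Lemma radius_bounds n : 1 / 2 <= radius n < 1.
Proof.
have h : 0 < n.+2%:R^-1 :> R by rewrite invr_gt0.
have : n.+2%:R^-1 <= 2^-1 :> R by rewrite lef_pV2 ?posrE// ler_nat.
rewrite /radius; move: (n.+2%:R^-1) h => x h h2; apply/andP; split; lra.
Qed.

Variable phi : C -> C.
Hypothesis aphi : analytic_on_disc phi.
Hypothesis dphi : forall z, disc z -> disc (phi z).

(* Only the radii 1 - 1/(n+2) are tested, which makes this set visibly measurable;
   it contains contact_set. *)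
Definition contact : set R := circ `&` \bigcap_k \bigcup_N \bigcap_n
  [set t | 1 - k.+1%:R^-1 < cabs (phi ((radius (N + n))%:C * expi t))].

Lemma measurable_contact : measurable contact.
Proof.
apply: measurableI => //; apply: bigcapT_measurable => k.
apply: bigcupT_measurable => N; apply: bigcapT_measurable => n.
set f := fun t => cabs (phi ((radius (N + n))%:C * expi t)).
have cf : continuous f.
  apply: continuous_cabs; apply: analytic_circle => //.
  by have /andP[h ->] := radius_bounds (N + n); rewrite andbT; lra.
rewrite (_ : [set t | _] = setT `&` f @^-1` `]1 - k.+1%:R^-1, +oo[).
  by apply: (continuous_measurable_fun cf) => //; exact: measurable_itv.
by rewrite setTI; apply/seteqP; split=> t /=; rewrite in_itv/= andbT.
Qed.

Lemma contact_cvg t : contact t ->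
  (fun n => cabs (phi ((radius n)%:C * expi t))) @ \oo --> (1 : R).
Proof.
move=> [ct h]; apply/cvgrPdist_lt => e e0.
have [k hk] : exists k : nat, k.+1%:R^-1 < e.
  exists (Num.trunc e^-1); rewrite invf_plt ?posrE//.
  by rewrite truncnS_gt.
have [N _ hN] := h k I.
exists N => // n /= Nn; have := hN (n - N)%N I; rewrite /= subnKC// => h1.
have h2 : cabs (phi ((radius n)%:C * expi t)) < 1.
  apply: (dphi (disc_circle t _)).
  by have /andP[h2 ->] := radius_bounds n; rewrite andbT; lra.
move: (k.+1%:R^-1) hk h1 => x hk h1; rewrite ger0_norm; lra.
Qed.

Lemma contact_set_sub : contact_set phi `<=` contact.
Proof.
move=> t [ct [l [hl l1]]]; split=> // k _.
have k0 : 0 < k.+1%:R^-1 :> R by rewrite invr_gt0.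
have /cvg_cabs/cvgrPdist_lt/(_ _ k0) := hl.
rewrite l1 => -[d /= d0 hd].
have [N hN] : exists N, forall n, (N <= n)%N -> n.+2%:R^-1 < d.
  exists (Num.trunc d^-1) => n Nn; rewrite invf_plt ?posrE//.
  by rewrite (lt_le_trans (truncnS_gt _))// ler_nat ltnS (leq_trans Nn).
exists N => // n _ /=; have h := hN (N + n)%N (leq_addr _ _).
have := hd (radius (N + n)); have /andP[_ r1] := radius_bounds (N + n).
rewrite /radius /ball/= opprB addrCA subrr addr0 ger0_norm ?invr_ge0//.
move=> /(_ h); rewrite -/(radius _) => /(_ r1); rewrite ltr_norml => /andP[_].
by rewrite ltrBlDr -ltrBlDl.
Qed.

Lemma contact_measure : (0 < circ_measure (contact_set phi))%E ->
  0 < \int[mu]_(t in circ) \1_contact t.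
Proof.
move=> h; have mE := measurable_contact.
have h1 : (0 < mu (contact_set phi))%E.
  rewrite lt_neqAle measure_ge0 andbT; apply/eqP => z.
  by move: h; rewrite /circ_measure -z mule0 ltxx.
rewrite rint_indic// setIidl; last by move=> t [].
rewrite fine_gt0//; apply/andP; split.
  (* Unfolding to the outer measure gives monotonicity without measurability of
     [contact_set phi]. *)
  apply: (lt_le_trans h1); rewrite /lebesgue_measure /lebesgue_stieltjes_measure /measure_extension.
  by apply: le_mu_ext; exact: contact_set_sub.
apply: le_lt_trans fc; apply: le_measure; rewrite ?inE//.
by move=> t [].
Qed.

(** Dominated convergence along [radius n]. The radius found depends on m, so it can be fixed only
    once the largest exponent is known. *)
Lemma near_boundary m (e : R) : 0 < e -> exists r : R, 1 / 2 <= r < 1 /\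
  \int[mu]_(t in circ) (\1_contact t * (1 - cabs (phi (r%:C * expi t)) ^+ m)) <= e.
Proof.
move=> e0; have mE := measurable_contact; have rE := rbm_indic mc mE.
pose f n t := \1_contact t * (1 - cabs (phi ((radius n)%:C * expi t)) ^+ m).
have r01 n : 0 <= radius n < 1.
  by have /andP[h2 ->] := radius_bounds n; rewrite andbT; lra.
have rf n : rbm circ (f n).
  apply: rbmM => //; apply: rbmB; first exact: rbm_cst.
  by apply: rbmX; apply: rbm_cabs; exact: cbm_analytic.
have p1 n t : 0 <= cabs (phi ((radius n)%:C * expi t)) ^+ m <= 1.
  rewrite exprn_ge0 ?cabs_ge0//= exprn_ile1 ?cabs_ge0// ltW//.
  exact: (dphi (disc_circle t (r01 n))).
have : (fun n => \int[mu]_(t in circ) f n t) @ \oo --> (0 : R).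
  have f1 n t : circ t -> `|f n t| <= 1.
    move=> _; rewrite /f indicE; have := p1 n t.
    by case: (_ \in _); rewrite ?mul1r ?mul0r ?normr0// => h; rewrite ger0_norm; lra.
  have f0 t : circ t -> f ^~ t @ \oo --> (0 : R).
    move=> _; rewrite /f indicE; case: (boolP (t \in contact)) => [/set_mem tE|_].
      rewrite (_ : 0 = 1 * (1 - 1 ^+ m)); last by rewrite expr1n subrr mulr0.
      apply: cvgM; first exact: cvg_cst.
      apply: cvgB; first exact: cvg_cst.
      have := contact_cvg tE; set g := fun n => _ => hg.
      elim: m {f rf p1 f1} => [|m ih].
        by under eq_fun do rewrite expr0; rewrite expr0; exact: cvg_cst.
      by under eq_fun do rewrite exprS; rewrite exprS; exact: cvgM.
    by under eq_fun do rewrite mul0r; exact: cvg_cst.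
  exact: (rint_dct0 rf f1 f0).
move=> /cvgrPdist_le/(_ e e0)[n _ /(_ n (leqnn n))]; rewrite /= sub0r normrN => hn.
exists (radius n); split; first exact: radius_bounds.
exact: le_trans (ler_norm _) hn.
Qed.

Local Notation muE := (\int[mu]_(t in circ) \1_contact t).

(** The Gram matrix of the functions 1_E phi^(nk k) is close to muE times the identity. For k > l
    the product of phi^k and the conjugate of phi^l is phi^(k-l) |phi|^(2l): on E the modulus is
    replaced by 1 at small cost, and [weak_null] handles phi^(k-l). The errors use up at most half
    of muE. *)
Lemma gram_lower (M : nat) : (0 < M)%N -> 0 < muE ->
  exists nk : nat -> nat, [/\ (0 < nk 0)%N, forall k, (M * nk k < nk k.+1)%N &
  forall (N : nat) (a : nat -> C), exists r : R, 1 / 2 <= r < 1 /\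
    muE / 2 * (\sum_(k < N) cabs (a k) ^+ 2) <=
    \int[mu]_(t in circ) (\1_contact t *
       cabs (\sum_(k < N) a k * phi (r%:C * expi t) ^+ nk k) ^+ 2)].
Proof.
move=> M0 E0; have mE := measurable_contact; have rE := rbm_indic mc mE.
(* For l <= k one has 4^(-k) <= 2^(-k) 2^(-l), so the bound for the pair (k, l) factors and sums to
   at most 4 over all pairs. *)
pose eps k : R := muE / 16 * (1 / 4) ^+ k.
have eps0 k : 0 < eps k by rewrite mulr_gt0 ?exprn_gt0 ?divr_gt0.
have /choice[thr hthr] : forall k, exists m0 : nat, forall m r, (m0 <= m)%N -> 1 / 2 <= r < 1 ->
    cabs (cint circ (fun t => (\1_contact t)%:C * phi (r%:C * expi t) ^+ m)) <= eps k.
  by move=> k; exact: weak_null.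
have [nk [nk0 nkM nkthr]] := lacunary_gaps thr M0.
exists nk; split=> // N a.
set S := \sum_(k < N) _.
have S0 : 0 <= S by apply: sumr_ge0 => i _; rewrite exprn_ge0// cabs_ge0.
have aS (k : 'I_N) : cabs (a k) ^+ 2 <= S.
  by rewrite /S (bigD1 k)//= lerDl sumr_ge0// => i _; rewrite exprn_ge0// cabs_ge0.
have aa (k l : 'I_N) : cabs (a k) * cabs (a l) <= S.
  have := aS k; have := aS l; have := cabs_ge0 (a k); have := cabs_ge0 (a l).
  move: (cabs (a k)) (cabs (a l)) => x y; have := sqr_ge0 (x - y); nra.
(* Each of the N^2 entries carries an error [2 * e'], together at most muE / 4; the [eps] terms make
   up the other quarter. *)
pose e' : R := muE / (8 * (N%:R ^+ 2 + 1)).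
have N0 : 0 < N%:R ^+ 2 + 1 :> R by rewrite ltr_wpDl// exprn_ge0.
have e'0 : 0 < e' by rewrite divr_gt0// mulr_gt0.
(* As |phi| <= 1, its powers decrease in the exponent, so one radius good for [mx] is good for all k
   < N. *)
pose mx := (\max_(k < N) (2 * nk k))%N.
have [r [hr hbd]] := near_boundary mx e'0.
have hr' : 0 <= r < 1 by case/andP: hr => h2 ->; rewrite andbT; lra.
exists r; split=> //.
pose ph t := phi (r%:C * expi t).
have cph : cbm circ ph by exact: cbm_analytic.
have ph0 t : 0 <= cabs (ph t) by exact: cabs_ge0.
have ph1 t : cabs (ph t) <= 1 by apply: ltW; exact: (dphi (disc_circle t hr')).
have cX n : cbm circ (fun t => ph t ^+ n) by exact: cbmX.
have cXJ n : cbm circ (fun t => conjc (ph t) ^+ n) by apply: cbmX; exact: cbmJ.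
have cE : cbm circ (fun t => (\1_contact t)%:C) by exact: cbm_real.
have rEX n : rbm circ (fun t => \1_contact t * (1 - cabs (ph t) ^+ n)).
  by apply: rbmM => //; apply: rbmB; [exact: rbm_cst|apply: rbmX; exact: rbm_cabs].
have ind01 t : 0 <= (\1_contact t : R) <= 1.
  by rewrite indicE; case: (_ \in _); rewrite ?lexx ?ler01.
have bd (k : 'I_N) : \int[mu]_(t in circ) (\1_contact t * (1 - cabs (ph t) ^+ (2 * nk k))) <= e'.
  apply: le_trans hbd; apply: rint_le => //.
  move=> t _; have /andP[i0 _] := ind01 t; rewrite ler_wpM2l// lerD2l lerN2.
  have kmx : (2 * nk k <= mx)%N by exact: (@leq_bigmax _ (fun k : 'I_N => (2 * nk k)%N) k).
  by apply: ler_wiXn2l; [exact: ph0|exact: ph1|exact: kmx].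
pose G k l := cint circ (fun t => (\1_contact t)%:C * (ph t ^+ k * conjc (ph t) ^+ l)).
have cG k l : cbm circ (fun t => (\1_contact t)%:C * (ph t ^+ k * conjc (ph t) ^+ l)).
  by apply: cbmM => //; exact: cbmM.
have GJ k l : G k l = conjc (G l k).
  rewrite /G -cintJ//; apply: eq_cint => t _.
  by rewrite !conjcM conjc_real !conjcX conjcK [conjc _ ^+ l * _]mulrC.
have powE k l t : (l <= k)%N ->
    ph t ^+ k * conjc (ph t) ^+ l = ph t ^+ (k - l) * (cabs (ph t) ^+ (2 * l))%:C.
  move=> lk; rewrite -{1}(subnK lk) exprD -mulrA -exprMn mulCJ exprM.
  by congr (_ * _); exact/esym/(rmorphXn (real_complex R)).
have Gdiag (k : 'I_N) : muE - e' <= complex.Re (G (nk k) (nk k)).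
  rewrite Re_cint lerBlDr -lerBlDl (le_trans _ (bd k))//.
  have [rG _] := cG (nk k) (nk k).
  rewrite -rintB// le_eqVlt; apply/orP; left; apply/eqP; apply: eq_Rintegral => t _.
  by rewrite powE// subnn expr0 mul1r RCM /= mulrBr mulr1.
have Goff' (k l : 'I_N) : (l < k)%N ->
    cabs (G (nk k) (nk l)) <= eps k + 2 * e'.
  move=> lk; have lkn : (nk l <= nk k)%N.
    rewrite leqNgt; apply/negP => h.
    suff mono i j : (i <= j)%N -> (nk i <= nk j)%N by move: (mono l k (ltnW lk)); rewrite leqNgt h.
    move=> /subnK <-; elim: (j - i)%N => [|d ih]; rewrite ?add0n// addSn.
    rewrite (leq_trans ih)// (leq_trans (leq_pmull _ M0))//; exact/ltnW/nkM.
  have c1 : cbm circ (fun t => (\1_contact t)%:C * ph t ^+ (nk k - nk l)) by exact: cbmM.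
  have c2 : cbm circ (fun t => (\1_contact t)%:C *
      (ph t ^+ (nk k - nk l) * (1 - cabs (ph t) ^+ (2 * nk l))%:C)).
    apply: cbmM => //; apply: cbmM => //; apply: cbm_real; apply: rbmB.
      exact: rbm_cst.
    by apply: rbmX; exact: rbm_cabs.
  have -> : G (nk k) (nk l) =
      cint circ (fun t => (\1_contact t)%:C * ph t ^+ (nk k - nk l)) -
      cint circ (fun t => (\1_contact t)%:C *
        (ph t ^+ (nk k - nk l) * (1 - cabs (ph t) ^+ (2 * nk l))%:C)).
    rewrite -cintB//; apply: eq_cint => t _; rewrite powE// rmorphB /=.
    rewrite mulrBr mulr1 mulrBr; ring.
  rewrite (le_trans (cabsB _ _))// lerD//; first by apply: hthr => //; exact: nkthr.
  rewrite (le_trans (cabs_cint mc fc c2))// ler_wpM2l// (le_trans _ (bd l))//.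
  apply: rint_le => //; first exact: rbm_cabs.
  move=> t _; have /andP[i0 i1] := ind01 t.
  rewrite !cabsM !cabsR cabsX (ger0_norm i0) ler_wpM2l//.
  have h : 0 <= 1 - cabs (ph t) ^+ (2 * nk l) by rewrite subr_ge0 exprn_ile1.
  by rewrite (ger0_norm h) ler_piMl// exprn_ile1.
have Goff (k l : 'I_N) : k != l ->
    cabs (G (nk k) (nk l)) <= muE / 16 * (1 / 2) ^+ k * (1 / 2) ^+ l + 2 * e'.
  have epsE (i j : nat) : (j <= i)%N -> eps i <= muE / 16 * (1 / 2) ^+ i * (1 / 2) ^+ j.
    move=> ji; rewrite /eps -[X in _ <= X]mulrA ler_wpM2l ?divr_ge0 ?(ltW E0)//.
    rewrite (_ : 1 / 4 = 1 / 2 * (1 / 2) :> R); last by field.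
    rewrite exprMn ler_wpM2l ?exprn_ge0//.
    by apply: ler_wiXn2l => //; lra.
  rewrite neq_ltn => /orP[kl|lk].
    rewrite GJ cabsJ (le_trans (Goff' _ _ kl))// lerD2r.
    by rewrite -mulrA [X in _ * X]mulrC mulrA epsE// ltnW.
  by rewrite (le_trans (Goff' _ _ lk))// lerD2r epsE// ltnW.
pose F t := \sum_(k < N) a k * ph t ^+ nk k.
have expand t : \1_contact t * cabs (F t) ^+ 2 = \sum_(k < N) \sum_(l < N)
    complex.Re (a k * conjc (a l) * ((\1_contact t)%:C * (ph t ^+ nk k * conjc (ph t) ^+ nk l))).
  have -> : \1_contact t * cabs (F t) ^+ 2 =
      complex.Re ((\1_contact t)%:C * (F t * conjc (F t))).
    by rewrite mulCJ RCM.
  rewrite /F conjc_sum mulr_suml mulr_sumr Re_sum; apply: eq_bigr => k _.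
  rewrite !mulr_sumr Re_sum; apply: eq_bigr => l _; congr complex.Re.
  by rewrite conjcM conjcX; ring.
have cT k l : cbm circ (fun t => a k * conjc (a l) *
    ((\1_contact t)%:C * (ph t ^+ nk k * conjc (ph t) ^+ nk l))).
  by apply: cbmM; [exact: cbm_cst|exact: cG].
suff : muE / 2 * S <= \int[mu]_(t in circ) (\1_contact t * cabs (F t) ^+ 2) by [].
have -> : \int[mu]_(t in circ) (\1_contact t * cabs (F t) ^+ 2) =
    \sum_(k < N) \sum_(l < N) complex.Re (a k * conjc (a l) * G (nk k) (nk l)).
  transitivity (\int[mu]_(t in circ) \sum_(k < N) \sum_(l < N)
    complex.Re (a k * conjc (a l) * ((\1_contact t)%:C * (ph t ^+ nk k * conjc (ph t) ^+ nk l)))).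
    by apply: eq_Rintegral => t _; rewrite -expand.
  rewrite rint_sum//; last by move=> k _; apply: rbm_sum => l _; have [] := cT k l.
  apply: eq_bigr => k _; rewrite rint_sum//; last by move=> l _; have [] := cT k l.
  by apply: eq_bigr => l _; rewrite -cintZ// Re_cint.
(* The same error is charged to every entry, the diagonal included, so that the double sum
   factors. *)
have term (k l : 'I_N) : (if k == l then cabs (a k) ^+ 2 * muE else 0) -
    S * (muE / 16 * (1 / 2) ^+ k * (1 / 2) ^+ l + 2 * e') <=
    complex.Re (a k * conjc (a l) * G (nk k) (nk l)).
  have p0 : 0 <= muE / 16 * (1 / 2) ^+ k * (1 / 2) ^+ l :> R.
    by rewrite !mulr_ge0 ?exprn_ge0// ltW.
  case: eqVneq => [lk|kl]; first rewrite -lk in p0 *.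
    rewrite mulCJ RCM /=; apply: (@le_trans _ _ (cabs (a k) ^+ 2 * (muE - e'))); last first.
      by apply: ler_wpM2l (Gdiag k); exact: sqr_ge0.
    rewrite mulrBr lerD2l lerN2; apply: ler_pM (aS k) _; first exact: sqr_ge0.
      exact: ltW.
    by move: (muE / 16 * _ * _) (p0 : is_true _) => z z0; lra.
  rewrite sub0r; have := Re_le_cabs (a k * conjc (a l) * G (nk k) (nk l)).
  rewrite ler_norml => /andP[h _]; apply: le_trans h; rewrite lerN2 !cabsM cabsJ.
  by rewrite ler_pM ?mulr_ge0 ?cabs_ge0// Goff.
apply: (@le_trans _ _ (\sum_(k < N) \sum_(l < N)
   ((if k == l then cabs (a k) ^+ 2 * muE else 0) -
    S * (muE / 16 * (1 / 2) ^+ k * (1 / 2) ^+ l + 2 * e')))); last first.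
  by apply: ler_sum => k _; apply: ler_sum => l _; exact: term.
have geo : \sum_(l < N) (1 / 2) ^+ l <= 2 :> R.
  have h2 : (1 - 1 / 2) * \sum_(l < N) (1 / 2) ^+ l = 1 - (1 / 2) ^+ N :> R.
    by rewrite -[1 - 1 / 2]opprB mulNr -subrX1 opprB.
  have : 0 <= (1 / 2) ^+ N :> R by rewrite exprn_ge0.
  lra.
have geo0 : 0 <= \sum_(l < N) (1 / 2) ^+ l :> R.
  by apply: sumr_ge0 => l _; rewrite exprn_ge0.
rewrite (_ : \sum_(k < N) _ = S * muE - S * (muE / 16 * (\sum_(l < N) (1 / 2) ^+ l) ^+ 2
    + 2 * e' * N%:R ^+ 2)); last first.
  under eq_bigr do rewrite sumrB.
  rewrite sumrB; congr (_ - _).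
    rewrite /S mulr_suml; apply: eq_bigr => k _.
    rewrite (bigD1 k)//= eqxx big1 ?addr0// => l lk.
    by rewrite eq_sym (negbTE lk).
  under eq_bigr do rewrite -mulr_sumr big_split/= -mulr_sumr.
  rewrite -mulr_sumr big_split/= -mulr_suml -mulr_sumr.
  rewrite !sumr_const card_ord; congr (S * (_ + _)); first by rewrite expr2 mulrA.
  by rewrite -mulr_natr -[_ *+ N]mulr_natr; ring.
have e'E : 2 * e' * N%:R ^+ 2 <= muE / 4.
  have -> : muE / 4 = 2 * e' * (N%:R ^+ 2 + 1) by rewrite /e'; field; rewrite gt_eqF.
  by apply: ler_wpM2l; [rewrite mulr_ge0// ltW|rewrite lerDl].
move: (\sum_(l < N) _) geo geo0 => g geo geo0.
have g4 : g ^+ 2 <= 4 by nra.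
have h1 : muE / 16 * g ^+ 2 <= muE / 4 by have := E0; nra.
rewrite -mulrBr mulrC ler_wpM2l//; lra.
Qed.

End ContactSet.

(** * Lacunary power series *)

Section ComplexSeries.
Variable R : realType.
Local Notation C := R[i].

Lemma cauchy_real (x : nat -> R) :
  (forall e : R, 0 < e -> exists N, forall n, (N <= n)%N -> `|x N - x n| < e) ->
  exists l : R, x @ \oo --> l.
Proof.
move=> h; suff : cvg (x @ \oo) by move=> /cvg_ex.
apply: cauchy_cvg; apply: cauchy_exP => e e0; have [N hN] := h e e0.
by exists (x N); exists N => // n /= Nn; exact: hN.
Qed.

Lemma cabs_dist3 (x y z w : C) (e : R) : cabs (x - y) <= e / 3 ->
  cabs (y - z) <= e / 3 -> cabs (w - z) <= e / 3 -> cabs (x - w) <= e.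
Proof.
move=> h1 h2 h3; rewrite (_ : x - w = (x - y) + ((y - z) + (z - w))); last by rewrite !subrKA.
rewrite (_ : e = e / 3 + (e / 3 + e / 3)); last by lra.
rewrite (le_trans (cabsD _ _))// lerD// (le_trans (cabsD _ _))//.
by rewrite lerD// cabsC.
Qed.

Definition ccvg (s : nat -> C) (l : C) :=
  forall e : R, 0 < e -> exists N, forall n, (N <= n)%N -> cabs (s n - l) < e.

Lemma cauchy_complex (s : nat -> C) :
  (forall e : R, 0 < e -> exists N, forall n, (N <= n)%N -> cabs (s N - s n) < e) ->
  exists l : C, ccvg s l.
Proof.
move=> h.
have [a ha] : exists a : R, (fun n => complex.Re (s n)) @ \oo --> a.
  apply: cauchy_real => e e0; have [N hN] := h e e0; exists N => n Nn.
  by apply: le_lt_trans (hN n Nn); rewrite -cReN -cReD Re_le_cabs.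
have [b hb] : exists b : R, (fun n => complex.Im (s n)) @ \oo --> b.
  apply: cauchy_real => e e0; have [N hN] := h e e0; exists N => n Nn.
  by apply: le_lt_trans (hN n Nn); rewrite -cImN -cImD Im_le_cabs.
exists (a +i* b) => e e0; have e20 : 0 < e / 2 by rewrite divr_gt0.
have /cvgrPdist_lt/(_ _ e20)[N1 _ h1] := ha.
have /cvgrPdist_lt/(_ _ e20)[N2 _ h2] := hb.
exists (maxn N1 N2) => n; rewrite geq_max => /andP[n1 n2].
have {}h1 := h1 n n1; have {}h2 := h2 n n2.
rewrite (le_lt_trans (cabs_le _))// !cE/= (splitr e).
by rewrite ltrD// distrC.
Qed.

Lemma ccvg_le (s : nat -> C) (l c : C) (B : R) (N : nat) : ccvg s l ->
  (forall n, (N <= n)%N -> cabs (s n - c) <= B) -> cabs (l - c) <= B.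
Proof.
move=> sl h; apply/ler_addgt0Pl => e e0.
have [M hM] := sl e e0.
pose n := maxn M N; have := hM n (leq_maxl _ _); have := h n (leq_maxr _ _).
move=> h1 h2; rewrite -(subrK (s n) l) -addrA (le_trans (cabsD _ _))// lerD//.
by rewrite cabsC ltW.
Qed.

Lemma ccvg_unique s l l' : ccvg s l -> ccvg s l' -> l = l'.
Proof.
move=> sl sl'; apply/eqP; rewrite -subr_eq0 -cabs_eq0 eq_le cabs_ge0 andbT.
apply/ler_addgt0Pl => e e0; rewrite addr0; have [N hN] := sl' e e0.
by apply: (ccvg_le sl) => n /hN/ltW.
Qed.

Lemma ccvg_lin (s t : nat -> C) (ls lt x : C) : ccvg s ls -> ccvg t lt ->
  ccvg (fun n => s n + x * t n) (ls + x * lt).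
Proof.
move=> sl tl e e0; have x0 : 0 < 1 + cabs x by rewrite ltr_pwDl ?cabs_ge0.
have e20 : 0 < e / 2 by rewrite divr_gt0.
have e30 : 0 < e / 2 / (1 + cabs x) by rewrite divr_gt0.
have [N1 h1] := sl _ e20; have [N2 h2] := tl _ e30.
exists (maxn N1 N2) => n; rewrite geq_max => /andP[/h1 {}h1 /h2 {}h2].
rewrite opprD addrACA -mulrBr (le_lt_trans (cabsD _ _))// (splitr e) ltrD//.
rewrite cabsM; apply: (@le_lt_trans _ _ ((1 + cabs x) * cabs (t n - lt))).
  by rewrite ler_wpM2r ?cabs_ge0// lerDr.
by rewrite mulrC -ltr_pdivlMr.
Qed.

(** A divergent series gets the default value 0, so the rules of calculation carry convergence
    hypotheses. *)
Definition csum (b : nat -> C) : C :=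
  xget 0 [set l | ccvg (fun n => \sum_(k < n) b k) l].

Lemma csum_unique (b : nat -> C) (l : C) :
  ccvg (fun n => \sum_(k < n) b k) l -> csum b = l.
Proof. by move=> h; apply: xget_unique => // l' /ccvg_unique; apply. Qed.

Lemma csum_geometric (b : nat -> C) (A x : R) : 0 <= x < 1 -> 0 <= A ->
  (forall k, cabs (b k) <= A * x ^+ k) ->
  ccvg (fun n => \sum_(k < n) b k) (csum b) /\
  forall n, cabs (csum b - \sum_(k < n) b k) <= A * x ^+ n / (1 - x).
Proof.
move=> /andP[x0 x1] A0 hb; have x1' : 0 < 1 - x by rewrite subr_gt0.
pose s n := \sum_(k < n) b k.
have step n d : cabs (s (n + d)%N - s n) <= A * x ^+ n / (1 - x).
  (* The factor 1 - x^d makes the bound exact for the geometric series, hence inductive in d. *)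
  have : (1 - x) * cabs (s (n + d)%N - s n) <= A * x ^+ n * (1 - x ^+ d).
    elim: d => [|d ih]; first by rewrite addn0 subrr cabs0 expr0 subrr !mulr0.
    rewrite /s addnS big_ord_recr/= -/(s _) addrAC.
    apply: (@le_trans _ _ ((1 - x) * (cabs (s (n + d)%N - s n) + cabs (b (n + d)%N)))).
      by rewrite ler_pM2l// cabsD.
    rewrite mulrDr; apply: (le_trans (lerD ih (_ : _ <= (1 - x) * (A * x ^+ (n + d))))).
      by rewrite ler_pM2l.
    by rewrite exprD exprS le_eqVlt; apply/orP; left; apply/eqP; ring.
  rewrite mulrC -ler_pdivlMr// => /le_trans; apply.
  rewrite ler_pM2r ?invr_gt0// ler_piMr ?mulr_ge0 ?exprn_ge0//.
  by rewrite gerBl exprn_ge0.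
have cvgs : exists l : C, ccvg s l.
  apply: cauchy_complex => e e0.
  have : (fun n => A / (1 - x) * x ^+ n) @ \oo --> (0 : R).
    rewrite -(mulr0 (A / (1 - x))); apply: cvgM; first exact: cvg_cst.
    by apply: cvg_expr; rewrite ger0_norm.
  move=> /cvgrPdist_lt/(_ e e0)[N _ /(_ N (leqnn N))]; rewrite /= sub0r normrN => hN.
  exists N => n Nn; rewrite cabsC -(subnKC Nn) (le_lt_trans (step _ _))//.
  by apply: le_lt_trans hN; rewrite mulrAC ler_norm.
have [l hl] := cvgs; have -> : csum b = l by exact: csum_unique.
split=> // n; apply: (ccvg_le (N := n) hl) => m nm.
by rewrite -(subnKC nm) step.
Qed.

Lemma csum_lin (b c : nat -> C) (x lb lc : C) :
  ccvg (fun n => \sum_(k < n) b k) lb -> ccvg (fun n => \sum_(k < n) c k) lc ->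
  csum (fun k => b k + x * c k) = lb + x * lc.
Proof.
move=> hb hc; apply: csum_unique.
rewrite (_ : (fun n => _) = fun n => \sum_(k < n) b k + x * \sum_(k < n) c k).
  exact: ccvg_lin.
by apply/funext => n; rewrite big_split mulr_sumr.
Qed.

Lemma csum_finite (b : nat -> C) N : (forall k, (N <= k)%N -> b k = 0) ->
  csum b = \sum_(k < N) b k.
Proof.
move=> h; apply: csum_unique => e e0; exists N => n Nn.
rewrite -(subnKC Nn) big_split_ord/= addrAC subrr add0r big1 ?cabs0//.
by move=> i _; rewrite h// leq_addr.
Qed.

End ComplexSeries.

Section LacunarySeries.
Variable R : realType.
Local Notation C := R[i].

Variables (nk : nat -> nat) (a : nat -> C) (A : R).
Hypothesis nk_ge : forall k, (k < nk k)%N.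
Hypothesis A0 : 0 <= A.
Hypothesis aA : forall k, cabs (a k) <= A.

Lemma lacunary_cvg (z : C) : disc z ->
  ccvg (fun n => \sum_(k < n) a k * z ^+ nk k) (csum (fun k => a k * z ^+ nk k)) /\
  forall n, cabs (csum (fun k => a k * z ^+ nk k) - \sum_(k < n) a k * z ^+ nk k) <=
    A * cabs z ^+ n / (1 - cabs z).
Proof.
move=> dz; apply: csum_geometric => //; first by rewrite cabs_ge0.
move=> k; rewrite cabsM cabsX ler_pM ?exprn_ge0 ?cabs_ge0//.
by apply: ler_wiXn2l; rewrite ?cabs_ge0 ?(ltW dz)// ltnW.
Qed.

(* The difference quotient of a power series is the sum of the divided
   differences of the monomials, which converges uniformly near z. *)
Lemma lacunary_derivable (z : C) : disc z ->
  derivable ((fun w => csum (fun k => a k * w ^+ nk k)) : C^o -> C^o) z 1.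
Proof.
move=> dz; apply/derivableCP.
(* These points cut the interval from |z| to 1 into thirds. The numbers z + h stay in the disc of
   radius x, and the room between x and y absorbs the number of terms: the divided difference of
   degree n is at most y^n / (y - x). *)
pose x := (1 + 2 * cabs z) / 3; pose y := (2 + cabs z) / 3.
have z0 : 0 <= cabs z := cabs_ge0 z.
have z1 : cabs z < 1 by exact: dz.
have x0 : 0 <= x by rewrite /x; lra.
have xy : x < y by rewrite /x /y; lra.
have y1 : y < 1 by rewrite /y; lra.
have zx : cabs z < x by rewrite /x; lra.
pose d := x - cabs z; have d0 : 0 < d by rewrite subr_gt0.
have hx h : cabs h < d -> cabs (z + h) <= x.
  by move=> hd; rewrite (le_trans (cabsD _ _))//; rewrite /d in hd; lra.
pose q (n : nat) (h : C) : C := \sum_(i < n) (z + h) ^+ (n.-1 - i) * z ^+ i.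
have qE n h : (z + h) ^+ n - z ^+ n = h * q n h.
  by rewrite subrXX addrAC subrr add0r.
have qb n h : cabs h < d -> cabs (q n h) <= y ^+ n / (y - x).
  move=> hd; have hzx := hx h hd.
  apply: (@le_trans _ _ (\sum_(i < n) y ^+ (n.-1 - i) * x ^+ i)).
    rewrite (le_trans (cabs_sum _ _ _))//; apply: ler_sum => i _.
    rewrite cabsM !cabsX ler_pM ?exprn_ge0 ?cabs_ge0//.
      by apply: pow_le; rewrite ?cabs_ge0// (le_trans hzx)// ltW.
    by apply: pow_le => //; exact: ltW.
  have yx0 : 0 < y - x by rewrite subr_gt0.
  rewrite ler_pdivlMr// mulrC -subrXX.
  by rewrite gerBl exprn_ge0.
have Ay : 0 <= A / (y - x) by rewrite divr_ge0// subr_ge0 ltW.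
have y01 : 0 <= y < 1 by rewrite y1 andbT (le_trans x0)// ltW.
pose E h := csum (fun k => a k * q (nk k) h).
have hE h : cabs h < d ->
   ccvg (fun n => \sum_(k < n) a k * q (nk k) h) (E h) /\
   forall n, cabs (E h - \sum_(k < n) a k * q (nk k) h) <= A / (y - x) * y ^+ n / (1 - y).
  move=> hd; apply: csum_geometric => // k.
  rewrite cabsM mulrAC -mulrA ler_pM ?cabs_ge0// (le_trans (qb _ _ hd))//.
  rewrite ler_pM2r ?invr_gt0 ?subr_gt0//.
  case/andP: y01 => y0 _.
  by apply: ler_wiXn2l; [exact: y0|exact: ltW y1|exact: ltnW].
have fE h : cabs h < d ->
    csum (fun k => a k * (z + h) ^+ nk k) - csum (fun k => a k * z ^+ nk k) = h * E h.
  move=> hd; have [E1 _] := hE h hd; have [f1 _] := lacunary_cvg dz.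
  have := @csum_lin _ (fun k => a k * z ^+ nk k) (fun k => a k * q (nk k) h) h _ _ f1 E1; rewrite (_ : (fun k => _) = fun k => a k * (z + h) ^+ nk k).
    by move=> ->; rewrite addrC addKr.
  apply/funext => k; rewrite mulrCA -mulrDr; congr (_ * _).
  by rewrite -qE addrC subrK.
have E0 := hE 0 _; rewrite cabs0 in E0; have {E0}[_ E0] := E0 d0.
exists (E 0) => e e0.
have : (fun n => A / (y - x) / (1 - y) * y ^+ n) @ \oo --> (0 : R).
  rewrite -(mulr0 (A / (y - x) / (1 - y))); apply: cvgM; first exact: cvg_cst.
  by apply: cvg_expr; rewrite ger0_norm//; case/andP: y01.
have e30 : 0 < e / 3 by rewrite divr_gt0.
move=> /cvgrPdist_le/(_ _ e30)[n _ /(_ n (leqnn n))]; rewrite /= sub0r normrN => hn.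
have {}hn : A / (y - x) * y ^+ n / (1 - y) <= e / 3.
  by apply: le_trans hn; rewrite mulrAC ler_norm.
pose P h := \sum_(k < n) a k * q (nk k) h.
have aP : analytic_on_disc P.
  apply: (@analytic_sum R 'I_n _ _ (fun k h => a k * q (nk k) h)) => k _.
  apply: (@analyticM R (fun=> a k) (q (nk k)) (analytic_cst (a k))).
  apply: (@analytic_sum R 'I_(nk k) _ _ (fun i h => (z + h) ^+ ((nk k).-1 - i) * z ^+ i)) => i _.
  exact: (@analyticM R (fun h => (z + h) ^+ ((nk k).-1 - i)) (fun=> z ^+ i)
    (@analyticX R (fun h => z + h) _ (analyticD (analytic_cst z) analytic_id))
    (analytic_cst (z ^+ i))).
have /cvgCP/(_ _ e30) := derivable_continuousC (aP 0 (@disc0 R)).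
move=> /nbhsC0P[d' d'0 hd'].
exists (Num.min d d'); first by rewrite lt_min d0.
move=> h; rewrite lt_min => /andP[hd hd2].
have [_ /(_ n) Eh] := hE h hd.
have {}hd2 := ltW (hd' h hd2).
have hE0 : cabs (E h - E 0) <= e.
  exact: cabs_dist3 (le_trans Eh hn) hd2 (le_trans (E0 n) hn).
rewrite (fE h hd); move: (E h) (E 0) hE0 => x1 x2 H.
by rewrite [x2 * h]mulrC -mulrBr cabsM mulrC ler_wpM2r ?cabs_ge0.
Qed.

End LacunarySeries.

(** * Hardy norms and square-summable sequences *)

Section HardyNorm.
Variable R : realType.
Local Notation C := R[i].
Local Notation mu := (@lebesgue_measure R).

Let mc := @measurable_circ R.
Let fc := @mu_circ_fin R.

Lemma powR_le (x y p : R) : 0 <= p -> 0 <= x -> x <= y -> x `^ p <= y `^ p.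
Proof. by move=> p0 x0 xy; apply: ge0_ler_powR => //; rewrite nnegrE// (le_trans x0). Qed.

Lemma powRV_K (x p : R) : 1 <= p -> 0 <= x -> (x `^ p^-1) `^ p = x.
Proof.
by move=> p1 x0; rewrite -powRrM mulVf ?powRr1// gt_eqF// (lt_le_trans ltr01).
Qed.

Lemma powR_le1DX (y p : R) m : 0 <= y -> 0 <= p -> p <= m%:R -> y `^ p <= 1 + y ^+ m.
Proof.
move=> y0 p0 pm; have [y1|y1] := leP y 1.
  rewrite (le_trans (powR_le p0 y0 y1))// powR1 lerDl exprn_ge0//.
by rewrite -powR_mulrn// (le_trans (ler_powR (ltW y1) pm))// lerDr.
Qed.

Lemma le_1DpowR (y p : R) : 0 <= y -> 1 <= p -> y <= 1 + y `^ p.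
Proof.
move=> y0 p1; have [y1|y1] := leP y 1; first by rewrite (le_trans y1)// lerDl powR_ge0.
by rewrite (le_trans (le1r_powR (ltW y1) p1))// lerDr.
Qed.

Lemma powR_sum_le (x y p : R) : 0 <= x -> 0 <= y -> 0 <= p ->
  (x + y) `^ p <= 2 `^ p * (x `^ p + y `^ p).
Proof.
move=> x0 y0 p0; wlog xy : x y x0 y0 / x <= y.
  move=> h; have [|/ltW] := leP x y; first exact: h.
  by move=> /(h _ _ y0 x0); rewrite [y + x]addrC [y `^ _ + _]addrC.
rewrite (le_trans (powR_le p0 _ (_ : _ <= 2 * y)))//; first exact: addr_ge0.
  by rewrite mulr_natl mulr2n lerD2r.
by rewrite powRM// ler_wpM2l ?powR_ge0// lerDr powR_ge0.
Qed.

Lemma powR_quasi_triangle (x y p a b c : R) : 1 <= p -> 0 <= c -> 0 <= x -> 0 <= y ->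
  a <= c * x `^ p -> b <= c * y `^ p -> 2 `^ p * (a + b) <= c * (4 * (x + y)) `^ p.
Proof.
move=> p1 c0 x0 y0 ha hb; have p0 : 0 <= p by rewrite (le_trans ler01).
apply: (@le_trans _ _ (2 `^ p * (c * (2 * (x + y) `^ p)))).
  rewrite ler_wpM2l ?powR_ge0// (le_trans (lerD ha hb))// -mulrDr.
  by rewrite ler_wpM2l// mulr_natl mulr2n lerD// powR_le// ?lerDl ?lerDr.
rewrite mulrCA ler_wpM2l// powRM ?addr_ge0// mulrA ler_wpM2r ?powR_ge0//.
rewrite (_ : 4 = 2 * 2 :> R) ?powRM//; last by lra.
by rewrite ler_wpM2l ?powR_ge0//; apply: le1r_powR => //; lra.
Qed.

Lemma rbm_powR D (f : R -> R) p : 0 <= p -> (forall x, D x -> 0 <= f x) ->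
  rbm D f -> rbm D (fun x => f x `^ p).
Proof.
move=> p0 f0 [mf [B hB]]; split; first exact: measurableT_comp (measurable_powR p) mf.
exists (B `^ p) => x Dx; rewrite ger0_norm ?powR_ge0// powR_le ?f0//.
by rewrite (le_trans (ler_norm _)) ?hB.
Qed.

Definition pmean (p : R) (f : C -> C) (r : R) : R :=
  \int[mu]_(t in circ) (cabs (f (r%:C * expi t)) `^ p).

Lemma rbm_pmean (p : R) (f : C -> C) (r : R) : 0 <= p -> analytic_on_disc f -> 0 <= r < 1 ->
  rbm circ (fun t => cabs (f (r%:C * expi t)) `^ p).
Proof.
move=> p0 hf hr; apply: rbm_powR => // [t _|]; first exact: cabs_ge0.
by apply: rbm_cabs; exact: cbm_analytic.
Qed.

Lemma pmean_ge0 (p : R) (f : C -> C) (r : R) : 0 <= pmean p f r.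
Proof. by apply: Rintegral_ge0 => t _; exact: powR_ge0. Qed.

Lemma intmeanE (p : R) (f : C -> C) (r : R) : 0 <= p -> analytic_on_disc f -> 0 <= r < 1 ->
  intmean p f r = ((2 * pi)^-1 * pmean p f r)%:E.
Proof.
by move=> p0 hf hr; rewrite /intmean rint_integral//; exact: rbm_pmean.
Qed.

Lemma Hp_sup_eq (p : R) (f g : C -> C) : (forall z, disc z -> cabs (f z) = cabs (g z)) ->
  Hp_sup p f = Hp_sup p g.
Proof.
move=> fg; have /eq_imagel E : forall r, `[0, 1[%classic r -> intmean p f r = intmean p g r.
  move=> r; rewrite /= in_itv/= => hr; apply: (congr1 (fun x => _ * x)%E).
  by apply: eq_integral => t _; rewrite (fg _ (disc_circle t hr)).
by rewrite /Hp_sup E.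
Qed.

Lemma Hp_sup_fin (p : R) (f : C -> C) : 0 <= p -> inHp p f -> Hp_sup p f \is a fin_num /\ (0 <= Hp_sup p f)%E.
Proof.
move=> p0 [hf sf]; have s0 : (0 <= Hp_sup p f)%E.
  apply: (@le_trans _ _ (intmean p f 0)).
    by rewrite intmeanE ?lexx ?ltr01// lee_fin mulr_ge0 ?pmean_ge0// invr_ge0 ltW// twopi_gt0.
  by apply: ereal_sup_ubound; exists 0 => //=; rewrite in_itv/= lexx ltr01.
by split=> //; rewrite ge0_fin_numE.
Qed.

Lemma Hnorm_ge0 (p : R) (f : C -> C) : 0 <= Hnorm p f. Proof. exact: powR_ge0. Qed.

Lemma pmean_le_Hnorm (p : R) (f : C -> C) (r : R) : 1 <= p -> inHp p f -> 0 <= r < 1 ->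
  pmean p f r <= 2 * pi * Hnorm p f `^ p.
Proof.
move=> p1 hf hr; have p0 : 0 <= p by rewrite (le_trans ler01).
have [sf s0] := Hp_sup_fin p0 hf.
rewrite powRV_K ?fine_ge0// mulrC -ler_pdivrMr ?twopi_gt0// mulrC.
rewrite -lee_fin fineK// -intmeanE//; last by have [] := hf.
by apply: ereal_sup_ubound; exists r.
Qed.

Lemma Hnorm_le (p : R) (f : C -> C) (K : R) : 1 <= p -> analytic_on_disc f -> 0 <= K ->
  (forall r, 0 <= r < 1 -> pmean p f r <= 2 * pi * K `^ p) ->
  inHp p f /\ Hnorm p f <= K.
Proof.
move=> p1 hf K0 h; have p0 : 0 < p by rewrite (lt_le_trans ltr01).
have hs : (Hp_sup p f <= (K `^ p)%:E)%E.
  apply: ge_ereal_sup => y [r + <-]; rewrite /= in_itv/= => hr.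
  rewrite intmeanE ?(ltW p0)// lee_fin mulrC ler_pdivrMr ?twopi_gt0// mulrC.
  exact: h.
have fH : inHp p f by split=> //; rewrite (le_lt_trans hs)// ltry.
split=> //; have [sf s0] := Hp_sup_fin (ltW p0) fH.
have -> : K = (K `^ p) `^ p^-1 by rewrite -powRrM mulfV ?powRr1// gt_eqF.
apply: powR_le; rewrite ?invr_ge0 ?fine_ge0// ?(ltW p0)//.
by rewrite -lee_fin fineK.
Qed.

(** The norm is a supremum over radii, so a single circle, chosen for this f, gives a lower
    bound. *)
Lemma Hnorm_ge (p : R) (f : C -> C) (d r : R) : 1 <= p -> inHp p f -> 0 <= r < 1 ->
  2 * pi * d `^ p <= pmean p f r -> d <= Hnorm p f.
Proof.
move=> p1 hf hr hd; rewrite leNgt; apply/negP => lt.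
have /(le_trans hd) := pmean_le_Hnorm p1 hf hr.
rewrite ler_pM2l ?twopi_gt0// leNgt => /negP; apply.
have p0 : 0 < p by rewrite (lt_le_trans ltr01).
by apply: gt0_ltr_powR => //; rewrite nnegrE ?Hnorm_ge0// (le_trans _ (ltW lt))// Hnorm_ge0.
Qed.

(** A quasi-triangle inequality from the pointwise bound (x + y)^p <= 2^p (x^p + y^p). One factor 2
    comes from there, the other from adding the two p-th means. *)
Lemma HnormD (p : R) (f g : C -> C) : 1 <= p -> inHp p f -> inHp p g ->
  inHp p (fun z => f z + g z) /\
  Hnorm p (fun z => f z + g z) <= 4 * (Hnorm p f + Hnorm p g).
Proof.
move=> p1 hf hg; have p0 : 0 <= p by rewrite (le_trans ler01).
have [[af _] [ag _]] := (hf, hg).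
have Hf0 := Hnorm_ge0 p f; have Hg0 := Hnorm_ge0 p g.
have afg := @analyticD R f g af ag.
apply: (Hnorm_le p1 afg); first exact: mulr_ge0 (ler0n _ 4) (addr_ge0 Hf0 Hg0).
move=> r hr; have rf := rbm_pmean p0 af hr; have rg := rbm_pmean p0 ag hr.
apply: (@le_trans _ _ (2 `^ p * (pmean p f r + pmean p g r))).
  rewrite -rintD// -rintZ//; last exact: rbmD.
  apply: rint_le => //; first exact: rbm_pmean p0 afg hr.
    by apply: rbmM; [exact: rbm_cst|exact: rbmD].
  move=> t _; rewrite (le_trans _ (powR_sum_le _ _ p0)) ?cabs_ge0//.
  by rewrite powR_le ?cabs_ge0// cabsD.
exact: powR_quasi_triangle p1 (ltW (@twopi_gt0 R)) Hf0 Hg0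
  (pmean_le_Hnorm p1 hf hr) (pmean_le_Hnorm p1 hg hr).
Qed.

Lemma HnormB (p : R) (f g : C -> C) : 1 <= p -> inHp p f -> inHp p g ->
  inHp p (fun z => f z - g z) /\
  Hnorm p (fun z => f z - g z) <= 4 * (Hnorm p f + Hnorm p g).
Proof.
move=> p1 hf [ag sg].
have E : Hp_sup p (fun z => - g z) = Hp_sup p g.
  by apply: Hp_sup_eq => z _; rewrite cabsN.
have hN : inHp p (fun z => - g z) by split; [exact: analyticN|rewrite E].
by have := HnormD p1 hf hN; rewrite /Hnorm E.
Qed.

Lemma pmean_eq0 (p : R) (f : C -> C) (r : R) : 1 <= p -> analytic_on_disc f -> 0 <= r < 1 ->
  pmean p f r = 0 -> forall t, circ t -> f (r%:C * expi t) = 0.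
Proof.
move=> p1 hf hr h t ct; apply/eqP; rewrite -cabs_eq0; apply/eqP.
have p0 : 0 <= p by rewrite (le_trans ler01).
have cf := analytic_circle hf hr.
have rf := rbm_pmean p0 hf hr; have rc := rbm_cabs (cbm_analytic hf hr).
move: t ct; apply: continuous_eq0 => [|t _|]; [exact: continuous_cabs|exact: cabs_ge0|].
apply/eqP; rewrite eq_le Rintegral_ge0 ?andbT; last by move=> t _; exact: cabs_ge0.
apply/ler_addgt0Pl => e e0; rewrite addr0.
have [d d0 dE] : exists2 d : R, 0 < d & d * (2 * pi) = e.
  exists (e / (2 * pi)); first by rewrite divr_gt0 ?twopi_gt0.
  by rewrite divfK// gt_eqF// twopi_gt0.
(* For every d > 0 one has x <= d (1 + (x/d)^p); as the p-th mean vanishes, the integral of |f| is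
   at most 2 pi d. *)
apply: (@le_trans _ _ (\int[mu]_(t in circ)
    (d + d / d `^ p * cabs (f (r%:C * expi t)) `^ p))).
  apply: rint_le => //; first by apply: rbmD; [exact: rbm_cst|apply: rbmM => //; exact: rbm_cst].
  move=> t _; move: (cabs _) (cabs_ge0 (f (r%:C * expi t))) => x x0.
  have /(ler_wpM2l (ltW d0)) := le_1DpowR (divr_ge0 x0 (ltW d0)) p1.
  rewrite mulrC divfK ?gt_eqF// => /le_trans; apply.
  rewrite mulrDr mulr1 lerD2l powRM ?invr_ge0 ?(ltW d0)//.
  have -> : d^-1 `^ p = (d `^ p)^-1 by rewrite -(powR_inv1 (ltW d0)) -powRrM mulN1r powRN.
  by rewrite [x `^ p * _]mulrC mulrA.
rewrite rintD//; [|exact: rbm_cst|by apply: rbmM => //; exact: rbm_cst].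
rewrite rintZ// rint_cst// -/(pmean p f r) h mulr0 addr0 fine_mu_circ.
by rewrite dE.
Qed.

Lemma Hnorm_eq0 (p : R) (f : C -> C) : 1 <= p -> inHp p f -> Hnorm p f = 0 ->
  forall z, disc z -> f z = 0.
Proof.
move=> p1 hf h z; rewrite discE => dz.
have hr : 0 <= cabs z < 1 by rewrite cabs_ge0.
have [t ct ->] := polar z; have [af _] := hf; apply: (pmean_eq0 p1 af hr) => //.
apply/eqP; rewrite eq_le pmean_ge0 andbT (le_trans (pmean_le_Hnorm p1 hf hr))//.
by rewrite h powR0 ?mulr0// gt_eqF// (lt_le_trans ltr01).
Qed.

End HardyNorm.

(** * Square-summable sequences *)

Section SquareSummable.
Variable R : realType.
Local Notation C := R[i].

Lemma l2_partial (a : nat -> C) N : in_l2 a ->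
  \sum_(k < N) cabs (a k) ^+ 2 <= l2norm a ^+ 2.
Proof.
move=> ha; have pos n : (0 <= (cabs (a n) ^+ 2)%:E)%E by rewrite lee_fin sqr_ge0.
have s0 : (0 <= \sum_(0 <= n <oo) (cabs (a n) ^+ 2)%:E)%E by exact: nneseries_ge0.
rewrite /l2norm sqr_sqrtr ?fine_ge0// -lee_fin fineK ?ge0_fin_numE//.
rewrite -sumEFin -(big_mkord xpredT (fun n => (cabs (a n) ^+ 2)%:E)).
exact: nneseries_lim_ge.
Qed.

Lemma l2_bound (a : nat -> C) (s : R) : 0 <= s ->
  (forall N, \sum_(k < N) cabs (a k) ^+ 2 <= s ^+ 2) -> in_l2 a /\ l2norm a <= s.
Proof.
move=> s0 h; have pos n : (0 <= (cabs (a n) ^+ 2)%:E)%E by rewrite lee_fin sqr_ge0.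
have le : (\sum_(0 <= n <oo) (cabs (a n) ^+ 2)%:E <= (s ^+ 2)%:E)%E.
  apply: lime_le; first exact: is_cvg_nneseries.
  by apply: nearW => n; rewrite big_mkord sumEFin lee_fin.
have fin : in_l2 a by rewrite /in_l2 (le_lt_trans le)// ltry.
split=> //; rewrite /l2norm -[X in _ <= X](ger0_norm s0) -sqrtr_sqr ler_sqrt ?sqr_ge0//.
rewrite -lee_fin fineK// ge0_fin_numE//; exact: nneseries_ge0.
Qed.

Lemma l2norm_ge0 (a : nat -> C) : 0 <= l2norm a. Proof. exact: sqrtr_ge0. Qed.

Lemma l2_coef (a : nat -> C) k : in_l2 a -> cabs (a k) <= l2norm a.
Proof.
move=> ha; rewrite -(@ler_pXn2r _ 2) ?nnegrE ?cabs_ge0 ?l2norm_ge0//.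
apply: le_trans (l2_partial k.+1 ha); rewrite big_ord_recr /= lerDr.
by apply: sumr_ge0 => i _; exact: sqr_ge0.
Qed.

Lemma in_l2Z (x : C) (a : nat -> C) : in_l2 a -> in_l2 (fun n => x * a n).
Proof.
move=> ha; have c0 : 0 <= cabs x * l2norm a by rewrite mulr_ge0 ?cabs_ge0 ?l2norm_ge0.
suff h N : \sum_(k < N) cabs (x * a k) ^+ 2 <= (cabs x * l2norm a) ^+ 2.
  by have [] := @l2_bound (fun n => x * a n) _ c0 h.
under eq_bigr do rewrite cabsM exprMn.
by rewrite -mulr_sumr exprMn ler_wpM2l ?sqr_ge0// l2_partial.
Qed.

Lemma in_l2D (a b : nat -> C) : in_l2 a -> in_l2 b -> in_l2 (fun n => a n + b n).
Proof.
move=> ha hb; have c0 : 0 <= 2 * (l2norm a + l2norm b).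
  by rewrite mulr_ge0 ?addr_ge0 ?l2norm_ge0.
suff h N : \sum_(k < N) cabs (a k + b k) ^+ 2 <= (2 * (l2norm a + l2norm b)) ^+ 2.
  by have [] := @l2_bound (fun n => a n + b n) _ c0 h.
apply: (@le_trans _ _ (\sum_(k < N) (2 * cabs (a k) ^+ 2 + 2 * cabs (b k) ^+ 2))).
  apply: ler_sum => k _; have := cabsD (a k) (b k).
  move: (cabs (_ + _)) (cabs (a k)) (cabs (b k)) (cabs_ge0 (a k + b k)) => x y z x0 xyz.
  rewrite (le_trans (lerXn2r _ _ _ xyz)) ?nnegrE//; first by rewrite (le_trans x0).
  by have := sqr_ge0 (y - z); rewrite !expr2; lra.
rewrite big_split/= -!mulr_sumr.
have := l2_partial N ha; have := l2_partial N hb.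
move: (\sum_(k < N) _) (\sum_(k < N) _) (l2norm_ge0 a) (l2norm_ge0 b) => x y.
move: (l2norm a) (l2norm b) => s t s0 t0 h1 h2.
have := mulr_ge0 s0 t0; rewrite !expr2 in h1 h2 *; nra.
Qed.

(** If all partial sums of squares stayed at or below the squared norm minus e^2, [l2_bound] would
    give a norm that is too small. Beyond an N that exceeds this level the tail has square sum at
    most e^2. *)
Lemma l2_tail (a : nat -> C) (e : R) : in_l2 a -> 0 < e -> exists N,
  [/\ l2norm a <= Num.sqrt (\sum_(k < N) cabs (a k) ^+ 2) + e,
      in_l2 (fun k => if (k < N)%N then 0 else a k) &
      l2norm (fun k => if (k < N)%N then 0 else a k) <= e].
Proof.
move=> ha e0; have s0 := l2norm_ge0 a.
pose P N := \sum_(k < N) cabs (a k) ^+ 2.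
have P0 N : 0 <= P N by apply: sumr_ge0 => k _; exact: sqr_ge0.
have [N hN] : exists N, l2norm a ^+ 2 - e ^+ 2 < P N.
  apply/not_existsP => h; have {}h N : P N <= l2norm a ^+ 2 - e ^+ 2.
    by rewrite leNgt; apply/negP; exact: h.
  have d0 : 0 <= l2norm a ^+ 2 - e ^+ 2 by rewrite (le_trans (P0 0%N)).
  have h' N : P N <= Num.sqrt (l2norm a ^+ 2 - e ^+ 2) ^+ 2 by rewrite sqr_sqrtr.
  have [_] := l2_bound (sqrtr_ge0 _) h'.
  rewrite leNgt => /negP; apply.
  rewrite -[X in _ < X](ger0_norm s0) -sqrtr_sqr ltr_sqrt.
    by rewrite ltrBlDr ltrDl exprn_gt0.
  have : 0 < e ^+ 2 by rewrite exprn_gt0.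
  by move: d0; rewrite subr_ge0 => /[swap] /lt_le_trans; apply.
have tl n : \sum_(k < n) cabs (if (k < N)%N then 0 else a k) ^+ 2 <= e ^+ 2.
  apply: (@le_trans _ _ (P (N + n)%N - P N)).
    rewrite /P big_split_ord/= addrAC subrr add0r.
    have [nN|Nn] := leqP n N.
      rewrite big1 ?sumr_ge0//; first by move=> i _; exact: sqr_ge0.
      by move=> i _; rewrite (leq_trans (ltn_ord i))// cabs0 expr0n.
    rewrite -(subnKC (ltnW Nn)) big_split_ord/= big1 ?add0r; last first.
      by move=> i _; rewrite ltn_ord cabs0 expr0n.
    rewrite addnC big_split_ord/=; under eq_bigr do rewrite ltnNge leq_addr/=.
    by rewrite lerDl sumr_ge0// => i _; exact: sqr_ge0.
  by rewrite lerBlDr (le_trans (l2_partial _ ha))// -lerBlDl ltW.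
have [t1 t2] := @l2_bound (fun k => if (k < N)%N then 0 else a k) e (ltW e0) tl.
exists N; split=> //; rewrite -/(P N).
rewrite -(@ler_pXn2r _ 2) ?nnegrE ?addr_ge0 ?sqrtr_ge0 ?(ltW e0)// sqrrD.
have := sqr_sqrtr (P0 N); move: (Num.sqrt (P N)) (sqrtr_ge0 (P N)) => x x0 xE.
have := mulr_ge0 x0 (ltW e0); rewrite mulr2n; lra.
Qed.

End SquareSummable.

(** * Lacunary series in Hardy spaces *)

Section LacunaryHardy.
Variable R : realType.
Local Notation C := R[i].
Local Notation mu := (@lebesgue_measure R).

Let mc := @measurable_circ R.
Let fc := @mu_circ_fin R.

Lemma subord_cst_ge0 (phi : C -> C) : (forall z, disc z -> disc (phi z)) ->
  0 <= subord_cst phi.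
Proof.
move=> dphi; have h : cabs (phi 0) < 1 by exact: dphi (@disc0 R).
apply: addr_ge0 => //; apply: divr_ge0; first by rewrite mulr_ge0// sqr_ge0.
by rewrite subr_ge0 exprn_ile1 ?cabs_ge0// ltW.
Qed.

(** The 2m-th power of |F| is the squared modulus of F^m, again a polynomial in phi, so
    subordination and [coefsq_dissociate] apply to it. *)
Lemma lacunary_moment (phi : C -> C) (M N m : nat) (nk : nat -> nat) (a : nat -> C) (r : R) :
  analytic_on_disc phi -> (forall z, disc z -> disc (phi z)) ->
  (0 < nk 0)%N -> (forall k, (M * nk k < nk k.+1)%N) -> (m <= M)%N -> 0 <= r < 1 ->
  \int[mu]_(t in circ)
    (cabs (\sum_(k < N) a k * phi (r%:C * expi t) ^+ nk k) ^+ (2 * m)) <=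
  2 * pi * (subord_cst phi * (m`!%:R * (\sum_(k < N) cabs (a k) ^+ 2) ^+ m)).
Proof.
move=> aphi dphi nk0 nkM mM hr.
apply: (@le_trans _ _ (\int[mu]_(t in circ)
    (cabs ((\sum_(k < N) a k *: 'X^(nk k)) ^+ m).[phi (r%:C * expi t)] ^+ 2))).
  rewrite le_eqVlt; apply/orP; left; apply/eqP; apply: eq_Rintegral => t _.
  by rewrite horner_exp horner_lacunary cabsX -exprM mulnC.
apply: (le_trans (subordination aphi dphi _ hr)); rewrite ler_pM2l ?twopi_gt0//.
rewrite ler_wpM2l//; first exact: subord_cst_ge0 dphi.
exact: coefsq_dissociate.
Qed.

Variables (M : nat) (nk : nat -> nat).
Hypothesis M0 : (0 < M)%N.
Hypothesis nk0 : (0 < nk 0)%N.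
Hypothesis nkM : forall k, (M * nk k < nk k.+1)%N.

Lemma lacunary_gt k : (k < nk k)%N.
Proof.
elim: k => // k ih; rewrite (leq_ltn_trans ih)// (leq_ltn_trans _ (nkM k))//.
exact: leq_pmull.
Qed.

(** [fixes_copy_of_l2] asks for linearity as an identity of functions on the whole plane; the value
    0 outside the disc makes it hold there too. *)
Definition lacsum (a : nat -> C) (z : C) : C :=
  if `[< disc z >] then csum (fun k => a k * z ^+ nk k) else 0.

Lemma lacsumE (a : nat -> C) z : disc z -> lacsum a z = csum (fun k => a k * z ^+ nk k).
Proof. by move=> /asboolP dz; rewrite /lacsum dz. Qed.

Lemma lacsum_partial (a : nat -> C) z n : in_l2 a -> disc z ->
  cabs (lacsum a z - \sum_(k < n) a k * z ^+ nk k) <=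
    l2norm a * cabs z ^+ n / (1 - cabs z).
Proof.
move=> ha dz; rewrite lacsumE//.
by have [_] := lacunary_cvg lacunary_gt (l2norm_ge0 a) (fun k => l2_coef k ha) dz.
Qed.

Lemma lacsum_lin (a b : nat -> C) (x z : C) : in_l2 a -> in_l2 b ->
  lacsum (fun k => a k + x * b k) z = lacsum a z + x * lacsum b z.
Proof.
move=> ha hb; rewrite /lacsum; case: asboolP => [dz|_]; last by rewrite mulr0 addr0.
have [ca _] := lacunary_cvg lacunary_gt (l2norm_ge0 a) (fun k => l2_coef k ha) dz.
have [cb _] := lacunary_cvg lacunary_gt (l2norm_ge0 b) (fun k => l2_coef k hb) dz.
rewrite -(@csum_lin _ (fun k => a k * z ^+ nk k) (fun k => b k * z ^+ nk k) _ _ _ ca cb).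
by congr csum; apply/funext => k; rewrite mulrDl mulrA.
Qed.

Lemma lacsum0 (z : C) : lacsum (fun=> 0) z = 0.
Proof.
rewrite /lacsum; case: asboolP => // dz.
by rewrite (@csum_finite _ _ 0) ?big_ord0// => k _; rewrite mul0r.
Qed.

Lemma lacsum_finite (a : nat -> C) N z : (forall k, (N <= k)%N -> a k = 0) ->
  disc z -> lacsum a z = \sum_(k < N) a k * z ^+ nk k.
Proof.
by move=> h dz; rewrite lacsumE// (@csum_finite _ _ N)// => k /h ->; rewrite mul0r.
Qed.

Lemma analytic_lacsum (a : nat -> C) : in_l2 a -> analytic_on_disc (lacsum a).
Proof.
move=> ha z dz; apply/derivableCP.
have /derivableCP[l hl] :=
  lacunary_derivable lacunary_gt (l2norm_ge0 a) (fun k => l2_coef k ha) dz.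
exists l => e e0; have [d d0 hd] := hl e e0.
exists (Num.min d (1 - cabs z)); first by rewrite lt_min d0 subr_gt0.
move=> h; rewrite lt_min => /andP[h1 h2]; have := hd h h1.
rewrite !lacsumE// discE (le_lt_trans (cabsD _ _))//.
by rewrite addrC -ltrBrDr.
Qed.

(* For phi = id the subordination constant is 2. *)
Lemma lacsum_moment (a : nat -> C) (s r : R) : in_l2 a ->
  (forall N, \sum_(k < N) cabs (a k) ^+ 2 <= s ^+ 2) -> 0 <= r < 1 ->
  \int[mu]_(t in circ) (cabs (lacsum a (r%:C * expi t)) ^+ (2 * M)) <=
    2 * pi * (2 * (M`!%:R * s ^+ (2 * M))).
Proof.
move=> ha hs hr.
have aid := @analytic_id R.
have aJ := analytic_lacsum ha.
have cJ := cbm_analytic aJ hr.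
pose S n t := \sum_(k < n) a k * (r%:C * expi t) ^+ nk k.
have cS n : cbm circ (S n).
  apply: cbm_sum => k _; apply: cbmM; first exact: cbm_cst.
  by apply: cbmX; exact: cbm_analytic aid hr.
pose B := l2norm a / (1 - r).
have r1 : 0 < 1 - r by rewrite subr_gt0; case/andP: hr.
have B0 : 0 <= B by rewrite divr_ge0 ?l2norm_ge0 ?ltW.
have part n t : cabs (lacsum a (r%:C * expi t) - S n t) <= B * r ^+ n.
  have := lacsum_partial n ha (disc_circle t hr).
  by rewrite cabs_circle; [rewrite mulrAC|case/andP: hr].
have JB t : cabs (lacsum a (r%:C * expi t)) <= B.
  by have := part 0%N t; rewrite /S big_ord0 subr0 expr0 mulr1.
have SB n t : cabs (S n t) <= 2 * B.
  have := part n t; rewrite cabsC => h.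
  rewrite -(subrK (lacsum a (r%:C * expi t)) (S n t)) (le_trans (cabsD _ _))//.
  rewrite mulr_natl mulr2n lerD// (le_trans h)// ler_piMr//.
  by case/andP: hr => r0 r1'; rewrite exprn_ile1// ltW.
pose f n t := cabs (lacsum a (r%:C * expi t)) ^+ (2 * M) - cabs (S n t) ^+ (2 * M).
(* On |z| = r the partial sums converge and stay below [2 * B], so the moment bound for polynomials
   passes to the limit. *)
have f0 : (fun n => \int[mu]_(t in circ) f n t) @ \oo --> (0 : R).
  apply: (@rint_dct0 _ _ (B ^+ (2 * M) + (2 * B) ^+ (2 * M))) => [n|n t _|t _].
  - by apply: rbmB; apply: rbmX; exact: rbm_cabs.
  - rewrite (le_trans (ler_normB _ _))// !ger0_norm ?exprn_ge0 ?cabs_ge0//.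
    by rewrite lerD// pow_le// cabs_ge0.
  rewrite -(subrr (cabs (lacsum a (r%:C * expi t)) ^+ (2 * M))).
  apply: cvgB; first exact: cvg_cst.
  apply: (cvg_comp (fun n => cabs (S n t)) (fun x => x ^+ (2 * M))); last exact: exprn_continuous.
  apply: cvg_cabs; apply/cvgCP => e e0.
  have : (fun n => B * r ^+ n) @ \oo --> (0 : R).
    rewrite -(mulr0 B); apply: cvgM; first exact: cvg_cst.
    by apply: cvg_expr; case/andP: hr => r0 r1'; rewrite ger0_norm.
  move=> /cvgrPdist_lt/(_ e e0); apply: filterS => n; rewrite sub0r normrN => h.
  by rewrite cabsC (le_lt_trans (part n t))// (le_lt_trans (ler_norm _)).
apply/ler_addgt0Pl => e e0.
have /cvgrPdist_lt/(_ e e0)[n _ /(_ n (leqnn n))] := f0.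
rewrite /= sub0r normrN => /(le_lt_trans (ler_norm _))/ltW.
rewrite rintB//; [|by apply: rbmX; exact: rbm_cabs|by apply: rbmX; exact: rbm_cabs].
rewrite lerBlDr => /le_trans; apply; rewrite lerD2l.
apply: (le_trans (@lacunary_moment id M n M nk a r aid (fun _ => id) nk0 nkM (leqnn M) hr)).
rewrite ler_pM2l ?twopi_gt0// /subord_cst cabs0 expr0n mulr0 mul0r addr0.
rewrite ler_pM2l// ler_wpM2l// exprM pow_le// sumr_ge0// => k _; exact: sqr_ge0.
Qed.

(** Since p <= 2M, one has x^p <= s^p (1 + (x/s)^(2M)). Scaling by s first makes the resulting bound
    homogeneous in s. *)
Lemma lacsum_pmean (p : R) (a : nat -> C) (s r : R) : 0 <= p -> p <= (2 * M)%:R ->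
  in_l2 a -> 0 < s -> (forall N, \sum_(k < N) cabs (a k) ^+ 2 <= s ^+ 2) -> 0 <= r < 1 ->
  pmean p (lacsum a) r <= 2 * pi * ((1 + 2 * M`!%:R) * s `^ p).
Proof.
move=> p0 pM ha s0 hs hr; have aJ := analytic_lacsum ha.
have rJ : rbm circ (fun t => cabs (lacsum a (r%:C * expi t)) ^+ (2 * M)).
  by apply: rbmX; apply: rbm_cabs; exact: cbm_analytic.
have rc (c : R) : rbm circ (fun t => c * cabs (lacsum a (r%:C * expi t)) ^+ (2 * M)).
  by apply: rbmM => //; exact: rbm_cst.
have k0 : 0 < s ^+ (2 * M) by rewrite exprn_gt0.
pose k := s `^ p / s ^+ (2 * M).
apply: (@le_trans _ _ (\int[mu]_(t in circ)
    (s `^ p + k * cabs (lacsum a (r%:C * expi t)) ^+ (2 * M)))).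
  apply: rint_le => //; [exact: rbm_pmean|by apply: rbmD => //; exact: rbm_cst|].
  move=> t _; move: (cabs _) (cabs_ge0 (lacsum a (r%:C * expi t))) => x x0.
  rewrite -{1}(divfK (lt0r_neq0 s0) x) powRM ?divr_ge0 ?(ltW s0)//.
  rewrite /k [X in _ <= _ + X]mulrAC -mulrA -expr_div_n -{2}[s `^ p]mulr1 -mulrDr mulrC.
  by rewrite ler_wpM2l ?powR_ge0// powR_le1DX// divr_ge0// ltW.
rewrite rintD//; last exact: rbm_cst.
rewrite rintZ// rint_cst// fine_mu_circ.
have := lacsum_moment ha hs hr.
move: (\int[mu]_(t in circ) _) (2 * pi) => I P.
have kk : 0 <= k by rewrite divr_ge0 ?powR_ge0 ?ltW.
move=> /(ler_wpM2l kk); rewrite /k; move: (s `^ p) (M`!%:R) => q F h.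
rewrite mulrDl mul1r mulrDr [P * q]mulrC lerD2l (le_trans h)//.
rewrite le_eqVlt; apply/orP; left; apply/eqP; field.
by rewrite gt_eqF.
Qed.

Lemma lacsum_Hnorm (p : R) (a : nat -> C) : 1 <= p -> p <= (2 * M)%:R -> in_l2 a ->
  inHp p (lacsum a) /\ Hnorm p (lacsum a) <= (1 + 2 * M`!%:R) * l2norm a.
Proof.
move=> p1 pM ha; have p0 : 0 <= p by rewrite (le_trans ler01).
have c1 : 1 <= 1 + 2 * M`!%:R :> R by rewrite lerDl.
have c0 : 0 < 1 + 2 * M`!%:R :> R by rewrite (lt_le_trans ltr01).
(* The scaling divides by s, while the norm of a may be 0; hence the detour over every positive s
   above the norm. *)
have h s : 0 < s -> l2norm a <= s ->
    inHp p (lacsum a) /\ Hnorm p (lacsum a) <= (1 + 2 * M`!%:R) * s.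
  move=> s0 as_; apply: (Hnorm_le p1 (analytic_lacsum ha)).
    by rewrite mulr_ge0 ?(ltW c0)// ltW.
  move=> r hr; have hs N : \sum_(k < N) cabs (a k) ^+ 2 <= s ^+ 2.
    by rewrite (le_trans (l2_partial N ha))// pow_le// l2norm_ge0.
  rewrite (le_trans (lacsum_pmean p0 pM ha s0 hs hr))// ler_pM2l ?twopi_gt0//.
  rewrite powRM ?(ltW c0) ?(ltW s0)// ler_wpM2r ?powR_ge0//.
  exact: le1r_powR.
have l0 := l2norm_ge0 a; split.
  have l1 : l2norm a <= l2norm a + 1 by rewrite lerDl.
  by have [] := h (l2norm a + 1) (ltr_wpDl l0 ltr01) l1.
apply/ler_addgt0Pl => e e0; pose d := e / (1 + 2 * M`!%:R).
have d0 : 0 < d by rewrite divr_gt0.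
have l1 : l2norm a <= d + l2norm a by rewrite lerDr ltW.
have [_] := h (d + l2norm a) (ltr_pwDl d0 l0) l1.
rewrite mulrDr; set c := 1 + _; rewrite /d -/c mulrCA mulfV ?gt_eqF// mulr1.
exact.
Qed.

End LacunaryHardy.

(** * Completeness of l2 and closedness of the range *)

Section ClosedRange.
Variable R : realType.
Local Notation C := R[i].

Lemma in_l2B (a b : nat -> C) : in_l2 a -> in_l2 b -> in_l2 (fun n => a n - b n).
Proof.
move=> ha hb; rewrite (_ : (fun n => _) = fun n => a n + -1 * b n).
  by apply: in_l2D => //; exact: in_l2Z.
by apply/funext => n; rewrite mulN1r.
Qed.

Lemma ccvg_sum_sqr_le (a : nat -> nat -> C) (l c : nat -> C) (B : R) (K N : nat) :
  (forall k, ccvg (fun n => a n k) (l k)) ->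
  (forall n, (N <= n)%N -> \sum_(k < K) cabs (c k - a n k) ^+ 2 <= B) ->
  \sum_(k < K) cabs (c k - l k) ^+ 2 <= B.
Proof.
move=> al hB; have cv (k : 'I_K) :
    (fun n => cabs (c k - a n k) ^+ 2) @ \oo --> cabs (c k - l k) ^+ 2.
  apply: (cvg_comp (fun n => cabs (c k - a n k)) (fun x => x ^+ 2)); last exact: exprn_continuous.
  apply/cvgrPdist_lt => e e0; have [M hM] := al k e e0; exists M => // n /= /hM.
  apply: le_lt_trans; rewrite (le_trans (cabs_dist _ _))//.
  by rewrite opprB addrC subrKA.
have cs : (fun n => \sum_(k < K) cabs (c k - a n k) ^+ 2) @ \oo -->
    \sum_(k < K) cabs (c k - l k) ^+ 2.
  elim: K cv {hB} => [|K ih] cv; first by under eq_fun do rewrite big_ord0; rewrite big_ord0; exact: cvg_cst.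
  under eq_fun do rewrite big_ord_recr; rewrite big_ord_recr/=.
  apply: cvgD (cv ord_max); apply: ih => k; exact: cv (widen_ord (leqnSn K) k).
have := cvgr_to_le cs; apply.
by exists N => // n /= /hB.
Qed.

Lemma l2_complete (a : nat -> nat -> C) : (forall n, in_l2 (a n)) ->
  (forall e : R, 0 < e -> exists N, forall n m, (N <= n)%N -> (N <= m)%N ->
    l2norm (fun k => a n k - a m k) <= e) ->
  exists2 l : nat -> C, in_l2 l & forall e : R, 0 < e -> exists N, forall n,
    (N <= n)%N -> l2norm (fun k => a n k - l k) <= e.
Proof.
move=> ha hc.
have /choice[l hl] : forall k, exists x, ccvg (fun n => a n k) x.
  move=> k; apply: cauchy_complex => e e0.
  have e20 : 0 < e / 2 by rewrite divr_gt0.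
  have [N hN] := hc _ e20; exists N => n Nn.
  apply: (@le_lt_trans _ _ (e / 2)); last by rewrite ltr_pdivrMr// ltr_pMr// ltr1n.
  apply: le_trans (hN N n (leqnn N) Nn).
  exact: (@l2_coef _ (fun k => a N k - a n k) k (in_l2B (ha N) (ha n))).
have lim e : 0 < e -> exists N, forall n, (N <= n)%N ->
    in_l2 (fun k => a n k - l k) /\ l2norm (fun k => a n k - l k) <= e.
  move=> e0; have [N hN] := hc e e0; exists N => n Nn.
  apply: (@l2_bound _ (fun k => a n k - l k) e (ltW e0)) => K.
  apply: (@ccvg_sum_sqr_le a l (a n) (e ^+ 2) K N hl) => m Nm.
  have := @l2_partial _ (fun k => a n k - a m k) K (in_l2B (ha n) (ha m)).
  move=> /le_trans; apply; apply: lerXn2r; rewrite ?nnegrE ?l2norm_ge0 ?(ltW e0)//.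
  exact: hN.
exists l; last first.
  by move=> e e0; have [N hN] := lim e e0; exists N => n /hN[].
have [N /(_ N (leqnn N))[h _]] := lim 1 ltr01.
rewrite (_ : l = fun k => a N k - (a N k - l k)); first exact: in_l2B.
by apply/funext => k; rewrite opprB addrC subrK.
Qed.

Variables (p : R) (J : (nat -> C) -> C -> C) (c1 c2 : R).
Hypothesis p1 : 1 <= p.
Hypothesis c1_gt0 : 0 < c1.
Hypothesis c2_gt0 : 0 < c2.
Hypothesis hJ : forall a, in_l2 a -> inHp p (J a).
Hypothesis JB : forall a b, in_l2 a -> in_l2 b ->
  J (fun n => a n - b n) = fun z => J a z - J b z.
Hypothesis J_lower : forall a, in_l2 a -> c1 * l2norm a <= Hnorm p (J a).
Hypothesis J_upper : forall a, in_l2 a -> Hnorm p (J a) <= c2 * l2norm a.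

Lemma closed_l2_range (fs : nat -> C -> C) (f : C -> C) :
  (forall n, (J @` (@in_l2 R)) (fs n)) -> inHp p f ->
  (fun n => Hnorm p (fun z => fs n z - f z)) @ \oo --> (0 : R) ->
  exists2 g, (J @` (@in_l2 R)) g & forall z, disc z -> g z = f z.
Proof.
move=> hfs hf lim.
have /choice[a ha] : forall n, exists a, in_l2 a /\ J a = fs n.
  by move=> n; have [a ? ?] := hfs n; exists a.
have inB n : inHp p (fun z => fs n z - f z).
  by have [h <-] := ha n; have [] := HnormB p1 (hJ h) hf.
have small e : 0 < e -> exists N, forall n, (N <= n)%N ->
    Hnorm p (fun z => fs n z - f z) <= e.
  move=> e0; have /cvgrPdist_le/(_ e e0)[N _ hN] := lim; exists N => n /hN.
  by rewrite /= sub0r normrN; apply: le_trans; exact: ler_norm.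
have [l hl al] : exists2 l : nat -> C, in_l2 l & forall e : R, 0 < e -> exists N, forall n,
    (N <= n)%N -> l2norm (fun k => a n k - l k) <= e.
  apply: l2_complete => [n|e e0]; first by have [] := ha n.
  (* The 8 is twice the constant 4 of [HnormB]: both terms are within [c1 * e / 8] of f, and the
     lower bound for J turns this into a distance e of the sequences. *)
  have d0 : 0 < c1 * e / 8 by rewrite divr_gt0// mulr_gt0.
  have [N hN] := small _ d0; exists N => n m /hN Hn /hN Hm.
  have [hn Jn] := ha n; have [hm Jm] := ha m.
  rewrite -(ler_pM2l c1_gt0); have hB := in_l2B hn hm.
  apply: (le_trans (J_lower hB)); rewrite JB// Jn Jm.
  have [_] := HnormB p1 (inB n) (inB m).
  rewrite (_ : (fun z => _ - (fs m z - f z)) = fun z => fs n z - fs m z); last first.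
    by apply/funext => z; rewrite opprB subrKA.
  move=> /le_trans; apply.
  move: (Hnorm _ _) (Hnorm _ _) (c1 * e) Hn Hm => x y w; lra.
exists (J l); first by exists l.
have inJ : inHp p (fun z => J l z - f z) by have [] := HnormB p1 (hJ hl) hf.
have /(Hnorm_eq0 p1 inJ) h0 : Hnorm p (fun z => J l z - f z) = 0; last first.
  by move=> z /h0/eqP; rewrite subr_eq0 => /eqP.
apply/eqP; rewrite eq_le Hnorm_ge0 andbT; apply/ler_addgt0Pl => e e0; rewrite addr0.
have e1 : 0 < e / 8 by rewrite divr_gt0.
have e2 : 0 < e / 8 / c2 by rewrite divr_gt0.
have [N1 hN1] := small _ e1; have [N2 hN2] := al _ e2.
pose n := maxn N1 N2.
have {}hN1 := hN1 n (leq_maxl _ _); have {}hN2 := hN2 n (leq_maxr _ _).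
have [hn Jn] := ha n; have hB := in_l2B hn hl.
have := J_upper hB; have := hJ hB; rewrite JB// Jn => inH hu.
have {}hu : Hnorm p (fun z => fs n z - J l z) <= e / 8.
  apply: (le_trans hu); apply: (le_trans (ler_wpM2l (ltW c2_gt0) hN2)).
  by rewrite mulrC divfK// gt_eqF.
have [_] := HnormB p1 (inB n) inH.
rewrite (_ : (fun z => _ - (fs n z - J l z)) = fun z => J l z - f z); last first.
  by apply/funext => z; rewrite opprB addrC subrKA.
move=> /le_trans; apply.
move: (Hnorm _ _) (Hnorm _ _) hN1 hu => x y; lra.
Qed.

End ClosedRange.

(** * The lower bound for the weighted composition operator *)

Section LowerBound.
Variable R : realType.
Local Notation C := R[i].
Local Notation mu := (@lebesgue_measure R).

Let mc := @measurable_circ R.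
Let fc := @mu_circ_fin R.

(* Where x > tau one has x^2 <= kappa x^4 + 1/kappa, and 1/kappa is paid for by 1_L
   or by w. *)
Lemma sqr_mean_split (E L : set R) (x w : R -> R) (tau kappa : R) :
  measurable E -> measurable L -> rbm circ x -> rbm circ w ->
  0 < tau -> 0 < kappa -> (forall t, circ t -> 0 <= x t) ->
  (forall t, circ t -> 0 <= w t) ->
  (forall t, circ t -> [\/ x t <= tau, L t | 1 <= w t]) ->
  \int[mu]_(t in circ) (\1_E t * x t ^+ 2) <= 2 * pi * tau ^+ 2 +
    (kappa * \int[mu]_(t in circ) (x t ^+ 4) +
     (kappa^-1 * \int[mu]_(t in circ) \1_L t + kappa^-1 * \int[mu]_(t in circ) w t)).
Proof.
move=> mE mL rx rw t0 k0 x0 w0 h; have rL := rbm_indic mc mL; have rE := rbm_indic mc mE.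
have rc (c : R) (f : R -> R) : rbm circ f -> rbm circ (fun t => c * f t).
  by apply: rbmM; exact: rbm_cst.
have rx4 := rbmX 4 rx; have r1 := rc kappa _ rx4; have r2 := rc kappa^-1 _ rL.
have r3 := rc kappa^-1 _ rw; have r4 := rbm_cst circ (tau ^+ 2).
rewrite [2 * pi * _]mulrC -(@fine_mu_circ R) -rint_cst// -!rintZ// -!rintD//; last 2 first.
- exact: (rbmD r1 (rbmD r2 r3)).
- exact: (rbmD r2 r3).
apply: rint_le => //; first by apply: rbmM => //; exact: rbmX.
  by apply: rbmD => //; apply: rbmD => //; exact: rbmD.
move=> t ct; have := x0 t ct; have := w0 t ct; have := h t ct.
have e0 : 0 <= \1_E t :> R by rewrite indicE.
have e1 : \1_E t <= 1 :> R by rewrite indicE; case: (t \in E) => /=; rewrite ?ler01.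
have l0 : 0 <= \1_L t :> R by rewrite indicE.
have l1 : L t -> \1_L t = 1 :> R by move=> Lt; rewrite indicE mem_set.
move: (x t) (w t) (\1_E t) (\1_L t) e0 e1 l0 l1 => y v i j i0 i1 j0 j1 H v0 y0.
apply: (@le_trans _ _ (y ^+ 2)); first by rewrite ler_piMl// sqr_ge0.
have kv : 0 < kappa^-1 by rewrite invr_gt0.
have y4 : 0 <= kappa * y ^+ 4 by exact: mulr_ge0 (ltW k0) (exprn_ge0 4 y0).
have jk : 0 <= kappa^-1 * j by rewrite mulr_ge0// ltW.
have vk : 0 <= kappa^-1 * v by rewrite mulr_ge0// ltW.
have tt : 0 <= tau ^+ 2 by exact: sqr_ge0.
have amgm : y ^+ 2 <= kappa * y ^+ 4 + kappa^-1.
  have kk : kappa * kappa^-1 = 1 by rewrite mulfV ?gt_eqF.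
  have h1 := sqr_ge0 (kappa * y ^+ 2 - 1); move: kk; move: kappa^-1 kv => z z0 kz.
  rewrite -(ler_pM2l k0) mulrDr kz (_ : kappa * (kappa * y ^+ 4) = (kappa * y ^+ 2) ^+ 2).
    have : 0 <= kappa * y ^+ 2 by rewrite mulr_ge0 ?sqr_ge0// ltW.
    move: (kappa * y ^+ 2) h1 => q h1 q0; rewrite !expr2 in h1 *; nra.
  by rewrite exprMn -exprM expr2 mulrA.
case: H => [yt|/j1 jE|v1].
- apply: (@le_trans _ _ (tau ^+ 2)); last by rewrite lerDl !addr_ge0.
  by apply: pow_le.
- by rewrite jE mulr1 in jk *; lra.
have : kappa^-1 <= kappa^-1 * v by rewrite ler_peMr// ltW.
lra.
Qed.

Variables (q : R) (u phi : C -> C) (S : R) (M : nat).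
Hypothesis q1 : 1 <= q.
Hypothesis au : analytic_on_disc u.
Hypothesis aphi : analytic_on_disc phi.
Hypothesis dphi : forall z, disc z -> disc (phi z).
Hypothesis u_neq0 : exists z, disc z /\ u z != 0.
Hypothesis uS : forall r, 0 <= r < 1 -> \int[mu]_(t in circ) cabs (u (r%:C * expi t)) <= S.
Hypothesis M2 : (1 < M)%N.
Let muE := \int[mu]_(t in circ) \1_(contact phi) t.
Hypothesis muE_gt0 : 0 < muE.

(* Paley-Zygmund: the mean square on the contact set is bounded below and the fourth
   moment above, so |F| cannot be small on most of it, and |u| is small only on a
   set of small measure. *)
Lemma weighted_lower : exists (nk : nat -> nat) (d : R),
  [/\ (0 < nk 0)%N, forall k, (M * nk k < nk k.+1)%N, 0 < d &
   forall N (a : nat -> C), exists2 r : R, 0 <= r < 1 &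
     2 * pi * (d * Num.sqrt (\sum_(k < N) cabs (a k) ^+ 2)) `^ q <=
     \int[mu]_(t in circ) (cabs (u (r%:C * expi t)) *
        cabs (\sum_(k < N) a k * phi (r%:C * expi t) ^+ nk k)) `^ q].
Proof.
have q0 : 0 < q by rewrite (lt_le_trans ltr01).
have [nk [nk0 nkM hG]] := gram_lower aphi dphi (ltnW M2) muE_gt0.
have Cp := subord_cst_ge0 dphi; have tp := @twopi_gt0 R.
(* After normalization the mean square on the contact set is at least muE / 2. The constants keep
   three terms of [sqr_mean_split] at muE / 16 each: [tau] the first, [kappa] the fourth moment (at
   most [K4], whose inner 2 is 2!), and the measure [kappa * (muE / 16)] the set where |u| < c. At
   least muE / 4 is left for the last term. *)
pose K4 := 2 * pi * (subord_cst phi * 2) + 1.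
have K40 : 0 < K4 by rewrite ltr_wpDl// mulr_ge0 ?(ltW tp)// mulr_ge0.
pose kappa := muE / 16 / K4; have k0 : 0 < kappa by rewrite !divr_gt0.
pose tau := Num.sqrt (muE / 16 / (2 * pi)).
have t0 : 0 < tau by rewrite sqrtr_gt0 !divr_gt0.
have eta0 : 0 < kappa * (muE / 16) by rewrite mulr_gt0// divr_gt0.
have [c c0 hc] := small_set au u_neq0 uS eta0.
(* The argument ends with the integral being at least [kappa * muE / 4 * b]. This g solves 2 pi g =
   kappa muE / 4, and the exponent 1/q brings it inside the q-th power. *)
pose g := kappa * muE / 4 / (2 * pi); have g0 : 0 < g by rewrite !divr_gt0// mulr_gt0.
exists nk, (c * tau * g `^ q^-1); split=> //; first by rewrite !mulr_gt0 ?powR_gt0.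
move=> N a; have [r [hr hE]] := hG N a.
have hr' : 0 <= r < 1.
  by case/andP: hr => r0 ->; rewrite andbT (le_trans _ r0)// divr_ge0.
exists r => //.
pose A := \sum_(k < N) cabs (a k) ^+ 2.
have A0 : 0 <= A by apply: sumr_ge0 => k _; exact: sqr_ge0.
pose F t := \sum_(k < N) a k * phi (r%:C * expi t) ^+ nk k.
have cF : cbm circ F.
  apply: cbm_sum => k _; apply: cbmM; first exact: cbm_cst.
  by apply: cbmX; exact: cbm_analytic aphi hr'.
have rF := rbm_cabs cF; have ru := rbm_cabs (cbm_analytic au hr').
have [A_eq0|A_neq0] := eqVneq A 0.
  rewrite -/A A_eq0 sqrtr0 mulr0 powR0 ?gt_eqF// mulr0.
  by apply: Rintegral_ge0 => t _; exact: powR_ge0.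
have A_gt0 : 0 < A by rewrite lt_neqAle eq_sym A_neq0.
pose s := Num.sqrt A; have s0 : 0 < s by rewrite sqrtr_gt0.
have sA : s ^+ 2 = A by rewrite sqr_sqrtr.
rewrite -/A -/s -/(F _).
have rw : rbm circ (fun t => (cabs (u (r%:C * expi t)) * cabs (F t)) `^ q).
  apply: rbm_powR; [exact: ltW| |exact: rbmM].
  by move=> t _; rewrite mulr_ge0 ?cabs_ge0.
pose b := (c * tau * s) `^ q; have b0 : 0 < b by rewrite powR_gt0// !mulr_gt0.
pose L := [set t | cabs (u (r%:C * expi t)) < c].
have mL : measurable L.
  by apply: measurable_small; apply: continuous_cabs; exact: analytic_circle.
(* Dividing F by s frees all constants from a. Where F/s exceeds tau and |u| >= c, the product |u F|
   is at least c tau s, so the last function is at least 1. *)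
have := @sqr_mean_split (contact phi) L (fun t => s^-1 * cabs (F t))
  (fun t => b^-1 * (cabs (u (r%:C * expi t)) * cabs (F t)) `^ q) tau kappa
  (measurable_contact aphi) mL.
have rc (x : R) (f : R -> R) : rbm circ f -> rbm circ (fun t => x * f t).
  by apply: rbmM; exact: rbm_cst.
move=> /(_ (rc _ _ rF) (rc _ _ rw) t0 k0).
have H1 t : circ t -> 0 <= s^-1 * cabs (F t).
  by move=> _; rewrite mulr_ge0 ?cabs_ge0// invr_ge0 ltW.
have H2 t : circ t -> 0 <= b^-1 * (cabs (u (r%:C * expi t)) * cabs (F t)) `^ q.
  by move=> _; rewrite mulr_ge0 ?powR_ge0// invr_ge0 ltW.
move=> /(_ H1 H2).
have H3 t : circ t -> [\/ s^-1 * cabs (F t) <= tau, L t |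
    1 <= b^-1 * (cabs (u (r%:C * expi t)) * cabs (F t)) `^ q].
  move=> _; have [?|xt] := leP (s^-1 * cabs (F t)) tau; first exact: Or31.
  have [?|cu] := ltP (cabs (u (r%:C * expi t))) c; first exact: Or32.
  apply: Or33; rewrite mulrC ler_pdivlMr// mul1r; apply: powR_le; [exact: ltW| |].
    by rewrite !mulr_ge0 ?ltW.
  rewrite -mulrA ler_pM//; [exact: ltW|by rewrite mulr_ge0 ?ltW|].
  by move: xt; rewrite mulrC ltr_pdivlMr// => /ltW.
move=> /(_ H3).
have E1 : \int[mu]_(t in circ) (\1_(contact phi) t * (s^-1 * cabs (F t)) ^+ 2) =
    A^-1 * \int[mu]_(t in circ) (\1_(contact phi) t * cabs (F t) ^+ 2).
  rewrite -rintZ//; last first.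
    by apply: rbmM; [apply: rbm_indic => //; exact: measurable_contact|exact: rbmX].
  by apply: eq_Rintegral => t _; rewrite exprMn exprVn sA mulrCA.
have E2 : \int[mu]_(t in circ) ((s^-1 * cabs (F t)) ^+ 4) =
    (A ^+ 2)^-1 * \int[mu]_(t in circ) (cabs (F t) ^+ 4).
  rewrite -rintZ//; last exact: rbmX.
  by apply: eq_Rintegral => t _; rewrite exprMn exprVn -sA -exprM.
rewrite E1 E2 (rintZ mc fc _ rw).
have h1 : muE / 2 <= A^-1 * \int[mu]_(t in circ) (\1_(contact phi) t * cabs (F t) ^+ 2).
  by rewrite [X in _ <= X]mulrC ler_pdivlMr.
have h2 : (A ^+ 2)^-1 * \int[mu]_(t in circ) (cabs (F t) ^+ 4) <= K4.
  rewrite mulrC ler_pdivrMr ?exprn_gt0//.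
  apply: (le_trans (@lacunary_moment _ phi M N 2 nk a r aphi dphi nk0 nkM M2 hr')).
  rewrite -/A (_ : K4 * A ^+ 2 = 2 * pi * (subord_cst phi * (2 * A ^+ 2)) + A ^+ 2).
    by rewrite lerDl sqr_ge0.
  by rewrite /K4; move: (2 * pi) => P; ring.
have h3 := hc r hr.
have h4 : 2 * pi * tau ^+ 2 = muE / 16.
  rewrite sqr_sqrtr; last by rewrite !divr_ge0 ?ltW.
  by rewrite mulrC divfK// gt_eqF.
have h5 : 2 * pi * (c * tau * g `^ q^-1 * s) `^ q = kappa * muE / 4 * b.
  rewrite (_ : c * tau * _ * s = c * tau * s * g `^ q^-1); last by rewrite mulrAC.
  rewrite powRM ?powR_ge0//; last by apply: ltW; rewrite !mulr_gt0.
  rewrite powRV_K ?(ltW g0)// -/b [b * g]mulrC mulrA; congr (_ * _).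
  by rewrite /g mulrC divfK// gt_eqF.
rewrite h5 h4.
have h6 : kappa * K4 = muE / 16 by rewrite /kappa divfK// gt_eqF.
move: (\int[mu]_(t in circ) _) (\int[mu]_(t in circ) _) (\int[mu]_(t in circ) _)
  (\int[mu]_(t in circ) _) h1 h2 h3 h6 => I4 I3 I2 I1 h1 h2 h3 h6.
move: (A^-1 * I1) (_ * I2) h1 h2 => X1 X2 h1 h2 H.
have h2' := ler_wpM2l (ltW k0) h2; rewrite h6 in h2'.
have h3' : kappa^-1 * I3 <= muE / 16 by rewrite mulrC ler_pdivrMr// mulrC.
have aux (m x y z w : R) : 0 < m -> m / 2 <= x -> y <= m / 16 -> z <= m / 16 ->
    x <= m / 16 + (y + (z + w)) -> m / 4 <= w by lra.
have h7 : muE / 4 <= kappa^-1 * (b^-1 * I4) := aux _ _ _ _ _ muE_gt0 h1 h2' h3' H.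
move: h7; rewrite -ler_pdivrMl ?invr_gt0// invrK -ler_pdivrMl ?invr_gt0// invrK.
by rewrite mulrC !mulrA.
Qed.

End LowerBound.

(** * The isomorphic copy of l2 *)

Section FixedCopy.
Variable R : realType.
Local Notation C := R[i].
Local Notation mu := (@lebesgue_measure R).

Let mc := @measurable_circ R.
Let fc := @mu_circ_fin R.

Lemma truncation_bound (x y w l k v e : R) : w <= 4 * (x + y) -> y <= k ->
  l <= w + v -> v + 4 * k = e -> l <= e + 4 * x.
Proof. lra. Qed.

Lemma inHp_one (p : R) : 1 <= p -> inHp p (fun=> 1 : C).
Proof.
move=> p1; have [] // := @Hnorm_le R p (fun=> 1) 1 p1 (analytic_cst 1) ler01.
move=> r _; rewrite powR1 mulr1 /pmean cabs1 powR1 rint_cst// mul1r.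
by rewrite (@fine_mu_circ R).
Qed.

Lemma mean_cabs_bounded (q : R) (u : C -> C) : 1 <= q -> inHp q u ->
  forall r, 0 <= r < 1 ->
    \int[mu]_(t in circ) cabs (u (r%:C * expi t)) <= 2 * pi * (1 + Hnorm q u `^ q).
Proof.
move=> q1 hu r hr; have [au _] := hu; have q0 : 0 <= q by rewrite (le_trans ler01).
have r1 := rbm_cst circ (1 : R); have r2 := rbm_pmean q0 au hr.
apply: (@le_trans _ _ (\int[mu]_(t in circ) (1 + cabs (u (r%:C * expi t)) `^ q))).
  apply: rint_le => //; [by apply: rbm_cabs; exact: cbm_analytic|exact: rbmD|].
  by move=> t _; apply: le_1DpowR => //; exact: cabs_ge0.
rewrite rintD// rint_cst// mul1r (@fine_mu_circ R) [X in _ <= X]mulrDr mulr1 lerD2l.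
exact: pmean_le_Hnorm.
Qed.

Variables (p q : R) (u phi : C -> C) (M : nat) (nk : nat -> nat) (d K : R).
Hypothesis p1 : 1 <= p.
Hypothesis q1 : 1 <= q.
Hypothesis M0 : (0 < M)%N.
Hypothesis pM : p <= (2 * M)%:R.
Hypothesis nk0 : (0 < nk 0)%N.
Hypothesis nkM : forall k, (M * nk k < nk k.+1)%N.
Hypothesis dphi : forall z, disc z -> disc (phi z).
Hypothesis hT : forall f, inHp p f -> inHp q (wcomp u phi f).
Hypothesis K_gt0 : 0 < K.
Hypothesis hK : forall f, inHp p f -> Hnorm q (wcomp u phi f) <= K * Hnorm p f.
Hypothesis d_gt0 : 0 < d.
Hypothesis hd : forall N (a : nat -> C), exists2 r : R, 0 <= r < 1 &
  2 * pi * (d * Num.sqrt (\sum_(k < N) cabs (a k) ^+ 2)) `^ q <=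
  \int[mu]_(t in circ) (cabs (u (r%:C * expi t)) *
     cabs (\sum_(k < N) a k * phi (r%:C * expi t) ^+ nk k)) `^ q.

Let J := @lacsum R nk.
Let T := wcomp u phi.
Let c2 : R := 1 + 2 * M`!%:R.

Let c2_gt0 : 0 < c2. Proof. by rewrite ltr_pwDl. Qed.

Let inJ (a : nat -> C) : in_l2 a -> inHp p (J a).
Proof. by move=> ha; have [] := lacsum_Hnorm M0 nk0 nkM p1 pM ha. Qed.

Let J_upper (a : nat -> C) : in_l2 a -> Hnorm p (J a) <= c2 * l2norm a.
Proof. by move=> ha; have [] := lacsum_Hnorm M0 nk0 nkM p1 pM ha. Qed.

Lemma image_lower_finite (a : nat -> C) N : in_l2 a -> (forall k, (N <= k)%N -> a k = 0) ->
  d * Num.sqrt (\sum_(k < N) cabs (a k) ^+ 2) <= Hnorm q (T (J a)).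
Proof.
move=> ha h; have [r hr hE] := hd N a.
apply: (Hnorm_ge q1 (hT (inJ ha)) hr); apply: (le_trans hE).
rewrite le_eqVlt; apply/orP; left; apply/eqP; apply: eq_Rintegral => t _.
by rewrite /T /wcomp cabsM /J (lacsum_finite nk h)//; apply: dphi; exact: disc_circle.
Qed.

(** [hd] covers finite sums only. The head of a, cut at a large N, obeys it; the tail has norm at
    most e and, the operator being bounded, an image of norm at most K c2 e. [X] is the total
    multiple of e that is lost, and the 4 is that of [HnormB]. *)
Lemma image_lower (a : nat -> C) : in_l2 a -> d * l2norm a <= 4 * Hnorm q (T (J a)).
Proof.
move=> ha; pose X := d + 4 * K * c2.
have X0 : 0 < X by rewrite addr_gt0// !mulr_gt0.
apply/ler_addgt0Pl => e0 e0_gt0; pose e := e0 / X; have e_gt0 : 0 < e by rewrite divr_gt0.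
have [N [n1 hb nb]] := l2_tail ha e_gt0.
set b := (fun k => if (k < N)%N then 0 else a k) in hb nb.
pose h k := a k - b k; have hh : in_l2 h := in_l2B ha hb.
have h0 k : (N <= k)%N -> h k = 0 by move=> Nk; rewrite /h /b ltnNge Nk subrr.
have hE : \sum_(k < N) cabs (h k) ^+ 2 = \sum_(k < N) cabs (a k) ^+ 2.
  by apply: eq_bigr => k _; rewrite /h /b ltn_ord subr0.
have := image_lower_finite hh h0; rewrite hE.
have -> : T (J h) = fun z => T (J a) z - T (J b) z.
  apply/funext => z; rewrite /T /wcomp -mulrBr; congr (_ * _).
  rewrite -[X in _ = X](_ : J a (phi z) + -1 * J b (phi z) = _); last by rewrite mulN1r.
  rewrite -(lacsum_lin M0 nk0 nkM)//; congr (J _ _).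
  by apply/funext => k; rewrite /h mulN1r.
have [_ H1] := HnormB q1 (hT (inJ ha)) (hT (inJ hb)).
move=> /le_trans/(_ H1) H2.
have H3 : Hnorm q (T (J b)) <= K * (c2 * e).
  apply: (le_trans (hK (inJ hb))); rewrite ler_pM2l//.
  by apply: (le_trans (J_upper hb)); rewrite ler_pM2l.
have H4 := ler_wpM2l (ltW d_gt0) n1; rewrite mulrDr in H4.
have H5 : d * e + 4 * (K * (c2 * e)) = e0.
  by rewrite -[e0](@divfK _ X) ?gt_eqF// -/e /X; ring.
exact: truncation_bound H2 H3 H4 H5.
Qed.

Lemma fixes_copy : fixes_copy_of_l2 p q u phi.
Proof.
(* The lower bound for J follows from that of its image: d |a| <= 4 |T J a| <= 4 K |J a| in the
   respective norms. *)
have c1_gt0 : 0 < d / (4 * K) by rewrite divr_gt0// mulr_gt0.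
have J_lower a : in_l2 a -> d / (4 * K) * l2norm a <= Hnorm p (J a).
  move=> ha; rewrite mulrAC ler_pdivrMr ?mulr_gt0//.
  apply: (le_trans (image_lower ha)); rewrite [X in _ <= X]mulrCA.
  by rewrite ler_pM2l// mulrC; exact: hK (inJ ha).
have JD a b : in_l2 a -> in_l2 b ->
    J (fun n => a n + b n) = fun z => J a z + J b z.
  move=> ha hb; apply/funext => z.
  rewrite -[X in _ = _ + X]mul1r -(lacsum_lin M0 nk0 nkM)//; congr (J _ _).
  by apply/funext => k; rewrite mul1r.
have JZ (x : C) a : in_l2 a -> J (fun n => x * a n) = fun z => x * J a z.
  move=> ha; apply/funext => z; have h0 := @in_l2Z R 0 a ha.
  have z0 : (fun n => 0 * a n) = (fun=> 0) by apply/funext => n; rewrite mul0r.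
  rewrite z0 in h0; rewrite -[RHS]add0r -[X in _ = X + _](lacsum0 nk z).
  rewrite -(lacsum_lin M0 nk0 nkM)//; congr (J _ _).
  by apply/funext => k; rewrite add0r.
have JB a b : in_l2 a -> in_l2 b ->
    J (fun n => a n - b n) = fun z => J a z - J b z.
  move=> ha hb; rewrite (_ : (fun n => _) = fun n => a n + -1 * b n).
    rewrite JD ?JZ//; last exact: in_l2Z.
    by apply/funext => z; rewrite mulN1r.
  by apply/funext => k; rewrite mulN1r.
exists (J @` (@in_l2 R)), J; split=> //; split=> //; split=> //; split=> //; split.
  by exists (d / (4 * K)), c2; split=> //; split=> // a ha; split; [exact: J_lower|exact: J_upper].
split; first exact: closed_l2_range p1 c1_gt0 c2_gt0 inJ JB J_lower J_upper.
exists (d / (4 * c2)); split; first by rewrite divr_gt0// mulr_gt0.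
move=> _ [a ha <-]; rewrite mulrAC ler_pdivrMr ?mulr_gt0//.
apply: (le_trans (ler_wpM2l (ltW d_gt0) (J_upper ha))).
rewrite mulrCA [X in _ <= X]mulrC -mulrA [X in _ <= X]mulrCA ler_pM2l//.
exact: image_lower.
Qed.

End FixedCopy.

Theorem theorem1p2 (R : realType) (p q : R) (u phi : R[i] -> R[i]) :
  1 <= q -> q <= p ->
  analytic_on_disc u -> analytic_on_disc phi ->
  (forall z, disc z -> disc (phi z)) ->
  wcomp_bounded p q u phi ->
  (exists z, disc z /\ u z != 0) ->
  (0 < circ_measure (contact_set phi))%E ->
  fixes_copy_of_l2 p q u phi.
Proof.
move=> q1 qp au aphi dphi [hT [K hK]] u0 hE; have p1 := le_trans q1 qp.
(* u is the image of the constant function 1; this yields the bound on the means of |u| that the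
   small-set estimate uses. *)
have hu : inHp q u.
  have := hT _ (inHp_one p1); congr (inHp q _).
  by apply/funext => z; rewrite /wcomp mulr1.
(* M >= 2 gives the fourth moment of J a o phi, and 2 M >= p the even moment that controls the H^p
   norm of J a. *)
pose M := maxn 2 (Num.trunc p).+1.
have M2 : (1 < M)%N by rewrite leq_maxl.
have pM : p <= (2 * M)%:R.
  apply: (@le_trans _ _ M%:R); last by rewrite ler_nat leq_pmull.
  apply: (@le_trans _ _ (Num.trunc p).+1%:R); last by rewrite ler_nat leq_maxr.
  by rewrite ltW// truncnS_gt.
have [nk [d [nk0 nkM d0 hd]]] := weighted_lower q1 au aphi dphi u0
  (mean_cabs_bounded q1 hu) M2 (contact_measure aphi hE).
have K0 : 0 < Num.max K 1 by rewrite lt_max ltr01 orbT.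
apply: (@fixes_copy R p q u phi M nk d _ p1 q1 (ltnW M2) pM nk0 nkM dphi hT K0 _ d0 hd).
move=> f hf; apply: (le_trans (hK f hf)).
by apply: ler_wpM2r; [exact: Hnorm_ge0|rewrite le_max lexx].
Qed.
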